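(* Fix positive integers $k,d_1,\dots,d_k$. Let $q$ be a prime power, and independently for each $i\in[k]$ let $f_i$ be uniform on $\mathbb{F}_q[X_1,\dots,X_k]_{\le d_i}$. Then \[\mathbb{P}\Big(\big|V(f_1,\dots,f_k)\cap\mathbb{F}_q^k\big|=\prod_{i=1}^k d_i\Big)\ge\frac{1-c\,q^{-1/2}}{\big(\prod_{i=1}^k d_i\big)!}\] for some constant $c=c(d_1,\dots,d_k)>0$ independent of $q$.
   Context: $\mathbb{F}_q[X_1,\dots,X_k]_{\le d}$ is the set of $k$-variate polynomials over $\mathbb{F}_q$ of total degree at most $d$, sampled uniformly by choosing all coefficients independently and uniformly. $V(f_1,\dots,f_k)=\{x\in\overline{\mathbb{F}}_q^{\,k}: f_1(x)=\cdots=f_k(x)=0\}$, so $V(f_1,\dots,f_k)\cap\mathbb{F}_q^k$ is the set of common zeros with all coordinates in $\mathbb{F}_q$. *)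

(* Defs.v *)
From Stdlib Require Import Reals.
From mathcomp Require Import all_boot all_algebra all_field.
From mathcomp Require Import mpoly.

Unset Printing Implicit Defensive.
Import GRing.Theory.

(* Coefficient vectors of k-variate polynomials of total degree <= d over F:
   one coefficient for each monomial of total degree < d.+1. *)
Definition coeffs (F : finFieldType) (k d : nat) := {ffun 'X_{1..k < d.+1} -> F}.

Definition poly_of (F : finFieldType) (k d : nat) (c : coeffs F k d) : {mpoly F[k]} :=
  (\sum_(m : 'X_{1..k < d.+1}) c m *: 'X_[m])%R.

Definition sample (F : finFieldType) (k : nat) (d : 'I_k -> nat) :=
  {dffun forall i : 'I_k, coeffs F k (d i)}.

Definition Fzeros (F : finFieldType) (k : nat) (d : 'I_k -> nat) (w : sample F k d)
  : {set {ffun 'I_k -> F}} :=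
  [set x : {ffun 'I_k -> F} | [forall i : 'I_k, (@poly_of F k (d i) (w i)).@[x] == 0%R]].

Definition prob_exact (F : finFieldType) (k : nat) (d : 'I_k -> nat) : R :=
  Rdiv (INR #|[set w : sample F k d | #|@Fzeros F k d w| == (\prod_(i < k) d i)%N]|)
       (INR #|[set: sample F k d]|).

(* Main.v *)
Require Import Defs.
From Stdlib Require Import Reals.
From Stdlib Require Classical_Prop Lra.
From mathcomp Require Import all_boot all_algebra all_field.
From mathcomp Require Import fingroup perm pgroup mpoly.
From mathcomp Require Import zify ring.
From mathcomp Require polyXY.
Set Implicit Arguments. Unset Strict Implicit. Unset Printing Implicit Defensive.
Import GRing.Theory Pdiv.RingMonic Pdiv.Ring.
Local Open Scope ring_scope.

(* Let [w] be the system whose [i]-th equation is [\prod_(c < d i) ('X_i - a i c)], with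
   [D = \prod_i d i] distinct rational zeros, and restrict to a line [w + t v]. Elimination over
   [F[t]] represents the multiplication by a separating linear form on the [D] monomials [X ^ b],
   [b i < d i], by a matrix whose characteristic polynomial [P (t, Y)] has [D] distinct rational
   roots at [t = 0]. Whenever [P (t, _)] has [D] distinct rational roots and the elimination
   determinant is nonzero at [t], the system [w + t v] has exactly [D] rational zeros.

   The number of such [t] is at least [(q - O(sqrt q)) / D!]. Take an indecomposable factor [Q] of
   the Galois resolvent of [P], whose roots are the [\sum_j lam j * eta (s j)] for the permutations
   [s] of the roots [eta] of [P]. As [Q] has a simple rational root at [t = 0], only [deg Q]
   permutations can act as the Frobenius at more than [O(1)] of the points of [Q] over the
   rational [t], and Stepanov's method bounds the number of these points by [q + O(sqrt q)] for
   each of them. There are [q deg Q - O(1)] points in all, so the identity is the Frobenius at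
   [q - O(sqrt q)] of them at least; below such a point, [P (t, _)] splits.

   Finally average over [v]: for [t <> 0] the map [v |-> w + t v] is a bijection. *)

(** * Choice of parameters in the Stepanov argument *)

(** The final constant may depend on [d] but not on [q], so every degree is bounded in terms of [d]
    alone; hence the quasi-homogeneous weights in the Stepanov argument and the elimination by one
    explicit matrix of fixed size. The resolvent replaces [P] because all conjugates of one of its
    roots are quotients [G / H] of polynomials in that root. The condition that a permutation acts
    as the Frobenius becomes the equation [H z ^ q = G], the shape that Stepanov's method handles.
    Stepanov's method only bounds from above. The lower bound for the identity comes from knowing
    the total: each good [t] carries [deg Q] points, and the [deg Q - 1] other permutations that
    matter take about [q] points each. The factor [D!] is the bound on [deg Q], the number of points
    above one split [t]. The rational branch at [t = 0] does the work of absolute irreducibility: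
    its valuations keep the auxiliary polynomial from vanishing, and indecomposability over the
    finite field makes norms nonzero. Orders of vanishing are read off truncated branches rather
    than derivatives, so small characteristic does no harm. Small [q] is absorbed by the
    constant. *)

Definition stepanov_const (m kap g : nat) : nat :=
  let K := (kap * m.+1)%N in let C1 := (2 * (2 * K * m.+1 + 2))%N in
  let s0 := (m.+1 * K + C1 + m.+1 * g * m + 3 * m.+1 * (2 * K + 1) + 1)%N in
  (3 * (C1 + 1 + m.+1 * K) + 4 * m.+1 * s0)%N.

(* The elementary estimates, with [K], [C1] and [s0] as in [stepanov_const]. *)
Lemma stepanov_arith_aux (mm m K g C1 s0 q s N : nat) : (0 < mm)%N -> (1 < q)%N -> (0 < s)%N ->
  (s * s <= q)%N -> (q < s.+1 * s.+1)%N -> (s0 <= s)%N ->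
  C1 = (2 * (2 * (K * mm) + 2))%N ->
  (mm * K + C1 + mm * g * m + 3 * (mm * (2 * K + 1)) + 1 <= s0)%N ->
  (forall a b M, (mm * (a + 2 * K) < q)%N -> (M <= q)%N ->
    (M * (mm * (a + K + 2 * K * M + (b + g * m) + 1)) < (mm * b.+1) * (mm * a.+1))%N ->
    (M * N <= mm * (a + K + (b + K) * q + K))%N) ->
  (N <= q + 3 * (C1 + 1 + mm * K) * s)%N.
Proof.
move=> mm0 q1 s1 hs1 hs2 hs hC1 hs0 core.
(* The box argument is balanced by [M = s], [b ~ s / mm] and [a ~ q / mm]. *)
pose b := ((s + C1) %/ mm)%N; pose a := ((q.-1) %/ mm - 2 * K - 1)%N.
have hb1 : (mm * b <= s + C1)%N by rewrite mulnC leq_divM.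
have hb2 : (s + C1 < mm * b.+1)%N by rewrite mulnC ltn_ceil.
have ha0 : (mm * (q.-1 %/ mm) <= q.-1)%N by rewrite mulnC leq_divM.
have ha1 : (q.-1 < mm * (q.-1 %/ mm).+1)%N by rewrite mulnC ltn_ceil.
have hq : (s0 * s <= q)%N by apply: leq_trans hs1; rewrite leq_mul2r hs orbT.
have hq2 : (2 * (mm * (2 * K + 1)) + mm < q)%N.
  have h1 : (s0 <= s0 * s)%N by rewrite leq_pmulr.
  have h2 : (mm <= mm * (2 * K + 1))%N by rewrite leq_pmulr // addn1.
  by clear -h1 h2 hq hs0; lia.
move: (q.-1 %/ mm)%N @a ha0 ha1 => X a ha0 ha1.
have haK : (2 * K + 1 <= X)%N.
  rewrite leqNgt; apply/negP => h.
  have h1 : (mm * X.+1 <= mm * (2 * K + 1))%N by rewrite leq_mul2l h orbT.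
  by clear -h1 ha1 hq2; lia.
have ha2 : (mm * (a + 2 * K) < q)%N.
  have -> : (a + 2 * K = X.-1)%N by clear -haK; rewrite /a; lia.
  have h1 : (mm * X.-1 <= mm * X)%N by rewrite leq_mul2l leq_pred orbT.
  by clear -h1 ha0 q1; lia.
have ha3 : (q <= 2 * (mm * a.+1))%N.
  have -> : (a.+1 = X - 2 * K)%N by clear -haK; rewrite /a; lia.
  by rewrite mulnBr; clear -ha1 hq2; lia.
have sq : (s <= q)%N by apply: leq_trans hs1; rewrite leq_pmulr.
have {}core := core a b s ha2 sq.
move: b hb1 hb2 core => b hb1 hb2 core.
move: a ha2 ha3 core => a ha2 ha3 core.
have key : (s * (mm * (K + 2 * K * s + b + g * m)) <= C1 * (mm * a.+1))%N.
  have e1 : ((2 * (K * mm) + 2) * q <= C1 * (mm * a.+1))%N.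
    by rewrite hC1 [(2 * (2 * (K * mm) + 2))%N]mulnC -mulnA leq_mul.
  apply: leq_trans e1.
  have e2 : (s * (mm * b) <= s * (s + C1))%N by rewrite leq_mul2l hb1 orbT.
  have e3 : (s * (mm * K + C1 + mm * g * m) <= s0 * s)%N.
    by rewrite mulnC leq_mul2r; apply/orP; right; clear -hs0; lia.
  have e4 : (K * mm * (s * s) <= K * mm * q)%N by rewrite leq_mul2l hs1 orbT.
  by clear -e2 e3 e4 hq hs1; lia.
have c3 : (s * (mm * (a + K + 2 * K * s + (b + g * m) + 1)) < (mm * b.+1) * (mm * a.+1))%N.
  have e1 : ((s + C1).+1 * (mm * a.+1) <= (mm * b.+1) * (mm * a.+1))%N by rewrite leq_mul2r hb2 orbT.
  apply: leq_trans e1.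
  by clear -key mm0; lia.
have {core} := core c3 => core.
(* Dividing by [s] leaves [N <= q + (C1 + 1 + mm * K) * q / s], and [q <= 3 * s * s] makes the error
   linear in [s]. *)
have e1 : (s * N <= q + (s + C1) * q + mm * K * q)%N.
  have h1 : (mm * b * q <= (s + C1) * q)%N by rewrite leq_mul2r hb1 orbT.
  by clear -core h1 ha2; lia.
have e2 : (q <= 3 * (s * s))%N by clear -hs2 s1; nia.
have e3 : ((C1 + 1 + mm * K) * q <= (C1 + 1 + mm * K) * (3 * (s * s)))%N by rewrite leq_mul2l e2 orbT.
by rewrite -(leq_pmul2l s1); clear -e1 e3; lia.
Qed.

Lemma stepanov_arith m kap g q s N (mm := m.+1) :
  (1 < q)%N -> (s * s <= q)%N -> (q < s.+1 * s.+1)%N ->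
  (forall a b M, (mm * (a + 2 * kap * mm) < q)%N -> (M <= q)%N ->
    (M * (mm * (a + kap * mm + 2 * kap * mm * M + (b + g * m) + 1)) < (mm * b.+1) * (mm * a.+1))%N ->
    (M * N <= mm * (a + kap * mm + (b + kap * mm) * q + kap * mm))%N) ->
  (N <= mm * q)%N -> (N <= q + stepanov_const m kap g * s)%N.
Proof.
move=> q1 hs1 hs2 core triv; rewrite /stepanov_const -/mm.
have s1 : (0 < s)%N by case: s hs2 {hs1}; lia.
have mm0 : (0 < mm)%N by [].
set K := (kap * mm)%N; set C1 := (2 * _)%N; set s0 := (_ + 3 * mm * (2 * K + 1) + 1)%N.
(* Below [s0] the trivial bound is enough: [q < s.+1 * s.+1 <= 4 * s * s] gives
   [mm * q <= 4 * mm * s0 * s], the second summand of the constant. *)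
have [hs|hs] := ltnP s s0.
  apply: (leq_trans triv).
  have h1 : (mm * q <= mm * (4 * (s0 * s)))%N.
    rewrite leq_mul2l; apply/orP; right; clear -hs2 hs s1; move: s0 hs => s0 hs; nia.
  apply: (leq_trans h1); rewrite mulnDl addnA (leq_trans _ (leq_addl _ _)) //.
  by rewrite -!mulnA [(mm * (4 * _))%N]mulnCA leqnn.
have h := @stepanov_arith_aux mm m K g C1 s0 q s N mm0 q1 s1 hs1 hs2 hs.
rewrite mulnDl addnA; apply: leq_trans (leq_addr _ _); apply: h.
- by rewrite /C1 mulnA.
- by rewrite /s0 !mulnA.
- move=> a b M h1 h2 h3; apply: core => //; rewrite -?[(2 * kap * mm)%N]mulnA //.
Qed.

(** * Weights of polynomials in two and three variables *)

Lemma sum_neq0 (V : nmodType) (I : finType) (P : pred I) (E : I -> V) :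
  \sum_(i | P i) E i != 0 -> exists2 i, P i & E i != 0.
Proof.
move=> h; case: (boolP [exists i, P i && (E i != 0)]) => [/existsP[i /andP[? ?]]|]; first by exists i.
rewrite negb_exists => /forallP h'; case/eqP: h; apply: big1 => i Pi.
by have := h' i; rewrite Pi /= negbK => /eqP.
Qed.

Lemma coefM_neq0 (R : nzRingType) (p q : {poly R}) n :
  (p * q)`_n != 0 -> exists a b, n = (a + b)%N /\ p`_a * q`_b != 0.
Proof.
rewrite coefM => /sum_neq0[i _ h]; exists i, (n - i)%N; split=> //.
by rewrite subnKC // -ltnS.
Qed.

Lemma coefD_neq0 (R : nzRingType) (p q : {poly R}) n :
  (p + q)`_n != 0 -> p`_n != 0 \/ q`_n != 0.
Proof.
rewrite coefD; case: (eqVneq p`_n 0) => [->|]; last by left.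
by rewrite add0r; right.
Qed.

Section Weights.
Variables (R : comNzRingType) (kap c : nat).
Notation P2 := {poly {poly R}}.
Notation P3 := {poly {poly {poly R}}}.

(* The monomial [t^i Y^j] has weight [i + kap * j], and [tau] has weight [-c]. *)
Definition wt2 (n : nat) (u : P2) :=
  forall j i, u`_j`_i != 0 -> (i + kap * j <= n)%N.

Definition wt3 (n : int) (U : P3) :=
  forall l j i, U`_l`_j`_i != 0 -> (i%:Z + (kap * j)%:Z - (c * l)%:Z <= n).

Lemma wt2_le n n' u : (n <= n')%N -> wt2 n u -> wt2 n' u.
Proof. by move=> h hu j i /hu; lia. Qed.

Lemma wt3_le n n' U : n <= n' -> wt3 n U -> wt3 n' U.
Proof. by move=> h hu l j i /hu; lia. Qed.

Lemma wt2_0 n : wt2 n 0.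
Proof. by move=> j i; rewrite !coef0 eqxx. Qed.

Lemma wt3_0 n : wt3 n 0.
Proof. by move=> l j i; rewrite !coef0 eqxx. Qed.

Lemma wt2D n u v : wt2 n u -> wt2 n v -> wt2 n (u + v).
Proof.
move=> hu hv j i; rewrite coefD => /coefD_neq0[/hu|/hv] //.
Qed.

Lemma wt3D n u v : wt3 n u -> wt3 n v -> wt3 n (u + v).
Proof.
by move=> hu hv l j i; rewrite !(coefD _ _ l, coefD _ _ j) => /coefD_neq0[/hu|/hv].
Qed.

Lemma wt2N n u : wt2 n u -> wt2 n (- u).
Proof. by move=> hu j i; rewrite !coefN oppr_eq0 => /hu. Qed.

Lemma wt3N n u : wt3 n u -> wt3 n (- u).
Proof. by move=> hu l j i; rewrite !coefN oppr_eq0 => /hu. Qed.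

Lemma coefM2_neq0 (u v : P2) j i : (u * v)`_j`_i != 0 ->
  exists a b a' b', [/\ j = (a + b)%N, i = (a' + b')%N, u`_a`_a' != 0 & v`_b`_b' != 0].
Proof.
rewrite coefM coef_sum => /sum_neq0[a _ /coefM_neq0[a' [b' [-> h]]]].
exists a, (j - a)%N, a', b'; split=> //; first by rewrite subnKC // -ltnS.
  by apply: contraNneq h => ->; rewrite mul0r.
by apply: contraNneq h => ->; rewrite mulr0.
Qed.

Lemma wt2M n m u v : wt2 n u -> wt2 m v -> wt2 (n + m) (u * v).
Proof.
by move=> hu hv j i /coefM2_neq0[a [b [a' [b' [-> -> /hu h1 /hv h2]]]]]; lia.
Qed.

Lemma wt3M n m u v : wt3 n u -> wt3 m v -> wt3 (n + m) (u * v).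
Proof.
move=> hu hv l j i; rewrite coefM !coef_sum => /sum_neq0[a _].
have hl : (l = a + (l - a))%N by rewrite subnKC // -ltnS.
move: (l - a)%N hl => b hl.
move=> /coefM2_neq0[a1 [b1 [a' [b' [-> -> /hu h1 /hv h2]]]]].
rewrite hl; lia.
Qed.

Lemma wt2_sum n (I : Type) (r : seq I) (P : pred I) E :
  (forall i, P i -> wt2 n (E i)) -> wt2 n (\sum_(i <- r | P i) E i).
Proof. by move=> h; elim/big_ind: _ => //; [apply: wt2_0|move=> u v; apply: wt2D]. Qed.

Lemma wt3_sum n (I : Type) (r : seq I) (P : pred I) E :
  (forall i, P i -> wt3 n (E i)) -> wt3 n (\sum_(i <- r | P i) E i).
Proof. by move=> h; elim/big_ind: _ => //; [apply: wt3_0|move=> u v; apply: wt3D]. Qed.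

Lemma wt2_1 n : wt2 n 1.
Proof.
move=> j i; rewrite coef1; case: j => [|j] /=; last by rewrite coef0 eqxx.
by rewrite coef1; case: i => [|i] /=; rewrite ?eqxx // muln0.
Qed.

Lemma wt2X n k u : wt2 n u -> wt2 (n * k) (u ^+ k).
Proof.
move=> h; elim: k => [|k IH]; first by rewrite expr0; apply: wt2_1.
by rewrite exprS mulnS; apply: wt2M.
Qed.

Lemma wt3C (n : nat) u : wt2 n u -> wt3 n u%:P.
Proof.
move=> h [|l] j i; rewrite coefC /=; last by rewrite !coef0 eqxx.
by move/h; lia.
Qed.

Lemma wt3X_nat n k U : wt3 n U -> wt3 (n * k%:Z) (U ^+ k).
Proof.
move=> h; elim: k => [|k IH]; first by rewrite expr0 mulr0; apply: (@wt3C 0 1 (@wt2_1 0)).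
by rewrite exprS; apply: wt3_le (wt3M h IH); lia.
Qed.

Lemma wt3_tau : wt3 (- c%:Z) 'X.
Proof.
move=> l j i; rewrite coefX; case: (l =P 1%N) => [->|] /=; last by rewrite !coef0 eqxx.
rewrite coef1; case: j => [|j]/=; last by rewrite coef0 eqxx.
by rewrite coef1; case: i => [|i] /=; rewrite ?eqxx //; lia.
Qed.

Lemma wt2_Y : wt2 kap 'X.
Proof.
move=> j i; rewrite coefX; case: (j =P 1%N) => [->|] /=; last by rewrite !coef0 eqxx.
by rewrite coef1; case: i => [|i] /=; rewrite ?eqxx //; lia.
Qed.

Lemma wt2C n (p : {poly R}) : (size p <= n.+1)%N -> wt2 n p%:P.
Proof.
move=> h [|j] i; rewrite coefC /=; last by rewrite coef0 eqxx.
move=> h'; have : (i < size p)%N by rewrite ltnNge; apply: contraNN h' => /leq_sizeP ->.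
lia.
Qed.

Lemma wt2_size n (u : P2) (j : nat) : wt2 n u -> (size (u`_j)%R <= n.+1)%N.
Proof.
move=> h; apply/leq_sizeP => i hi; apply/eqP; apply: contraTT hi => /h; lia.
Qed.

Lemma wt2_nderiv n k u : wt2 n u -> wt2 n (u^`N(k)).
Proof.
move=> h j i; rewrite coef_nderivn coefMn => h'.
have : u`_(k + j)`_i != 0 by apply: contraNneq h' => ->; rewrite mul0rn.
by move/h; nia.
Qed.

(** The truncated subtraction is harmless: for [n < kap] no term of positive degree in [Y] fits the
    weight, and the derivative is zero. *)
Lemma wt2_deriv n u : wt2 n u -> wt2 (n - kap) (u^`()).
Proof.
move=> h j i; rewrite coef_deriv coefMn => h'.
have : u`_(j.+1)`_i != 0 by apply: contraNneq h' => ->; rewrite mul0rn.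
by move/h; lia.
Qed.

(** This is the price of a Taylor coefficient: each order in [tau] costs [c] in degree, which is
    where [2 * kap * mm * M] in the Stepanov count comes from. *)
Lemma wt3_coef (n : nat) U l : wt3 n U -> wt2 (n + c * l) (U`_l).
Proof. by move=> h j i /h; lia. Qed.

End Weights.

(** * Formal branches of a plane curve *)

Lemma horner_sub_dvd (R : comNzRingType) (p : {poly R}) x y :
  exists r, p.[x] - p.[y] = (x - y) * r.
Proof.
elim/poly_ind: p => [|p a [r IH]]; first by exists 0; rewrite !horner0; ring.
exists (r * x + p.[y]); rewrite !hornerMXaddC.
have -> : p.[x] = p.[y] + (x - y) * r by rewrite -IH; ring.
ring.
Qed.

Section Hensel.
Variables (R : comNzRingType) (kap m : nat) (Q : {poly {poly R}}).
Notation P2 := {poly {poly R}}.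
Notation P3 := {poly {poly {poly R}}}.
Hypothesis wtQ : wt2 kap (kap * m) Q.
Let c := (2 * kap * m)%N.
Let del : P2 := Q^`().

(* [shift Z] is the substitution [t := t + del ^ 2 tau], [Y := Y + del Z (tau)]. Scaling the
   local parameter by [del ^ 2] lets the Newton iteration for a root of [Q] run without
   denominators, so that weights can be tracked. *)
Definition shiftT : P3 := 'X%:P%:P + (del ^+ 2)%:P * 'X.
Definition shift_coef : {rmorphism {poly R} -> P3} :=
  horner_eval shiftT \o map_poly (polyC \o polyC \o polyC).
Definition shiftY (Z : P3) : P3 := 'X%:P + del%:P * Z.
Definition shift (Z : P3) : {rmorphism P2 -> P3} :=
  horner_eval (shiftY Z) \o map_poly shift_coef.

(** The divided difference of [p] between [shiftT] and [t]. *)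
Let rho (p : {poly R}) : P3 :=
  \sum_(i < size p) (p`_i)%:P%:P%:P * \sum_(a < i) shiftT ^+ (i.-1 - a) * 'X%:P%:P ^+ a.

Lemma wt_shiftT : wt3 kap c 1 shiftT.
Proof.
apply: wt3D.
  apply: (@wt3C _ _ _ 1); apply: wt2C; by rewrite size_polyX.
have h := wt3M (wt3C c (wt2X (k:=2) (wt2_deriv wtQ))) (@wt3_tau R kap c).
apply: wt3_le h; rewrite /c; nia.
Qed.

Lemma shift_coefE p : shift_coef p = p%:P%:P + (del ^+ 2)%:P * ('X * rho p).
Proof.
have tE : p%:P%:P = (map_poly (polyC \o polyC \o polyC) p).['X%:P%:P] :> P3.
  rewrite -[LHS](_ : (polyC \o polyC) p = _) // -{1}[p]comp_polyXr /comp_poly.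
  by rewrite -horner_map -map_poly_comp.
rewrite tE /= /horner_eval !horner_coef.
rewrite (size_map_inj_poly (f := polyC \o polyC \o polyC)) //; last first.
  by move=> x y /= /polyC_inj/polyC_inj/polyC_inj.
rewrite /rho !mulr_sumr -big_split; apply: eq_bigr => i _.
rewrite coef_map /=; set a := (p`_i)%:P%:P%:P.
have := subrXX shiftT 'X%:P%:P i; set S := \sum_(_ < _) _ => h.
have -> : shiftT ^+ i = 'X%:P%:P ^+ i + (shiftT - 'X%:P%:P) * S by rewrite -h; ring.
have -> : shiftT - 'X%:P%:P = (del ^+ 2)%:P * 'X by rewrite /shiftT; ring.
ring.
Qed.

Lemma wt_rho n (p : {poly R}) : (size p <= n.+1)%N -> wt3 kap c n (rho p).
Proof.
move=> h; apply: wt3_sum => i _.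
apply: (@wt3_le _ _ _ (0%N%:Z + n)); first by lia.
apply: wt3M; first by apply: wt3C; apply: wt2C; apply: size_polyC_leq1.
apply: wt3_sum => a _.
have wX : wt2 kap 1 ('X%:P : P2) by apply: wt2C; rewrite size_polyX.
have w := wt3M (wt3X_nat (k:=i.-1 - a) wt_shiftT) (wt3X_nat (k:=a) (wt3C c wX)).
apply: wt3_le w.
have := ltn_ord a; have := ltn_ord i; lia.
Qed.

(** [Q1p] is the divided difference of [Q] in the [t] direction, and [T2p] collects its Taylor terms
    in [Y] of order at least two. The substituted [Q] is then
    [Q + del ^ 2 (Z + tau Q1p + Z ^ 2 T2p)]: the term linear in [Z] has coefficient [del * del], so
    [del ^ 2] factors out, and a root is a fixed point of [step]. *)
Let Q1p : {poly P3} := \poly_(j < size Q) rho Q`_j.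
Let T2p : {poly P3} := \poly_(i < size Q) (Q^`N(i.+2))%:P.
Let step (Z : P3) : P3 := - ('X * Q1p.[shiftY Z] + Z ^+ 2 * T2p.[del%:P * Z]).

Lemma shiftE Z (u : P2) :
  shift Z u = \sum_(j < size u) shift_coef u`_j * shiftY Z ^+ j.
Proof.
have -> : shift Z u = (map_poly shift_coef u).[shiftY Z] by [].
rewrite (@horner_coef_wide _ (size u)) ?size_poly //.
by apply: eq_bigr => i _; rewrite coef_map.
Qed.

Lemma shiftQ Z : shift Z Q = Q%:P + (del ^+ 2)%:P * (Z - step Z).
Proof.
have E1 : shift Z Q = (map_poly (polyC \o polyC) Q).[shiftY Z] + (del ^+ 2)%:P * ('X * Q1p.[shiftY Z]).
  rewrite shiftE [Q1p.[_]]horner_poly.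
  rewrite (@horner_coef_wide _ (size Q) (map_poly (polyC \o polyC) Q)) ?size_poly //.
  rewrite !mulr_sumr -big_split; apply: eq_bigr => i _.
  by rewrite coef_map shift_coefE mulrDl; congr (_ + _); rewrite !mulrA.
rewrite E1 /step opprK.
have -> : (map_poly (polyC \o polyC) Q).[shiftY Z] =
   Q%:P + (del ^+ 2)%:P * Z + (del ^+ 2)%:P * (Z ^+ 2 * T2p.[del%:P * Z]); last by ring.
have evY u : (map_poly (polyC \o polyC) u).['X%:P] = u%:P :> P3.
  rewrite -[in RHS](comp_polyXr u) /comp_poly -horner_map -map_poly_comp.
  by congr (_.[_]).
rewrite (@nderiv_taylor_wide _ (size Q).+2); last 2 first.
- exact: mulrC.
- by rewrite (leq_trans (size_poly _ _)) // -addn2 leq_addr.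
rewrite !big_ord_recl /= !nderivn_map !evY poly.nderivn0 poly.nderivn1 expr0 mulr1 /bump /= !add1n expr1 -/del.
rewrite addrA; congr (_ + _); first by rewrite expr2 polyCM; ring.
rewrite horner_poly !mulr_sumr; apply: eq_bigr => i _.
rewrite nderivn_map evY !add1n polyCM -[i.+2]addn2 exprD.
set Zi := (_ ^+ i); set A := (_%:P : P3) in Zi *; set B := (_%:P) ; ring.
Qed.

Lemma wt_shiftY Z : wt3 kap c (- (kap * m)%:Z) Z -> wt3 kap c kap (shiftY Z).
Proof.
move=> wZ; apply: wt3D; first exact: wt3C (@wt2_Y _ _).
apply: wt3_le (wt3M (wt3C c (wt2_deriv wtQ)) wZ); lia.
Qed.

Lemma wt2_coef_split n (u : P2) (j : nat) : wt2 kap n u ->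
  u`_j = 0 \/ exists2 b : nat, (size (u`_j)%R <= b.+1)%N & (b + kap * j <= n)%N.
Proof.
move=> wu; have [->|nz] := eqVneq u`_j 0; first by left.
right; exists (size u`_j).-1; first by case: (size _).
apply: wu; by rewrite -/(lead_coef _) lead_coef_eq0.
Qed.

Lemma wt_shift_coef n (p : {poly R}) : (size p <= n.+1)%N -> wt3 kap c n (shift_coef p).
Proof.
move=> h; have -> : shift_coef p = (map_poly (polyC \o polyC \o polyC) p).[shiftT] by [].
rewrite (@horner_coef_wide _ (size p)) ?size_poly //.
apply: wt3_sum => i _; rewrite coef_map.
have w0 : wt2 kap 0 (p`_i)%:P%:P by apply: wt2C; apply: size_polyC_leq1.
have w := wt3M (wt3C c w0) (wt3X_nat (k:=i) wt_shiftT).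
apply: wt3_le w; have := ltn_ord i; lia.
Qed.

Lemma wt_shift n u Z : wt3 kap c (- (kap * m)%:Z) Z -> wt2 kap n u -> wt3 kap c n (shift Z u).
Proof.
move=> wZ wu; rewrite shiftE; apply: wt3_sum => j _.
case: (wt2_coef_split j wu) => [->|[b hb hn]]; first by rewrite rmorph0 mul0r; apply: wt3_0.
apply: (@wt3_le _ _ _ (b%:Z + kap * (j : nat))); first by lia.
by apply: wt3M; [exact: wt_shift_coef|exact: wt3X_nat (wt_shiftY wZ)].
Qed.

(** The weight [- kap * m] reproduces itself: [tau] and [Z ^ 2] both have weight [- 2 * kap * m],
    and their cofactors have weight at most [kap * m]. This dictates the value of [c]. *)
Lemma wt_step Z : wt3 kap c (- (kap * m)%:Z) Z -> wt3 kap c (- (kap * m)%:Z) (step Z).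
Proof.
move=> wZ; apply: wt3N; apply: wt3D.
  apply: (@wt3_le _ _ _ (- c%:Z + (kap * m)%N)); first by rewrite /c; lia.
  apply: wt3M; first exact: wt3_tau.
  rewrite horner_poly; apply: wt3_sum => j _.
  case: (wt2_coef_split j wtQ) => [->|[b hb hn]].
    by rewrite /rho size_poly0 big_ord0 mul0r; apply: wt3_0.
  apply: (@wt3_le _ _ _ (b%:Z + kap * (j : nat))); first by lia.
  by apply: wt3M; [exact: wt_rho|exact: wt3X_nat (wt_shiftY wZ)].
suff w : wt3 kap c (kap * m)%N T2p.[del%:P * Z].
  by apply: wt3_le (wt3M (wt3X_nat (k:=2) wZ) w); lia.
rewrite horner_poly; apply: wt3_sum => j _.
have w0 : wt3 kap c 0 (del%:P * Z).
  by apply: wt3_le (wt3M (wt3C c (wt2_deriv wtQ)) wZ); lia.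
have w1 := wt3C c (wt2_nderiv (k:=j.+2) wtQ).
by apply: wt3_le (wt3M w1 (wt3X_nat (k:=j) w0)); lia.
Qed.

(** [step] is a contraction for the [tau]-adic distance: [Q1p] carries a factor [tau], and the other
    term is quadratic in arguments divisible by [tau]. *)
Lemma step_cong n Z Z' d e e' : Z - Z' = 'X ^+ n * d -> Z = 'X * e -> Z' = 'X * e' ->
  exists d', step Z - step Z' = 'X ^+ n.+1 * d'.
Proof.
move=> h hZ hZ'.
have [r1 h1] := horner_sub_dvd Q1p (shiftY Z) (shiftY Z').
have [r2 h2] := horner_sub_dvd T2p (del%:P * Z) (del%:P * Z').
have e1 : shiftY Z - shiftY Z' = del%:P * 'X ^+ n * d by rewrite -mulrA -h /shiftY; ring.
have e2 : del%:P * Z - del%:P * Z' = del%:P * 'X ^+ n * d by rewrite -mulrA -h; ring.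
have e3 : Z ^+ 2 - Z' ^+ 2 = 'X ^+ n.+1 * (d * (e + e')).
  by rewrite subr_sqr h [in X in _ * X]hZ [in X in _ * X]hZ' exprS; ring.
exists (- (del%:P * d * r1 + d * (e + e') * T2p.[del%:P * Z] + 'X * e' ^+ 2 * del%:P * d * r2)).
rewrite /step.
have -> : - ('X * Q1p.[shiftY Z] + Z ^+ 2 * T2p.[del%:P * Z]) - - ('X * Q1p.[shiftY Z'] + Z' ^+ 2 * T2p.[del%:P * Z'])
  = - ('X * (Q1p.[shiftY Z] - Q1p.[shiftY Z']) + (Z ^+ 2 - Z' ^+ 2) * T2p.[del%:P * Z]
     + Z' ^+ 2 * (T2p.[del%:P * Z] - T2p.[del%:P * Z'])) by ring.
rewrite h1 h2 e1 e2 e3 hZ' exprS; ring.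
Qed.

Lemma step_dvd Z e : Z = 'X * e -> exists e', step Z = 'X * e'.
Proof.
move=> ->; exists (- (Q1p.[shiftY ('X * e)] + 'X * e ^+ 2 * T2p.[del%:P * ('X * e)])).
rewrite /step; ring.
Qed.

Lemma hensel_shift n : exists Z, [/\ wt3 kap c (- (kap * m)%:Z) Z,
   exists e, Z = 'X * e & exists r, shift Z Q = Q%:P + (del ^+ 2)%:P * 'X ^+ n * r].
Proof.
suff [Z [wZ hZ [d hd]]] : exists Z, [/\ wt3 kap c (- (kap * m)%:Z) Z,
   exists e, Z = 'X * e & exists d, Z - step Z = 'X ^+ n * d].
  by exists Z; split=> //; exists d; rewrite shiftQ hd; ring.
elim: n => [|n [Z [wZ [e hZ] [d hd]]]].
  exists 0; split; [exact: wt3_0|by exists 0; ring|].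
  by exists (0 - step 0); rewrite expr0 mul1r.
have [e' he'] := step_dvd hZ.
exists (step Z); split; [exact: wt_step|by exists e'|].
exact: step_cong hd hZ he'.
Qed.
End Hensel.

(** * Evaluation at points and along truncated branches *)

Section Eval.
Variables (F L : fieldType) (iota : {rmorphism F -> L}).
Notation P2 := {poly {poly F}}.
Notation P3 := {poly {poly {poly F}}}.

Definition ev1 (t : L) : {rmorphism {poly F} -> L} := horner_eval t \o map_poly iota.
Definition ev2 (t z : L) : {rmorphism P2 -> L} := horner_eval z \o map_poly (ev1 t).
Definition evJ (J : {poly L}) : {rmorphism P2 -> {poly L}} :=
  horner_eval J \o map_poly (map_poly iota).

Lemma ev1E t p : ev1 t p = (map_poly iota p).[t]. Proof. by []. Qed.

Lemma ev2E t z u : ev2 t z u = (map_poly (ev1 t) u).[z]. Proof. by []. Qed.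

Lemma evJE J u : evJ J u = (map_poly (map_poly iota) u).[J]. Proof. by []. Qed.

Lemma evJX J : evJ J 'X = J.
Proof. by rewrite evJE map_polyX hornerX. Qed.

Lemma ev2C t z p : ev2 t z p%:P = ev1 t p.
Proof. by rewrite ev2E map_polyC hornerC. Qed.

Lemma ev2_Y t z : ev2 t z 'X = z.
Proof. by rewrite ev2E map_polyX hornerX. Qed.

Lemma ev1X t : ev1 t 'X = t.
Proof. by rewrite ev1E map_polyX hornerX. Qed.

Lemma evJ_horner J t u : (evJ J u).[t] = ev2 t J.[t] u.
Proof.
rewrite evJE ev2E -[LHS]/(horner_eval t _) -horner_map.
rewrite -map_poly_comp /=; congr (_.[_]); exact: eq_map_poly.
Qed.

Variables (kap m : nat) (Q : P2) (n : nat) (Z : P3).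
Hypothesis hZ : exists e, Z = 'X * e.
Hypothesis hQ : exists r, shift Q Z Q = Q%:P + (Q^`() ^+ 2)%:P * 'X ^+ n * r.

(* The truncated branch of [Q = 0] through the point [(t, z)]: [tau] is specialized so that
   [t + del ^ 2 tau] becomes the variable ['X]. *)
Definition jet t z : {poly L} :=
  horner_eval ((ev2 t z Q^`()) ^- 2 *: ('X - t%:P)) (map_poly (polyC \o ev2 t z) (shiftY Q Z)).

(** The last clause is the use of tracking weights: the Taylor coefficients of [u] along the branch
    are values at [(t, z)] of polynomials that do not depend on the point, so one linear condition
    modulo [Q] serves all points at once. *)
Lemma jetP t z (J := jet t z) : ev2 t z Q = 0 -> ev2 t z Q^`() != 0 ->
  [/\ J.[t] = z, ('X - t%:P) ^+ n %| evJ J Q &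
    forall u S, (size (shift Q Z u) <= S)%N -> evJ J u = \sum_(l < S)
       ev2 t z (shift Q Z u)`_l *: ((ev2 t z Q^`()) ^- 2 *: ('X - t%:P)) ^+ l].
Proof.
move=> Q0; set d := ev2 t z Q^`() => d0.
pose tau : {poly L} := d ^- 2 *: ('X - t%:P).
pose ev3 : {rmorphism P3 -> {poly L}} := horner_eval tau \o map_poly (polyC \o ev2 t z).
have ev3E U : ev3 U = (map_poly (polyC \o ev2 t z) U).[tau] by [].
have ev3C u : ev3 u%:P = (ev2 t z u)%:P by rewrite ev3E map_polyC hornerC.
have ev3X : ev3 'X = tau by rewrite ev3E map_polyX hornerX.
have ev3T : ev3 (shiftT Q) = 'X.
  rewrite /shiftT rmorphD rmorphM !ev3C ev3X rmorphXn -/d ev2C ev1X /tau mul_polyC scalerA.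
  by rewrite mulfV ?expf_neq0 // scale1r addrC subrK.
have ev3c p : ev3 (shift_coef Q p) = map_poly iota p.
  have -> : shift_coef Q p = (map_poly (polyC \o polyC \o polyC) p).[shiftT Q] by [].
  rewrite -horner_map ev3T -map_poly_comp.
  rewrite -[RHS]comp_polyXr /comp_poly -map_poly_comp; congr (_.[_]).
  apply: eq_map_poly => a; rewrite [LHS](_ : _ = ev3 a%:P%:P%:P) //.
  by rewrite ev3C ev2C ev1E map_polyC hornerC.
have JE0 : J = ev3 (shiftY Q Z) by [].
have JE u : evJ J u = ev3 (shift Q Z u).
  have -> : shift Q Z u = (map_poly (shift_coef Q) u).[shiftY Q Z] by [].
  rewrite -horner_map -map_poly_comp evJE JE0; congr (_.[_]).
  by apply: eq_map_poly => p; rewrite -ev3c.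
split.
- have [e he] := hZ.
  rewrite JE0 /shiftY rmorphD rmorphM !ev3C he rmorphM ev3X ev2_Y /tau.
  by rewrite !(hornerD, hornerM, hornerC, hornerZ, hornerN, hornerX) subrr !(mulr0, mul0r) addr0.
- have [r hr] := hQ; rewrite JE hr rmorphD !rmorphM ev3C Q0 add0r rmorphXn ev3X /tau.
  by rewrite exprZn mulrAC -!scalerAr dvdpZr ?expf_neq0 ?invr_eq0 ?expf_neq0 // dvdp_mulIr.
- move=> u S hS; rewrite JE ev3E (@horner_coef_wide _ S); last exact: leq_trans (size_poly _ _) hS.
  by apply: eq_bigr => l _; rewrite coef_map /= mul_polyC.
Qed.
End Eval.
Arguments ev1 {F L} iota t : simpl never.
Arguments ev2 {F L} iota t z : simpl never.
Arguments evJ {F L} iota J : simpl never.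

(** * Norms from a monic bivariate polynomial *)

Lemma size_det_leq (R : comNzRingType) n e (A : 'M[{poly R}]_n) :
  (forall i j, (size (A i j) <= e.+1)%N) -> (size (\det A) <= (n * e).+1)%N.
Proof.
move=> h; apply: (leq_trans (size_sum _ _ _)); apply/bigmax_leqP => s _.
rewrite -signr_odd; set P := \prod_(_ < _) _.
have hP : (size P <= (n * e).+1)%N.
  apply: (leq_trans (size_poly_prod_leq _ _)).
  rewrite card_ord leq_subLR.
  have : (\sum_(i < n) size (A i (s i)) <= \sum_(i < n) e.+1)%N by apply: leq_sum.
  by rewrite sum_nat_const card_ord addnS ltnS mulnS.
by case: (odd _); rewrite ?expr0 ?expr1 ?mul1r ?mulN1r ?size_polyN.
Qed.

Lemma dvdp_det_cols (R : fieldType) n (A : 'M[{poly R}]_n) (d : {poly R}) (c : pred 'I_n) :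
  (forall i j, c j -> d %| A i j) -> d ^+ #|c| %| \det A.
Proof.
move=> h.
pose A' := \matrix_(i, j) (if c j then A i j %/ d else A i j).
have -> : A = A' *m diag_mx (\row_j (if c j then d else 1)).
  apply/matrixP => i j; rewrite mul_mx_diag !mxE.
  by case: ifP => [/(h i)/divpK ->|_]; rewrite ?mulr1.
rewrite det_mulmx det_diag dvdp_mull //.
under eq_bigr do rewrite mxE.
by rewrite -big_mkcond prodr_const dvdpp.
Qed.

Lemma size_prod_dvdp (R : fieldType) (I : eqType) (s : seq I) (x : I -> R) (e : I -> nat) (p : {poly R}) :
  injective x -> uniq s -> p != 0 ->
  (forall i, i \in s -> ('X - (x i)%:P) ^+ e i %| p) -> (\sum_(i <- s) e i < size p)%N.
Proof.
move=> xi us p0 h.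
suff hd : \prod_(i <- s) ('X - (x i)%:P) ^+ e i %| p.
  have := dvdp_leq p0 hd; apply: leq_trans.
  elim: s {us h hd} => [|i s IH]; first by rewrite !big_nil size_poly1.
  rewrite !big_cons size_Mmonic ?expf_neq0 ?polyXsubC_eq0 //; last first.
    by apply: monic_prod => j _; rewrite monic_exp ?monicXsubC.
  by rewrite size_exp_XsubC addSn /= ltn_add2l.
elim: s us h => [|i s IH] /=; first by rewrite big_nil dvd1p.
case/andP => nis us h; rewrite big_cons Gauss_dvdp.
  by rewrite h ?inE ?eqxx //= IH // => j js; apply: h; rewrite inE js orbT.
apply: coprimep_expl; rewrite coprimep_sym coprimep_XsubC.
apply/negP; rewrite /root horner_prod; apply/negP.
rewrite prodf_seq_neq0; apply/allP => j js /=.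
rewrite horner_exp hornerXsubC expf_neq0 // subr_eq0; apply: contraNneq nis => /xi ->; exact: js.
Qed.

Section Norm.
Variables (F : fieldType) (kap m : nat) (Q : {poly {poly F}}).
Notation P2 := {poly {poly F}}.
Hypothesis monQ : Q \is monic.
Hypothesis szQ : size Q = m.+1.
Hypothesis wtQ : wt2 kap (kap * m) Q.

(** [Q] is monic of weight [kap] times its degree, so replacing the top power of [Y] during division
    never raises the weight. *)
Lemma wt2_rmodp n u : wt2 kap n u -> wt2 kap n (rmodp u Q).
Proof.
have [s] := ubnP (size u); elim: s u => // s IH u hs wu.
have [hm|hm] := leqP (size u) m; first by rewrite rmodp_small // szQ.
have u0 : u != 0 by rewrite -size_poly_gt0; lia.
set k := (size u - m.+1)%N.
pose v := u - (lead_coef u)%:P * 'X^k * Q.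
have -> : rmodp u Q = rmodp v Q by rewrite /v rmodpB // rmodp_mull // subr0.
apply: IH.
  have h1 : (size v <= size u)%N.
    rewrite /v (leq_trans (size_polyD _ _)) // geq_max leqnn size_polyN.
    rewrite (leq_trans (size_polyMleq _ _)) // szQ /k.
    have h2 : (size ((lead_coef u)%:P * 'X^k)%R <= k.+1)%N.
      by rewrite mul_polyC (leq_trans (size_scale_leq _ _)) // size_polyXn.
    by rewrite addnS /= (leq_trans (leq_add h2 (leqnn m))) // addSnnS /k subnK.
  suff h2 : (size v < size u)%N by lia.
  rewrite ltn_neqAle h1 andbT; apply/eqP => e.
  have : v`_(size u).-1 = 0.
    rewrite /v coefB -mulrA coefCM coefXnM.
    have -> : ((size u).-1 < k)%N = false by rewrite /k; lia.
    have -> : ((size u).-1 - k)%N = (size Q).-1 by rewrite szQ /k; lia.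
    by rewrite -[Q`_(_)]/(lead_coef Q) (monicP monQ) mulr1 subrr.
  rewrite -e -[_`_ _]/(lead_coef v) => /eqP; rewrite lead_coef_eq0 => /eqP v0.
  by move: u0; rewrite -size_poly_gt0 -e v0 size_poly0.
apply: wt2D => //; apply: wt2N.
case: (wt2_coef_split (size u).-1 wu) => [h|[b hb hn]].
  by move: u0; rewrite -lead_coef_eq0 /lead_coef h eqxx.
have w := wt2M (wt2M (wt2C kap hb) (wt2X (k:=k) (@wt2_Y F kap))) wtQ.
apply: wt2_le w; rewrite /k; nia.
Qed.

(* [\det (nmx u)] is the norm of [u] from [F[t][Y] / Q] to [F[t]]. *)
Definition nmx (u : P2) : 'M[{poly F}]_m := \matrix_(i, j) (rmodp ('X^i * u) Q)`_j.

Lemma size_det_nmx n u : wt2 kap n u -> (size (\det (nmx u)) <= (m * (n + kap * m)).+1)%N.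
Proof.
move=> wu; apply: size_det_leq => i j; rewrite mxE.
apply: (@wt2_size _ kap).
apply: wt2_rmodp; rewrite addnC; apply: wt2M => //.
apply: wt2_le (wt2X (k:=i) (@wt2_Y F kap)); have := ltn_ord i; nia.
Qed.

Variables (L : fieldType) (iota : {rmorphism F -> L}).

Lemma nmx_jet d (J : {poly L}) u i : d %| evJ iota J Q ->
  d %| \sum_(j < m) map_poly iota (nmx u i j) * J ^+ j - J ^+ i * evJ iota J u.
Proof.
move=> hd.
have -> : J ^+ i * evJ iota J u = evJ iota J ('X^i * u).
  by rewrite rmorphM rmorphXn evJX.
rewrite [X in evJ iota J X](rdivp_eq monQ) rmorphD rmorphM [evJ iota J (rmodp _ _)]evJE.
have hs : (size (rmodp ('X^i * u) Q) <= m)%N.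
  by rewrite -ltnS -szQ ltn_rmodpN0 // monic_neq0.
rewrite (@horner_coef_wide _ m); last by rewrite (leq_trans (size_poly _ _)).
under [X in _ - (_ + X)]eq_bigr do rewrite coef_map.
have -> : \sum_(j < m) map_poly iota (nmx u i j) * J ^+ j =
    \sum_(j < m) map_poly iota (rmodp ('X^i * u) Q)`_j * J ^+ j.
  by apply: eq_bigr => j _; rewrite mxE.
by rewrite opprD addrCA subrr addr0 dvdpNr dvdp_mull.
Qed.

(** Multiply [nmx u] by the Vandermonde matrix of the branches. The column of a branch [J] becomes
    [J ^ i * u (J)] modulo [d], hence is divisible by [d] when [u] vanishes along [J]; the
    Vandermonde determinant is prime to [d] because the branches take distinct values at [t0]. *)
Lemma nmx_mult (M : nat) (t0 : L) (r : seq L) (c : pred L) (J : L -> {poly L}) u :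
  uniq r -> size r = m ->
  (forall z, z \in r -> c z -> [/\ (J z).[t0] = z, ('X - t0%:P) ^+ M %| evJ iota (J z) Q &
     ('X - t0%:P) ^+ M %| evJ iota (J z) u]) ->
  ('X - t0%:P) ^+ (M * count c r) %| map_poly iota (\det (nmx u)).
Proof.
move=> ur szr hJ; set d := ('X - t0%:P) ^+ M.
pose rr (j : 'I_m) := nth 0 r j.
have rrin j : rr j \in r by rewrite mem_nth // szr.
(* Roots not counted by [c] only need a placeholder with the right value at [t0], to keep the
   Vandermonde determinant nonzero there. *)
pose Jc z := if c z then J z else z%:P.
pose a : 'rV[{poly L}]_m := \row_j Jc (rr j).
pose W := Vandermonde m a.
have detW : ~~ root (\det W) t0.
  rewrite /root det_Vandermonde horner_prod; apply/prodf_neq0 => i _.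
  rewrite horner_prod; apply/prodf_neq0 => j ij.
  have Jt z : z \in r -> (Jc z).[t0] = z.
    by move=> zr; rewrite /Jc; case: ifP => [/(hJ _ zr)[]|_] //; rewrite hornerC.
  rewrite hornerD hornerN !mxE !Jt ?rrin // subr_eq0 /rr nth_uniq ?szr //.
  by rewrite eqn_leq negb_and -ltnNge -ltnNge ij.
have cop : coprimep (d ^+ count c r) (\det W).
  by apply/coprimep_expl/coprimep_expl; rewrite coprimep_sym coprimep_XsubC.
rewrite exprM -(Gauss_dvdpl _ cop) -det_map_mx -det_mulmx.
have -> : count c r = #|[pred j : 'I_m | c (rr j)]|.
  rewrite -sum1_card -sum1_count (big_nth 0) szr big_mkord.
  by apply: eq_bigl => j; rewrite inE.
apply: dvdp_det_cols => i j; rewrite inE => cj.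
have [h1 h2 h3] := hJ _ (rrin j) cj.
have := nmx_jet u i h2.
rewrite dvdp_subl; last exact: dvdp_mull.
rewrite !mxE; apply: etrans; congr (_ %| _); apply: eq_bigr => k _.
by rewrite !mxE /Jc cj.
Qed.
End Norm.

(** * The Frobenius and the box polynomials *)

Section Frobenius.
Variables (F : finFieldType) (L : comNzRingType) (iota : {rmorphism F -> L}).

Lemma pnat_card_pchar : [pchar L].-nat #|F|.
Proof.
have [p pp pF] := finPcharP F.
have h : p.-nat #|F| by have := pprimeChar_pgroup pF; rewrite /pgroup cardsT.
apply: sub_in_pnat h => p' _; rewrite !inE => /eqP ->.
exact: (rmorph_pchar iota pF).
Qed.

Lemma frobD (x y : L) : (x + y) ^+ #|F| = x ^+ #|F| + y ^+ #|F|.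
Proof. exact: exprDn_pchar pnat_card_pchar. Qed.

Lemma frobN (x : L) : (- x) ^+ #|F| = - x ^+ #|F|.
Proof.
apply/eqP; rewrite -addr_eq0 -frobD addNr expr0n.
by have := finNzRing_gt1 F; case: #|F|.
Qed.

Lemma frob_sum (I : Type) (r : seq I) (P : pred I) (E : I -> L) :
  (\sum_(i <- r | P i) E i) ^+ #|F| = \sum_(i <- r | P i) (E i) ^+ #|F|.
Proof.
apply: (big_morph (fun x => x ^+ #|F|)); first exact: frobD.
by rewrite expr0n; have := finNzRing_gt1 F; case: #|F|.
Qed.

Lemma frob_iota a : (iota a) ^+ #|F| = iota a.
Proof. by rewrite -rmorphXn expf_card. Qed.

Lemma frob_horner (p : {poly F}) x :
  ((map_poly iota p).[x]) ^+ #|F| = (map_poly iota p).[x ^+ #|F|].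
Proof.
rewrite !horner_coef frob_sum; apply: eq_bigr => i _.
by rewrite exprMn coef_map frob_iota exprAC.
Qed.
End Frobenius.

Lemma frob_fixed (F : finFieldType) (L : fieldType) (iota : {rmorphism F -> L}) (z : L) :
  z ^+ #|F| = z -> exists a, z = iota a.
Proof.
move=> h; have := congr1 (map_poly iota) (finField_genPoly F).
rewrite rmorphB /= rmorphXn /= !map_polyX rmorph_prod => /(congr1 (fun p => p.[z])).
rewrite hornerD hornerN hornerXn hornerX h subrr horner_prod => /esym/eqP/prodf_eq0[a _].
rewrite rmorphB /= !map_polyX map_polyC hornerD hornerN hornerX hornerC subr_eq0 => /eqP ->.
by exists a.
Qed.

Lemma ev2_frob (F : finFieldType) (L : fieldType) (iota : {rmorphism F -> L}) t z u :
  (ev2 iota (iota t) z u) ^+ #|F| = ev2 iota (iota t) (z ^+ #|F|) u.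
Proof.
rewrite !ev2E !horner_coef (frob_sum iota); apply: eq_bigr => i _.
rewrite exprMn coef_map exprAC; congr (_ * _).
have := frob_horner iota u`_i (iota t); rewrite frob_iota; exact.
Qed.

(** Pigeonhole in place of a rank argument: two vectors collide, and their difference is in the
    kernel. *)
Lemma ffun_additive_kernel (F : finFieldType) (I J : finType)
    (f : {ffun I -> F} -> {ffun J -> F}) :
  {morph f : x y / x - y} -> (#|J| < #|I|)%N -> exists2 x, x != 0 & f x = 0.
Proof.
move=> fB hIJ.
have /injectivePn[x [y xy fxy]] : ~~ injectiveb f.
  apply/negP => /injectiveP/leq_card; rewrite !card_ffun.
  by rewrite leqNgt ltn_exp2l ?hIJ // finNzRing_gt1.
by exists (x - y); rewrite ?subr_eq0 // fB fxy subrr.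
Qed.

Section BoxPoly.
Variables (F : fieldType) (m a : nat).
Notation P2 := {poly {poly F}}.
Notation boxc := {ffun 'I_m * 'I_a.+1 -> F}.

Definition box_coef (x : boxc) (j i : nat) : F :=
  if (insub j, insub i) is (Some j', Some i') then x (j', i') else 0.
Definition box_poly (x : boxc) : P2 := \poly_(j < m) \poly_(i < a.+1) box_coef x j i.

Lemma box_polyE x (j : 'I_m) (i : 'I_a.+1) : (box_poly x)`_j`_i = x (j, i).
Proof. by rewrite !(coef_poly, ltn_ord) /box_coef !valK. Qed.

Lemma box_polyB x y : box_poly (x - y) = box_poly x - box_poly y.
Proof.
apply/polyP => j; apply/polyP => i; rewrite coefB !coef_poly.
case: ifP => hj; last by rewrite subrr.
rewrite coefB !coef_poly; case: ifP => hi; last by rewrite subrr.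
by rewrite /box_coef !insubT !ffunE.
Qed.

Lemma size_box_poly x : (size (box_poly x) <= m)%N.
Proof. exact: size_poly. Qed.

Lemma wt2_box_poly kap x : wt2 kap (a + kap * m) (box_poly x).
Proof.
move=> j i; rewrite coef_poly; case: ifP => hj; last by rewrite coef0 eqxx.
rewrite coef_poly; case: ifP => hi; last by rewrite eqxx.
by move=> _; nia.
Qed.

Lemma box_poly_eq0 x : box_poly x = 0 -> x = 0.
Proof. by move=> h; apply/ffunP => -[j i]; rewrite -box_polyE h !coef0 ffunE. Qed.

Lemma box_poly0 : box_poly 0 = 0.
Proof. by rewrite -(subrr 0) box_polyB subrr. Qed.
End BoxPoly.

Lemma dvdXnP (F : fieldType) n (p : {poly F}) :
  reflect (forall i, (i < n)%N -> p`_i = 0) ('X^n %| p).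
Proof.
rewrite /dvdp -Pdiv.IdomainMonic.take_poly_modp.
apply: (iffP eqP) => [h i hi|h].
  by have := congr1 (fun p : {poly F} => p`_i) h; rewrite coef_take_poly hi coef0.
by apply/polyP => i; rewrite coef_take_poly coef0; case: ifP => // /h.
Qed.

Lemma dvdp_sumr (R : fieldType) (I : Type) (r : seq I) (P : pred I) (E : I -> {poly R}) d :
  (forall i, P i -> d %| E i) -> d %| \sum_(i <- r | P i) E i.
Proof.
move=> h; elim/big_ind: _ => [|p p' hp hp'|//]; first exact: dvdp0.
by rewrite dvdp_add.
Qed.

(** * Nonvanishing of the auxiliary polynomial *)

Section Valuations.
Variables (F : finFieldType) (kap m : nat) (Q : {poly {poly F}}).
Hypothesis monQ : Q \is monic.
Hypothesis szQ : size Q = m.+1.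
Hypothesis wtQ : wt2 kap (kap * m) Q.
Hypothesis irrQ : forall u, \det (nmx m Q u) = 0 -> rmodp u Q = 0.
Variables (th : F) (r0 : seq F) (J : {poly F}) (T : nat).
Hypothesis ur0 : uniq r0.
Hypothesis szr0 : size r0 = m.
Hypothesis thr0 : th \in r0.
Hypothesis J0 : J.[0] = th.
Hypothesis JQ : 'X^T %| evJ idfun J Q.
Notation ev := (evJ idfun J).

(** The norm of [u] is a nonzero polynomial in [t] of bounded degree, and vanishing of [u] to order
    [k] along a single branch already forces ['X^k] into it. *)
Lemma valuation_bound n k u : wt2 kap n u -> rmodp u Q != 0 -> (k <= T)%N ->
  'X^k %| ev u -> (k <= m * (n + kap * m))%N.
Proof.
move=> wu u0 kT hk.
have d0 : \det (nmx m Q u) != 0 by apply: contraNneq u0 => /irrQ ->.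
have X0 : 'X - 0%:P = 'X :> {poly F} by rewrite subr0.
have := @nmx_mult F m Q monQ szQ F idfun k 0 r0 (pred1 th) (fun=> J) u ur0 szr0.
rewrite X0 count_uniq_mem // thr0 muln1 map_poly_id // => /(_ _) h.
have {h}/(dvdp_leq d0) : 'X^k %| \det (nmx m Q u).
  apply: h => z zr /eqP ->; split=> //.
  by apply: dvdp_trans JQ; rewrite dvdp_exp2l.
rewrite size_polyXn => h; rewrite -ltnS; apply: leq_trans h _.
exact: size_det_nmx.
Qed.

Lemma rmodp_box_neq0 a (x : {ffun 'I_m * 'I_a.+1 -> F}) : x != 0 -> rmodp (box_poly x) Q != 0.
Proof.
move=> x0; rewrite rmodp_small ?szQ ?ltnS ?size_box_poly //.
by apply: contraNneq x0 => /box_poly_eq0 ->.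
Qed.

(* The evaluations of a space of dimension [n] take at least [n] distinct valuations. *)
Lemma valuation_family b (N := (m * (b + 2 * kap * m))%N) : (N < T)%N ->
  exists (V : {set 'I_N.+1}) (y : 'I_N.+1 -> {ffun 'I_m * 'I_b.+1 -> F}),
  (m * b.+1 <= #|V|)%N /\ forall v : 'I_N.+1, v \in V ->
    'X^v %| ev (box_poly (y v)) /\ ~~ ('X^(v.+1) %| ev (box_poly (y v))).
Proof.
move=> NT.
pose ok (v : 'I_N.+1) (y : {ffun 'I_m * 'I_b.+1 -> F}) :=
  ('X^v %| ev (box_poly y)) && ~~ ('X^(v.+1) %| ev (box_poly y)).
pose V := [set v | [exists y, ok v y]].
exists V, (fun v => odflt 0 [pick y | ok v y]); split; last first.
  move=> v; rewrite inE => /existsP[y hy]; case: pickP => [z /andP[]//|/(_ y)].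
  by rewrite hy.
rewrite leqNgt; apply/negP => hV.
(* With too few valuations, some nonzero [y] has zero coefficient at every position in [V]; but its
   own valuation lies in [V], and the coefficient there is nonzero. *)
pose f (y : {ffun 'I_m * 'I_b.+1 -> F}) := [ffun v : {v | v \in V} => (ev (box_poly y))`_(val v)].
have fB : {morph f : x y / x - y}.
  by move=> x y; apply/ffunP => v; rewrite !ffunE box_polyB rmorphB coefB.
have [|y y0 fy] := ffun_additive_kernel fB.
  by rewrite card_prod !card_ord card_sig; apply: leq_trans hV; rewrite ltnS; apply: subset_leq_card; apply/subsetP => v.
have hN : ~~ ('X^(N.+1) %| ev (box_poly y)).
  apply/negP => /(valuation_bound (@wt2_box_poly _ _ _ kap y) (rmodp_box_neq0 y0) NT).
  rewrite /N; nia.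
have h0 : exists k, ~~ ('X^(k.+1) %| ev (box_poly y)) by exists N.
case: (ex_minnP h0) => k hk kmin.
have kN : (k < N.+1)%N by rewrite ltnS; apply: kmin.
have okk : ok (Ordinal kN) y.
  rewrite /ok hk andbT /=; case: k kmin {hk kN} => [|k] kmin; first by rewrite expr0 dvd1p.
  by apply/negPn/negP => /kmin; rewrite ltnn.
have kV : Ordinal kN \in V by rewrite inE; apply/existsP; exists y.
have := congr1 (fun g : {ffun {v | v \in V} -> F} => g (exist _ (Ordinal kN) kV)) fy.
rewrite !ffunE /= => h; case/negP: hk; apply/dvdXnP => i; rewrite ltnS leq_eqVlt.
case/orP => [/eqP -> //|ik]; case/andP: okk => /dvdXnP h' _; exact: h'.
Qed.

(** The hypothesis on [a] keeps the valuation of each nonzero coefficient polynomial below [q]. The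
    term with the smallest [v i] therefore has valuation below [(v i).+1 * q], while all the others
    reach at least that order, so nothing cancels it. *)
Lemma frobenius_combination_neq0 a (I : finType) (v : I -> nat) (B : I -> {poly {poly F}})
   (x : I -> {ffun 'I_m * 'I_a.+1 -> F}) i0 :
  injective v -> (forall i, ((v i).+1 * #|F| <= T)%N) -> (m * (a + 2 * kap * m) < #|F|)%N ->
  (forall i, 'X^(v i) %| ev (B i) /\ ~~ ('X^((v i).+1) %| ev (B i))) ->
  x i0 != 0 -> rmodp (\sum_i box_poly (x i) * B i ^+ #|F|) Q != 0.
Proof.
move=> vi vT hq hB xi0; apply/negP => /eqP h.
have q0 : (0 < #|F|)%N by exact: leq_ltn_trans hq.
set Phi := \sum_i _ in h.
have hPhi : 'X^T %| ev Phi.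
  by rewrite (rdivp_eq monQ Phi) h addr0 rmorphM dvdp_mull.
case: (arg_minnP (P := fun i => x i != 0) v xi0) => i xi imin.
have : 'X^((v i).+1 * #|F|) %| ev (box_poly (x i)) * ev (B i) ^+ #|F|.
  have : 'X^((v i).+1 * #|F|) %| ev Phi by apply: dvdp_trans hPhi; rewrite dvdp_exp2l.
  rewrite /Phi rmorph_sum (bigD1 i) // rmorphM rmorphXn dvdp_addl //.
  apply: dvdp_sumr => j ji; rewrite rmorphM rmorphXn.
  have [->|xj] := eqVneq (x j) 0; first by rewrite box_poly0 rmorph0 mul0r dvdp0.
  apply: dvdp_mull; rewrite exprM.
  apply: dvdp_exp2r; apply: dvdp_trans (hB j).1; rewrite dvdp_exp2l //.
  by have := imin j xj; rewrite leq_eqVlt => /orP[/eqP/vi e|//]; rewrite e eqxx in ji.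
have [/dvdpP[B' hB'] hn] := hB i.
rewrite hB' exprMn -exprM mulrA mulSn exprD dvdp_mul2r; last first.
  by rewrite expf_neq0 // polyX_eq0.
have cop : coprimep 'X^#|F| (B' ^+ #|F|).
  apply/coprimep_expl/coprimep_expr; rewrite coprimep_sym -[X in coprimep _ X]subr0 coprimep_XsubC.
  apply: contra hn; rewrite hB' -dvdp_XsubCl subr0 exprSr => h'.
  by rewrite mulrC dvdp_mul.
rewrite (Gauss_dvdpl _ cop) => /(valuation_bound (@wt2_box_poly _ _ _ kap (x i)) (rmodp_box_neq0 xi)).
have hT : (#|F| <= T)%N by apply: leq_trans (vT i); rewrite mulSn leq_addr.
move/(_ hT); nia.
Qed.
End Valuations.

(** * The Stepanov bound *)

Section HomSubst.
Variables (F : fieldType) (kap m g : nat) (G H : {poly {poly F}}).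
Hypotheses (wtG : wt2 kap g G) (wtH : wt2 kap g H).

(* [H ^ n * B (t, G / H)], a polynomial when [B] has degree at most [n] in [Y]. *)
Definition homsubst n (B : {poly {poly F}}) : {poly {poly F}} :=
  \sum_(e < n.+1) (B`_e)%:P * G ^+ e * H ^+ (n - e).

Lemma wt2_homsubst n b (B : {poly {poly F}}) : (forall e : nat, (size (B`_e)%R <= b.+1)%N) ->
  wt2 kap (b + g * n) (homsubst n B).
Proof.
move=> hB; apply: wt2_sum => e _.
apply: wt2_le (wt2M (wt2M (wt2C kap (hB e)) (wt2X (k:=e) wtG)) (wt2X (k:=n - e) wtH)).
have := ltn_ord e; nia.
Qed.

Lemma ev2_homsubst (L : fieldType) (iota : {rmorphism F -> L}) t z z' n (B : {poly {poly F}}) :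
  (size B <= n.+1)%N -> ev2 iota t z H * z' = ev2 iota t z G ->
  ev2 iota t z (homsubst n B) = ev2 iota t z H ^+ n * ev2 iota t z' B.
Proof.
move=> sB hG; rewrite /homsubst rmorph_sum [ev2 _ _ z' B]ev2E.
rewrite (@horner_coef_wide _ n.+1) ?(leq_trans (size_poly _ _)) // mulr_sumr.
apply: eq_bigr => e _; rewrite !rmorphM !rmorphXn ev2C -hG coef_map exprMn.
have -> : ev2 iota t z H ^+ n = ev2 iota t z H ^+ e * ev2 iota t z H ^+ (n - e).
  by rewrite -exprD subnKC // -ltnS.
set x := ev1 _ _ _; set y := ev2 _ _ _ _; ring.
Qed.
End HomSubst.

Section Core.
Variables (F : finFieldType) (L : fieldType) (iota : {rmorphism F -> L}).
Variables (kap m g : nat) (Q G H : {poly {poly F}}).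
Hypothesis monQ : Q \is monic.
Hypothesis szQ : size Q = m.+2.
Hypothesis wtQ : wt2 kap (kap * m.+1) Q.
Hypothesis irrQ : forall u, \det (nmx m.+1 Q u) = 0 -> rmodp u Q = 0.
Hypotheses (wtG : wt2 kap g G) (wtH : wt2 kap g H).
Variables (th : F) (r0 : seq F).
Hypothesis ur0 : uniq r0.
Hypothesis szr0 : size r0 = m.+1.
Hypothesis thr0 : th \in r0.
Hypothesis Qth : ev2 idfun 0 th Q = 0.
Hypothesis dQth : ev2 idfun 0 th Q^`() != 0.
Variables (good : pred F) (rts : F -> seq L).
Hypothesis rtsU : forall t, good t -> uniq (rts t).
Hypothesis szrts : forall t, good t -> size (rts t) = m.+1.
Hypothesis Qrts : forall t z, good t -> z \in rts t -> ev2 iota (iota t) z Q = 0.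
Hypothesis dQrts : forall t z, good t -> z \in rts t -> ev2 iota (iota t) z Q^`() != 0.

Definition frob_cond t z := (ev2 iota (iota t) z H != 0) &&
  (ev2 iota (iota t) z H * z ^+ #|F| == ev2 iota (iota t) z G).
Notation mm := m.+1.

(* With [Phi = \sum_v A_v B_v ^ q], where the [B_v] have distinct valuations at a rational branch:
   along the branch through a point [(t, z)] with [H (t, z) z ^ q = G (t, z)], modulo [(X - t) ^ q],
   the [q]-th power [B_v ^ q] is the constant [B_v (t, z ^ q) = B_v (t, G / H)], so vanishing of
   [Phi] to order [M] there is a linear condition of low degree on the [A_v]. *)
Lemma stepanov_core a b M :
  (mm * (a + 2 * kap * mm) < #|F|)%N -> (M <= #|F|)%N ->
  (M * (mm * (a + kap * mm + 2 * kap * mm * M + (b + g * m) + 1)) < (mm * b.+1) * (mm * a.+1))%N ->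
  (M * \sum_(t | good t) count (frob_cond t) (rts t) <=
    mm * (a + kap * mm + (b + kap * mm) * #|F| + kap * mm))%N.
Proof.
move=> hq hM hcnt.
have q0 : (0 < #|F|)%N by exact: leq_ltn_trans hq.
(* [N] bounds the valuations of the [B v], and the precision [T] must reach [(v.+1) * q] for every
   [v <= N]. *)
pose N := (mm * (b + 2 * kap * mm))%N; pose T := (N.+1 * #|F|)%N.
have NT : (N < T)%N by rewrite /T; nia.
have [Z [wZ hZ hQ]] := hensel_shift wtQ T.
have [j1 j2 _] := jetP hZ hQ Qth dQth.
rewrite subr0 in j2.
set J0 := jet _ _ _ _ _ in j1 j2.
have [V [y [cV hV]]] := valuation_family monQ szQ wtQ irrQ ur0 szr0 thr0 j1 j2 NT.
pose VT : finType := {v | v \in V}.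
pose B (v : VT) := box_poly (y (val v)).
pose slice (x : {ffun VT * ('I_mm * 'I_a.+1) -> F}) (v : VT) := [ffun k => x (v, k)].
(* The number of powers of [t] that can occur in [U x l]: the weight of a shifted box polynomial at
   order [l < M], plus that of [homsubst], plus one. *)
pose e := (a + kap * mm + 2 * kap * mm * M + (b + g * m) + 1)%N.
pose U x (l : nat) := rmodp (\sum_v (shift Q Z (box_poly (slice x v)))`_l * homsubst G H m (B v)) Q.
pose f x := [ffun k : 'I_M * ('I_mm * 'I_e) => (U x k.1)`_k.2.1`_k.2.2].
have sliceB x x' v : slice (x - x') v = slice x v - slice x' v.
  by apply/ffunP => k; rewrite !ffunE.
have UB x x' l : U (x - x') l = U x l - U x' l.
  rewrite /U -rmodpB // -sumrB; congr (rmodp _ _); apply: eq_bigr => v _.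
  by rewrite sliceB box_polyB rmorphB coefB mulrBl.
have fB : {morph f : x x' / x - x'}.
  by move=> x x'; apply/ffunP => k; rewrite !ffunE UB !coefB.
have [|x x0 fx] := ffun_additive_kernel fB.
  rewrite !card_prod !card_ord card_sig; apply: leq_trans hcnt _.
  by rewrite leq_mul2r cV orbT.
have wB v (j : nat) : (size ((B v)`_j)%R <= b.+1)%N.
  by rewrite coef_poly; case: ifP => _; rewrite ?size_poly // size_poly0.
have Ux l : (l < M)%N -> U x l = 0.
  move=> lM; apply/polyP => j; apply/polyP => i; rewrite !coef0.
  have wU : wt2 kap (a + kap * mm + 2 * kap * mm * M + (b + g * m)) (U x l).
    apply: (@wt2_rmodp _ _ mm) => //; apply: wt2_sum => v _; apply: wt2M.
      have w := wt3_coef (l := l) (wt_shift wtQ wZ (@wt2_box_poly _ _ _ kap (slice x v))).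
      by apply: wt2_le w; rewrite leq_add2l leq_mul2l ltnW ?orbT.
    exact: wt2_homsubst.
  have [jm|jm] := leqP mm j.
    have /leq_sizeP -> // : (size (U x l) <= mm)%N; last by rewrite coef0.
    by rewrite -ltnS -szQ ltn_rmodpN0 // monic_neq0.
  have [ie|ie] := leqP e i.
    apply/eqP; apply: contraTT ie => /wU; rewrite /e; lia.
  have := congr1 (fun g : {ffun _ -> F} => g (Ordinal lM, (Ordinal jm, Ordinal ie))) fx.
  by rewrite !ffunE.
pose Phi := \sum_v box_poly (slice x v) * B v ^+ #|F|.
have Phi0 : rmodp Phi Q != 0.
  have [k xk] : exists k, x k != 0.
    apply/existsP; rewrite -negb_forall; apply: contra x0 => /forallP h.
    by apply/eqP/ffunP => k; rewrite ffunE; apply/eqP.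
  apply: (frobenius_combination_neq0 monQ szQ wtQ irrQ ur0 szr0 thr0 j1 j2 (v := fun v : VT => val (val v)) (i0 := k.1)) => //.
  - by move=> v v' /val_inj/val_inj.
  - by move=> v; rewrite /T leq_mul2r ltn_ord orbT.
  - by move=> v; apply: hV; apply: (valP v).
  - apply: contraNneq xk => h.
    by have := congr1 (fun g : {ffun _ -> F} => g k.2) h; rewrite !ffunE -surjective_pairing => ->.
have det0 : \det (nmx mm Q Phi) != 0 by apply: contraNneq Phi0 => /irrQ ->.
have wPhi : wt2 kap (a + kap * mm + (b + kap * mm) * #|F|) Phi.
  apply: wt2_sum => v _; apply: wt2M; first exact: wt2_box_poly.
  by apply: wt2X; apply: wt2_box_poly.
have := size_det_nmx monQ szQ wtQ wPhi; rewrite -(size_map_poly iota).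
have idet0 : map_poly iota (\det (nmx mm Q Phi)) != 0 by rewrite map_poly_eq0.
move=> hsz; rewrite -ltnS; apply: leq_trans hsz.
rewrite big_distrr -big_filter.
apply: (@size_prod_dvdp _ _ _ iota) => //; [exact: fmorph_inj|exact/filter_uniq/index_enum_uniq|].
move=> t; rewrite mem_filter => /andP[gt _].
apply: (@nmx_mult _ mm Q monQ szQ _ _ _ _ _ _ (jet iota Q Z (iota t))); [exact: rtsU|exact: szrts|].
move=> z zr /andP[H0 /eqP HG].
have [k1 k2 k3] := jetP hZ hQ (Qrts gt zr) (dQrts gt zr).
set J := jet _ _ _ _ _ in k1 k2 k3 *; set d := 'X - _ in k2 k3 *.
have MT : (M <= T)%N by rewrite /T mulSn; apply: leq_trans (leq_addr _ _).
split=> //; first by apply: dvdp_trans k2; rewrite dvdp_exp2l.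
(* Clears the denominators of [B v (t, G / H)], as [B v] has degree at most [m] in [Y]. *)
pose c := ev2 iota (iota t) z H ^+ m.
have c0 : c != 0 by rewrite expf_neq0.
rewrite -(dvdpZr _ _ c0) /Phi rmorph_sum scaler_sumr.
pose w := (ev2 iota (iota t) z Q^`()) ^- 2 *: d.
(* [B v (J) ^ q - B v (z) ^ q] is the [q]-th power of a multiple of [d], and [M <= q]. This is how
   the large factor [B v ^ q] becomes a constant. *)
have cB v : d ^+ M %| c *: evJ iota J (box_poly (slice x v) * B v ^+ #|F|) -
    evJ iota J (box_poly (slice x v)) * (ev2 iota (iota t) z (homsubst G H m (B v)))%:P.
  rewrite rmorphM rmorphXn (ev2_homsubst _ HG) ?size_box_poly // -/c.
  rewrite -ev2_frob polyCM polyC_exp -mul_polyC.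
  rewrite (_ : _ - _ = c%:P * evJ iota J (box_poly (slice x v)) *
     (evJ iota J (B v) ^+ #|F| - (ev2 iota (iota t) z (B v))%:P ^+ #|F|)); last first.
    by rewrite /c mulrBr !polyC_exp; congr (_ - _); [rewrite mulrA|rewrite mulrCA mulrA].
  apply: dvdp_mull.
  rewrite -(frobN (polyC \o iota : {rmorphism F -> {poly L}})).
  rewrite -(frobD (polyC \o iota : {rmorphism F -> {poly L}})).
  apply: (dvdp_trans (dvdp_exp2l _ hM)); apply: dvdp_exp2r.
  by rewrite dvdp_XsubCl /root hornerD hornerN hornerC evJ_horner k1 subrr.
rewrite -[X in _ %| X](subrK (\sum_v evJ iota J (box_poly (slice x v)) *
   (ev2 iota (iota t) z (homsubst G H m (B v)))%:P)) -sumrB dvdp_add //.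
  by apply: dvdp_sumr => v _; apply: cB.
pose S := (M + \max_v size (shift Q Z (box_poly (slice x v))))%N.
have hS v : (size (shift Q Z (box_poly (slice x v))) <= S)%N.
  rewrite /S; apply: leq_trans (leq_addl _ _).
  exact: (@leq_bigmax _ (fun v => size (shift Q Z (box_poly (slice x v)))) v).
rewrite (eq_bigr (fun v => \sum_(l < S) (ev2 iota (iota t) z
   ((shift Q Z (box_poly (slice x v)))`_l * homsubst G H m (B v))) *: w ^+ l)); last first.
  move=> v _; rewrite (k3 _ S (hS v)) mulr_suml; apply: eq_bigr => l _.
  by rewrite rmorphM mulrC mul_polyC scalerA mulrC.
rewrite exchange_big; apply: dvdp_sumr => l _.
rewrite -scaler_suml -rmorph_sum.
(* Orders [l >= M] are divisible by [d ^+ M] outright; the lower ones vanish by the choice of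
   [x]. *)
have [lM|lM] := ltnP l M; last first.
  rewrite -mul_polyC dvdp_mull // /w exprZn dvdpZr ?expf_neq0 ?invr_eq0 ?expf_neq0 ?dQrts //.
  exact: dvdp_exp2l.
set Ul := (X in ev2 iota (iota t) z X).
have -> : ev2 iota (iota t) z Ul = 0.
  by rewrite (rdivp_eq monQ Ul) rmorphD rmorphM Qrts // mulr0 add0r [rmodp _ _](Ux l lM) rmorph0.
by rewrite scale0r dvdp0.
Qed.

Lemma frob_count_trivial :
  (\sum_(t | good t) count (frob_cond t) (rts t) <= mm * #|F|)%N.
Proof.
apply: (@leq_trans (\sum_(t : F) mm)); last by rewrite sum_nat_const mulnC.
rewrite big_mkcond /=; apply: leq_sum => t _; case: ifP => // gt.
by rewrite -(szrts gt) count_size.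
Qed.

Lemma stepanov s : (s * s <= #|F|)%N -> (#|F| < s.+1 * s.+1)%N ->
  (\sum_(t | good t) count (frob_cond t) (rts t) <= #|F| + stepanov_const m kap g * s)%N.
Proof.
move=> hs1 hs2.
exact: (stepanov_arith (finNzRing_gt1 F) hs1 hs2 stepanov_core frob_count_trivial).
Qed.
End Core.

(** * Indecomposable factors *)

Lemma size_mul_gt (R : idomainType) (p q : {poly R}) :
  (1 < size p)%N -> q != 0 -> (size q < size (p * q)%R)%N.
Proof.
move=> sp q0; rewrite size_mul //; last by rewrite -size_poly_gt0; apply: ltnW.
by case: (size p) sp => [|[|n]] // _; rewrite !addSn /= ltnS leq_addl.
Qed.

Lemma scale_poly_inj (R : idomainType) (c : R) (p q : {poly R}) : c != 0 -> c *: p = c *: q -> p = q.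
Proof. by move=> c0; rewrite -!mul_polyC => /mulfI; apply; rewrite polyC_eq0. Qed.

Section Gauss.
Variables (F : fieldType) (K : closedFieldType) (iota : {rmorphism F -> K}).
Notation P2 := {poly {poly F}}.

Lemma common_factor (a : {poly F}) (g : P2) t : a != 0 ->
  ev1 iota t a = 0 -> map_poly (ev1 iota t) g = 0 ->
  exists pi a' g', [/\ a = pi * a', g = pi *: g', (1 < size pi)%N & size g' = size g].
Proof.
move=> a0 at0 gt0.
pose pi := \big[@gcdp _/a]_(j < size g) g`_j.
have pia : pi %| a.
  rewrite /pi; elim/big_rec: _ => [|j p _ hp]; first exact: dvdpp.
  exact: dvdp_trans (dvdp_gcdr _ _) hp.
have pig (j : 'I_(size g)) : pi %| g`_j.
  rewrite /pi; have : j \in index_enum 'I_(size g) by rewrite mem_index_enum.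
  elim: (index_enum _) => // i s IH; rewrite inE big_cons => /orP[/eqP <-|js].
    exact: dvdp_gcdl.
  exact: dvdp_trans (dvdp_gcdr _ _) (IH js).
have pit : root (map_poly iota pi) t.
  rewrite /pi; elim/big_rec: _ => [|j p _ hp]; first by rewrite /root -ev1E at0.
  rewrite gcdp_map root_gcd hp andbT /root -ev1E -coef_map gt0 coef0 //.
have pi0 : pi != 0 by apply: contraNneq a0 => h; move: pia; rewrite h dvd0p.
exists pi, (a %/ pi), (\poly_(j < size g) (g`_j %/ pi)).
have hg : g = pi *: \poly_(j < size g) (g`_j %/ pi).
  apply/polyP => j; rewrite coefZ coef_poly; case: ltnP => hj.
    by rewrite mulrC divpK // (pig (Ordinal hj)).
  by rewrite mulr0 nth_default.
split=> //.
- by rewrite mulrC divpK.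
- rewrite -(size_map_poly iota).
  by apply: (@root_size_gt1 _ t) => //; rewrite map_poly_eq0.
- by rewrite [in RHS]hg size_scale.
Qed.

(** Induction on the degree of [a]: at a root [t] of [a] the product [g * k] specializes to zero
    over a field, so one factor does, and [common_factor] then removes a nonconstant divisor common
    to it and to [a]. *)
Lemma gauss_monic (a : {poly F}) (Q g k : P2) : a != 0 -> Q \is monic -> a *: Q = g * k ->
  exists g' k', [/\ Q = g' * k', size g' = size g & size k' = size k].
Proof.
have [n] := ubnP (size a); elim: n a g k => // n IH a g k ha a0 monQ h.
have [s1|s1] := boolP (size a == 1%N).
  have /size_poly1P[c c0 ac] := s1.
  exists (c^-1%:P *: g), k; split=> //; last by rewrite size_scale // polyC_eq0 invr_eq0.
  by rewrite -scalerAl -h scalerA ac -polyCM mulVf // scale1r.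
have /closed_rootP[t tr] : size (map_poly iota a) != 1%N by rewrite size_map_poly.
have at0 : ev1 iota t a = 0 by apply/eqP.
have : map_poly (ev1 iota t) g * map_poly (ev1 iota t) k = 0.
  have := congr1 (map_poly (ev1 iota t)) h.
  by rewrite map_polyZ [X in X *: _](at0 : _ = 0) scale0r rmorphM => <-.
move/eqP; rewrite mulf_eq0 => /orP[]/eqP hz.
- have [pi [a' [g' [ha' hg' spi sg']]]] := common_factor a0 at0 hz.
  have pi0 : pi != 0 by rewrite -size_poly_gt0; lia.
  have a'0 : a' != 0 by apply: contraNneq a0 => z; rewrite ha' z mulr0.
  rewrite -sg'; apply: (IH a') => //.
    by rewrite -ltnS; apply: leq_trans ha; rewrite ltnS ha'; apply: size_mul_gt.
  by apply: (scale_poly_inj pi0); rewrite scalerA -ha' h hg' scalerAl.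
- have [pi [a' [k' [ha' hk' spi sk']]]] := common_factor a0 at0 hz.
  have pi0 : pi != 0 by rewrite -size_poly_gt0; lia.
  have a'0 : a' != 0 by apply: contraNneq a0 => z; rewrite ha' z mulr0.
  rewrite -sk'; apply: (IH a') => //.
    by rewrite -ltnS; apply: leq_trans ha; rewrite ltnS ha'; apply: size_mul_gt.
  by apply: (scale_poly_inj pi0); rewrite scalerA -ha' h hk' scalerAr.
Qed.
End Gauss.

Definition indecomposable (R : nzRingType) (Q : {poly R}) :=
  forall g k, Q = g * k -> (size g <= 1)%N \/ (size k <= 1)%N.

Lemma exists_indecomposable_factor (R : idomainType) (A : {poly R}) : A \is monic -> (1 < size A)%N ->
  exists Q k, [/\ A = Q * k, Q \is monic, (1 < size Q)%N & indecomposable Q].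
Proof.
have [n] := ubnP (size A); elim: n A => // n IH A hA monA sA.
have [h|h] := Classical_Prop.classic (indecomposable A).
  by exists A, 1; rewrite mulr1.
have [g [k [hgk sg sk]]] : exists g k, [/\ A = g * k, (1 < size g)%N & (1 < size k)%N].
  apply: Classical_Prop.NNPP => h'; apply: h => g k hgk.
  case: (leqP (size g) 1) => sg; first by left.
  case: (leqP (size k) 1) => sk; first by right.
  by case: h'; exists g, k.
have g0 : g != 0 by rewrite -size_poly_gt0; lia.
have k0 : k != 0 by rewrite -size_poly_gt0; lia.
(* The leading coefficients are mutually inverse, so both factors can be rescaled to monic ones. *)
have hl : lead_coef g * lead_coef k = 1 by rewrite -lead_coefM -hgk; apply/monicP.
have lk0 : lead_coef k != 0 by rewrite lead_coef_eq0.
have hA' : A = (lead_coef k *: g) * (lead_coef g *: k).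
  by rewrite -scalerAl -scalerAr scalerA mulrC hl scale1r.
have [||| Q [k' [e1 e2 e3 e4]]] := IH (lead_coef k *: g).
- rewrite size_scale // -ltnS; apply: leq_trans hA; rewrite ltnS hgk mulrC; exact: size_mul_gt.
- by rewrite monicE lead_coefZ mulrC hl.
- by rewrite size_scale.
by exists Q, (k' * (lead_coef g *: k)); split=> //; rewrite hA' e1 mulrA.
Qed.

(* By Gauss's lemma [Q] stays irreducible over [F(t)], so that [F[t][Y] / Q] is a domain. *)
Lemma det_nmx_eq0 (F : fieldType) (K : closedFieldType) (iota : {rmorphism F -> K}) m
    (Q u : {poly {poly F}}) : Q \is monic -> size Q = m.+1 -> indecomposable Q ->
  \det (nmx m Q u) = 0 -> rmodp u Q = 0.
Proof.
move=> monQ szQ indQ /eqP/det0P[v v0 hv].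
pose w : {poly {poly F}} := \sum_(i < m) v 0 i *: 'X^i.
have cw (i : 'I_m) : w`_i = v 0 i.
  rewrite /w coef_sum (bigD1 i) //= coefZ coefXn eqxx mulr1 big1 ?addr0 // => j ji.
  by rewrite coefZ coefXn (negbTE (_ : (i : nat) != j)) ?mulr0 // eq_sym.
have w0 : w != 0.
  apply: contraNneq v0 => h; apply/eqP/rowP => i; by rewrite -cw h coef0 mxE.
have sw : (size w <= m)%N.
  apply: (leq_trans (size_sum _ _ _)); apply/bigmax_leqP => i _.
  by rewrite (leq_trans (size_scale_leq _ _)) // size_polyXn.
have wu : rmodp (w * u) Q = 0.
  rewrite /w mulr_suml rmodp_sum //.
  apply/polyP => j; rewrite coef0 coef_sum.
  have [jm|jm] := ltnP j m; last first.
    apply: big1 => i _; apply/leq_sizeP: jm.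
    by rewrite -ltnS -szQ ltn_rmodpN0 // monic_neq0.
  have := congr1 (fun M : 'rV_m => M 0 (Ordinal jm)) hv; rewrite !mxE.
  apply: etrans; apply: eq_bigr => i _.
  by rewrite mxE -scalerAl rmodpZ // coefZ.
have hwu := rdivp_eq monQ (w * u); rewrite wu addr0 in hwu.
(* A nonconstant [gcdp Q w] would give, through [gauss_monic], a factor of [Q] of degree at most
   that of [w], hence a proper one. Otherwise a Bezout relation turns [Q] dividing [w * u] into [Q]
   dividing a nonzero constant multiple of [u]. *)
have [s1|s1] := eqVneq (size (gcdp Q w)) 1%N; last first.
  have g0 : gcdp Q w != 0 by rewrite gcdp_eq0 negb_and w0 orbT.
  have sg : (1 < size (gcdp Q w))%N by rewrite ltn_neqAle eq_sym s1 size_poly_gt0.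
  have /Pdiv.Idomain.dvdpP[[a k] /= a0 hk] := dvdp_gcdl Q w.
  have [k' [g' [hQ sk' sg']]] := gauss_monic iota a0 monQ hk.
  have lg : (size (gcdp Q w) <= m)%N by apply: leq_trans sw; apply: leq_gcdpr.
  have Q0 := monic_neq0 monQ.
  have [k'0 g'0] : k' != 0 /\ g' != 0.
    by apply/andP; rewrite -negb_or -mulf_eq0 -hQ.
  case: (indQ _ _ hQ) => h; last by move: sg; rewrite -sg' ltnNge h.
  have := size_polyMleq k' g'; rewrite -hQ szQ sg' leqNgt; case/negP.
  rewrite ltnS; apply: leq_trans lg; rewrite -subn1 leq_subLR leq_add2r; exact: h.
have [[x y] /= /eqp_size] := Bezoutp Q w; rewrite s1 => /eqP/size_poly1P[c c0 hc].
apply: (scale_poly_inj c0); rewrite scaler0 -rmodpZ // -mul_polyC -hc mulrDl.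
by rewrite -mulrA (mulrC Q) mulrA -(mulrA y) hwu (mulrA y) -mulrDl rmodp_mull.
Qed.

(** * Symmetric functions of the roots *)

Lemma mmap_mesym (F L : fieldType) (iota : {rmorphism F -> L}) D (eta : 'I_D -> L) k :
  mmap iota eta (mesym D F k) = (mesym D L k).@[eta].
Proof.
rewrite /mesym !raddf_sum; apply: eq_bigr => h _ /=.
rewrite !rmorph_prod; apply: eq_bigr => i _ /=.
by rewrite mmapX mmap1U mevalXU.
Qed.

Section Transfer.
Variables (F : fieldType) (D kap0 : nat) (P : {poly {poly F}}).
Hypothesis hP : forall j : nat, (size (P`_j)%R <= kap0.+1)%N.

(* The value of the symmetric polynomial [p] at the roots of [P], as a polynomial in [t]. *)
Definition symc_root (i : 'I_D) : {poly F} := (-1) ^+ i.+1 * P`_(D - i.+1).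
Definition symc (p : {mpoly F[D]}) : {poly F} := mmap polyC symc_root (symf p).

Lemma symc1 : symc 1 = 1.
Proof.
rewrite /symc; have -> : symf (1 : {mpoly F[D]}) = 1.
  apply: msym_fundamental_un; rewrite -symfP ?comp_mpoly1 //.
  exact: rpred1.
by rewrite rmorph1.
Qed.

Lemma symc0 : symc 0 = 0.
Proof.
rewrite /symc; have -> : symf (0 : {mpoly F[D]}) = 0.
  by apply: msym_fundamental_un; rewrite -symfP ?comp_mpoly0 // rpred0.
by rewrite rmorph0.
Qed.

(** The weighted degree of [symf p] is controlled by the degree of [p], so each of its monomials
    uses boundedly many coefficients of [P], each of degree at most [kap0] in [t]. *)
Lemma size_symc p : p \is symmetric -> (size (symc p) <= (msize p * kap0).+1)%N.
Proof.
move=> sp; have ws : (mweight (symf p) <= msize p)%N by apply: symfn_wgle.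
rewrite /symc /mmap; apply: (leq_trans (size_sum _ _ _)); apply/bigmax_leqP_seq => m hm _.
rewrite mul_polyC (leq_trans (size_scale_leq _ _)) // /mmap1.
apply: (leq_trans (size_poly_prod_leq _ _)); rewrite card_ord leq_subLR.
have hdeg : (mdeg m <= msize p)%N.
  apply: ltnW; apply: leq_trans ws; apply: leq_ltn_trans (leq_mdeg_mnmwgt _) _.
  exact: mmeasure_mnm_lt.
apply: (@leq_trans (\sum_(i < D) (m i * kap0).+1).+1).
  rewrite ltnS; apply: leq_sum => i _.
  apply: (leq_trans (size_poly_exp_leq _ _)); rewrite ltnS mulnC leq_mul2l; apply/orP; right.
  have : (size (symc_root i) <= kap0.+1)%N.
    by rewrite /symc_root -signr_odd; case: (odd _); rewrite ?expr0 ?expr1 ?mul1r ?mulN1r ?size_polyN.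
  by case: (size _).
have -> : (\sum_(i < D) (m i * kap0).+1 = mdeg m * kap0 + D)%N.
  under eq_bigr do rewrite -addn1.
  by rewrite big_split /= sum_nat_const card_ord muln1 -big_distrl /= -mdegE.
by rewrite -addnS addnC addSn -addnS leq_add2l ltnS leq_mul2r hdeg orbT.
Qed.

Definition sym_invariant (A : {poly {mpoly F[D]}}) := forall s, map_poly (msym s) A = A.

Lemma sym_invariant_coef A i : sym_invariant A -> A`_i \is symmetric.
Proof. by move=> h; apply/issymP => s; rewrite -[in RHS](h s) coef_map. Qed.

Definition transfer (A : {poly {mpoly F[D]}}) : {poly {poly F}} := map_poly symc A.

Lemma coef_transfer A i : (transfer A)`_i = symc A`_i.
Proof. by rewrite coef_map_id0 // symc0. Qed.

Section Eval.
Variables (L : fieldType) (iota : {rmorphism F -> L}) (t : L) (eta : 'I_D -> L).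
Hypothesis hroots : map_poly (ev1 iota t) P = \prod_(j < D) ('X - (eta j)%:P).

Lemma ev1_symc p : p \is symmetric -> ev1 iota t (symc p) = mmap iota eta p.
Proof.
move=> sp; rewrite [in RHS](symfP sp) comp_mpolyE.
transitivity (\sum_(m <- msupp (symf p)) ev1 iota t (((symf p)@_m)%:P * mmap1 symc_root m)).
  by rewrite /symc /mmap raddf_sum.
rewrite raddf_sum.
apply: eq_bigr => m _; rewrite [RHS]/= mmapZ rmorphM.
have -> : ev1 iota t ((symf p)@_m)%:P = iota (symf p)@_m by rewrite ev1E map_polyC hornerC.
congr (_ * _); rewrite /mmap1 !rmorph_prod; apply: eq_bigr => i _.
rewrite !rmorphXn tnth_mktuple; congr (_ ^+ _).
rewrite [RHS]/= mmap_mesym /symc_root rmorphM rmorph_sign.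
have -> : ev1 iota t P`_(D - i.+1) = (\prod_(j < D) ('X - (eta j)%:P))`_(D - i.+1).
  by rewrite -hroots coef_map.
have := mroots_coeff (mktuple eta) (Ordinal (ltn_ord i : i.+1 < D.+1)%N).
rewrite big_tuple; under eq_bigr do rewrite tnth_mktuple.
move=> ->; rewrite /= signrMK; apply: meval_eq => j; by rewrite tnth_mktuple.
Qed.

Lemma map_transfer A : sym_invariant A ->
  map_poly (ev1 iota t) (transfer A) = map_poly (mmap iota eta) A.
Proof.
move=> sA.
apply/polyP => i; rewrite !coef_map_id0 ?rmorph0 ?symc0 //.
exact/ev1_symc/sym_invariant_coef.
Qed.
End Eval.
End Transfer.

(** * The Galois resolvent *)

Section CoefMsize.
Variables (F : fieldType) (D : nat).
Implicit Types A B : {poly {mpoly F[D]}}.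

Definition coef_msize e A := forall i : nat, (msize (A`_i)%R <= e.+1)%N.

Lemma coef_msize_le e e' A : (e <= e')%N -> coef_msize e A -> coef_msize e' A.
Proof. by move=> h hA i; apply: leq_trans (hA i) _. Qed.

Lemma coef_msizeC e (p : {mpoly F[D]}) : (msize p <= e.+1)%N -> coef_msize e p%:P.
Proof. by move=> h i; rewrite coefC; case: eqP => _ //; rewrite msize0. Qed.

Lemma coef_msizeX e : coef_msize e 'X.
Proof. by move=> i; rewrite coefX; case: eqP; rewrite ?msize1 ?msize0. Qed.

Lemma coef_msizeB e A B : coef_msize e A -> coef_msize e B -> coef_msize e (A - B).
Proof.
move=> hA hB i; rewrite coefB; apply: leq_trans (mmeasureD_le _ _ _) _.
by rewrite geq_max mmeasureN hA hB.
Qed.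

Lemma coef_msize_sum e (I : Type) (r : seq I) (P : pred I) (E : I -> {poly {mpoly F[D]}}) :
  (forall i, P i -> coef_msize e (E i)) -> coef_msize e (\sum_(i <- r | P i) E i).
Proof.
move=> h i; rewrite coef_sum; elim/big_ind: _ => [|p p' hp hp'|j Pj]; first by rewrite msize0.
  by apply: leq_trans (mmeasureD_le _ _ _) _; rewrite geq_max hp hp'.
exact: h.
Qed.

Lemma coef_msizeM e e' A B : coef_msize e A -> coef_msize e' B -> coef_msize (e + e') (A * B).
Proof.
move=> hA hB i; rewrite coefM; elim/big_ind: _ => [|p p' hp hp'|j _]; first by rewrite msize0.
  by apply: leq_trans (mmeasureD_le _ _ _) _; rewrite geq_max hp hp'.
have [->|a0] := eqVneq A`_j 0; first by rewrite mul0r msize0.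
have [->|b0] := eqVneq B`_(i - j) 0; first by rewrite mulr0 msize0.
by rewrite msizeM // -subn1 leq_subLR add1n -addnS -addSn leq_add.
Qed.

Lemma coef_msize_prod (I : finType) (P : pred I) (E : I -> {poly {mpoly F[D]}}) :
  (forall i, P i -> coef_msize 1 (E i)) -> coef_msize #|I| (\prod_(i | P i) E i).
Proof.
move=> h; apply: (@coef_msize_le #|P|); first exact: max_card.
rewrite -sum1_card.
elim/big_ind2: _ => [|A e B e' hA hB|i /h //].
- by apply: (@coef_msizeC 0 1); rewrite msize1.
- exact: coef_msizeM.
Qed.
End CoefMsize.

Section Interp.
Variables (R : comNzRingType) (I : finType).

(** Lagrange interpolation without the division: at [f s] the value is [c s] times the derivative of
    [\prod_s' ('X - f s')] there. Leaving the denominator out keeps the coefficients polynomial in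
    the roots. *)
Definition lagrange (f c : I -> R) : {poly R} :=
  \sum_s (c s)%:P * \prod_(s' | s' != s) ('X - (f s')%:P).

Lemma lagrangeE f c s : (lagrange f c).[f s] = c s * \prod_(s' | s' != s) (f s - f s').
Proof.
rewrite horner_sum (bigD1 s) //= hornerM hornerC horner_prod [X in _ + X]big1 ?addr0; last first.
  move=> s' hs'; rewrite hornerM horner_prod (bigD1 s) 1?eq_sym //= hornerXsubC subrr.
  by rewrite mul0r mulr0.
by congr (_ * _); apply: eq_bigr => s' _; rewrite hornerXsubC.
Qed.
End Interp.

Lemma map_lagrange (R R' : comNzRingType) (I : finType) (h : {rmorphism R -> R'}) (f c : I -> R) :
  map_poly h (lagrange f c) = lagrange (h \o f) (h \o c).
Proof.
rewrite rmorph_sum; apply: eq_bigr => s _; rewrite rmorphM rmorph_prod.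
congr (_ * _); first by rewrite [LHS]map_polyC.
by apply: eq_bigr => s' _; rewrite rmorphB [X in X - _]map_polyX [X in _ - X]map_polyC.
Qed.

Lemma size_lagrange (R : comNzRingType) (I : finType) (f c : I -> R) : (size (lagrange f c) <= #|I|)%N.
Proof.
apply: (leq_trans (size_sum _ _ _)); apply/bigmax_leqP => s _.
rewrite mul_polyC (leq_trans (size_scale_leq _ _)) //.
rewrite -big_filter size_prod_XsubC size_filter -sum1_count sum1_card.
by rewrite -(cardC (pred1 s)) card1 add1n ltnS; apply/eq_leq/eq_card.
Qed.

Section Resolvent.
Variables (F : fieldType) (D : nat) (lam : 'I_D -> F).
Notation MP := {mpoly F[D]}.

Definition theta (s : 'S_D) : MP := \sum_j lam j *: 'X_(s j).
Definition resolvent : {poly MP} := \prod_s ('X - (theta s)%:P).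
(* At a root [theta s] of the resolvent, the quotient [resolvent_conj sg / resolvent_deriv] is the
   conjugate root [theta (sg * s)]. *)
Definition resolvent_deriv : {poly MP} := lagrange theta (fun=> 1).
Definition resolvent_conj (sg : 'S_D) : {poly MP} := lagrange theta (fun s => theta (sg * s)%g).
Definition resolvent_disc : MP := \prod_s \prod_(s' | s' != s) (theta s - theta s').

Lemma msym_theta u s : msym u (theta s) = theta (s * u)%g.
Proof.
rewrite /theta raddf_sum; apply: eq_bigr => j _ /=.
by rewrite msymZ /msym mmapX mmap1U permM.
Qed.

Lemma sym_invariant_resolvent : sym_invariant resolvent.
Proof.
move=> u; rewrite /resolvent rmorph_prod [RHS](reindex_inj (mulIg u)) /=.
apply: eq_bigr => s _; rewrite rmorphB [X in X - _]map_polyX [X in _ - X]map_polyC.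
by congr (_ - _%:P); apply: msym_theta.
Qed.

Lemma sym_invariant_lagrange c : (forall u s, msym u (c s) = c (s * u)%g) ->
  sym_invariant (lagrange theta c).
Proof.
move=> hc u; rewrite map_lagrange /lagrange [RHS](reindex_inj (mulIg u)) /=.
apply: eq_bigr => s _; rewrite hc.
rewrite [X in _ = _ * X](reindex_inj (mulIg u)).
under [X in _ = _ * X]eq_bigr => s' _ do rewrite -msym_theta.
under [X in _ = _ * X]eq_bigl => s' do rewrite (inj_eq (mulIg u)).
reflexivity.
Qed.

Lemma sym_invariant_deriv : sym_invariant resolvent_deriv.
Proof. by apply: sym_invariant_lagrange => u s; rewrite msym1. Qed.

(** Relabelling the roots multiplies on the right and [sg] multiplies on the left, so the two
    actions commute. *)
Lemma sym_invariant_conj sg : sym_invariant (resolvent_conj sg).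
Proof. by apply: sym_invariant_lagrange => u s; rewrite msym_theta mulgA. Qed.

Lemma sym_disc : resolvent_disc \is symmetric.
Proof.
apply/issymP => u; rewrite /resolvent_disc rmorph_prod [RHS](reindex_inj (mulIg u)) /=.
apply: eq_bigr => s _; rewrite rmorph_prod [RHS](reindex_inj (mulIg u)) /=.
apply: eq_big => s'; first by rewrite (inj_eq (mulIg u)).
by move=> _; rewrite msymB !msym_theta.
Qed.

Lemma msize_theta s : (msize (theta s) <= 2)%N.
Proof.
rewrite /theta; elim/big_ind: _ => [|p p' hp hp'|j _]; first by rewrite msize0.
  by apply: leq_trans (mmeasureD_le _ _ _) _; rewrite geq_max hp hp'.
by apply: leq_trans (msizeZ_le _ _) _; rewrite msizeX mdeg1.
Qed.

Let n := #|'S_D|.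

Lemma coef_msize_factor s : coef_msize 1 ('X - (theta s)%:P).
Proof. by apply: coef_msizeB; [exact: coef_msizeX|apply: coef_msizeC; apply: msize_theta]. Qed.

Lemma coef_msize_resolvent : coef_msize n resolvent.
Proof. by apply: coef_msize_prod => s _; apply: coef_msize_factor. Qed.

Lemma coef_msize_lagrange c : (forall s, msize (c s) <= 2)%N -> coef_msize n.+1 (lagrange theta c).
Proof.
move=> hc; apply: coef_msize_sum => s _; rewrite -add1n; apply: coef_msizeM.
  exact: coef_msizeC.
by apply: coef_msize_prod => s' _; apply: coef_msize_factor.
Qed.

Lemma msize_disc : (msize resolvent_disc <= (n * n).+1)%N.
Proof.
have h (I : finType) (P : pred I) e (E : I -> MP) : (forall i, msize (E i) <= e.+1)%N ->
    (msize (\prod_(i | P i) E i) <= (#|P| * e).+1)%N.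
  move=> hE; rewrite -sum1_card big_distrl /=.
  elim/big_ind2: _ => [|a p b p' hp hp'|i _]; [by rewrite msize1| |by rewrite mul1n].
  have [->|p0] := eqVneq p 0; first by rewrite mul0r msize0.
  have [->|p'0] := eqVneq p' 0; first by rewrite mulr0 msize0.
  by rewrite msizeM // -subn1 leq_subLR add1n -addnS -addSn leq_add.
rewrite /resolvent_disc; apply: (leq_trans (h _ _ n _ _)) => //.
move=> s; apply: (leq_trans (h _ _ 1%N _ _)); last by rewrite muln1 ltnS max_card.
move=> s'; apply: leq_trans (mmeasureD_le _ _ _) _.
by rewrite geq_max mmeasureN !msize_theta.
Qed.

Section Eval.
Variables (L : fieldType) (iota : {rmorphism F -> L}) (eta : 'I_D -> L).

Definition thetav (s : 'S_D) : L := \sum_j iota (lam j) * eta (s j).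

Lemma mmap_theta s : mmap iota eta (theta s) = thetav s.
Proof.
rewrite /theta raddf_sum; apply: eq_bigr => j _ /=.
by rewrite mmapZ mmapX mmap1U.
Qed.

Lemma map_resolvent : map_poly (mmap iota eta) resolvent = \prod_s ('X - (thetav s)%:P).
Proof.
rewrite /resolvent rmorph_prod; apply: eq_bigr => s _.
rewrite rmorphB [X in X - _]map_polyX [X in _ - X]map_polyC.
by congr (_ - _%:P); apply: mmap_theta.
Qed.

Lemma map_deriv_eval s :
  (map_poly (mmap iota eta) resolvent_deriv).[thetav s] =
  \prod_(s' | s' != s) (thetav s - thetav s').
Proof.
rewrite map_lagrange -[thetav s]mmap_theta lagrangeE /= rmorph1 mul1r.
by apply: eq_bigr => s' _; rewrite !mmap_theta.
Qed.

Lemma map_conj_eval sg s :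
  (map_poly (mmap iota eta) (resolvent_conj sg)).[thetav s] =
  thetav (sg * s)%g * \prod_(s' | s' != s) (thetav s - thetav s').
Proof.
rewrite map_lagrange -[thetav s]mmap_theta lagrangeE /= !mmap_theta.
by congr (_ * _); apply: eq_bigr => s' _; rewrite mmap_theta.
Qed.

Lemma mmap_disc : mmap iota eta resolvent_disc =
  \prod_s \prod_(s' | s' != s) (thetav s - thetav s').
Proof.
rewrite rmorph_prod; apply: eq_bigr => s _; rewrite rmorph_prod; apply: eq_bigr => s' _.
by rewrite rmorphB /= !mmap_theta.
Qed.

Lemma thetav_inj : mmap iota eta resolvent_disc != 0 -> injective thetav.
Proof.
rewrite mmap_disc => /prodf_neq0 h s s' e; apply/eqP; apply: contraTT isT => ne.
have /prodf_neq0/(_ s') := h s isT; rewrite eq_sym ne => /(_ isT).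
by rewrite e subrr eqxx.
Qed.

Lemma disc_neq0 : injective thetav -> mmap iota eta resolvent_disc != 0.
Proof.
move=> inj; rewrite mmap_disc; apply/prodf_neq0 => s _; apply/prodf_neq0 => s' ne.
by rewrite subr_eq0; apply: contraNneq ne => /inj ->.
Qed.

(** Two equal roots would give a transposition and the identity the same value of [thetav]. *)
Lemma eta_inj : injective thetav -> injective eta.
Proof.
move=> inj i j e; apply/eqP; apply: contraT => ne.
have : thetav (tperm i j) = thetav 1%g.
  by apply: eq_bigr => k _; rewrite perm1; congr (_ * _); case: tpermP => [->|->|].
by move/inj/permP/(_ i); rewrite tpermL perm1 => h; rewrite h eqxx in ne.
Qed.
End Eval.
End Resolvent.

(** * Counting the points with a given Frobenius *)

Lemma prod_XsubC_factor (L : fieldType) (I : finType) (f : I -> L) (p k : {poly L}) :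
  p \is monic -> p * k = \prod_s ('X - (f s)%:P) ->
  exists2 rs : seq I, uniq rs & p = \prod_(s <- rs) ('X - (f s)%:P).
Proof.
move=> mp h; have : p %| \prod_(s <- index_enum I) ('X - (f s)%:P) by rewrite -h dvdp_mulr.
case/dvdp_prod_XsubC => msk e; exists (mask msk (index_enum I)).
  by rewrite mask_uniq // index_enum_uniq.
by apply/eqP; rewrite -eqp_monic //; apply: monic_prod_XsubC.
Qed.

(** The degree in the inner variable is additive on products, as exchanging the two variables shows,
    so a factor cannot exceed the product. *)
Lemma factor_size_coef (R : idomainType) (e : nat) (Q k : {poly {poly R}}) : Q * k != 0 ->
  (forall i : nat, (size ((Q * k)`_i)%R <= e.+1)%N) -> (forall i : nat, (size (Q`_i)%R <= e.+1)%N).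
Proof.
move=> nz h i; apply: leq_trans (polyXY.max_size_coefXY _ _) _.
have [Q0 k0] : Q != 0 /\ k != 0 by apply/andP; rewrite -negb_or -mulf_eq0.
have : (polyXY.sizeY (Q * k) <= e.+1)%N by apply/bigmax_leqP => j _; apply: h.
rewrite !polyXY.sizeYE rmorphM size_mul ?polyXY.swapXY_eq0 //.
have : (0 < size (polyXY.swapXY k))%N by rewrite size_poly_gt0 polyXY.swapXY_eq0.
move: (size (polyXY.swapXY Q)) (size (polyXY.swapXY k)) => a [//|b] _.
by rewrite addnS /=; apply: leq_trans; rewrite leq_addr.
Qed.

Lemma simple_root_prod (L : fieldType) (rs : seq L) z : uniq rs -> z \in rs ->
  (\prod_(x <- rs) ('X - x%:P))^`().[z] != 0.
Proof.
rewrite -separable_prod_XsubC separable_poly.unlock => sep zr.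
by apply: (coprimep_root sep); rewrite root_prod_XsubC.
Qed.

Section SplittingCount.
Variables (F : finFieldType) (D kap0 : nat) (P : {poly {poly F}}).
Variables (eta0 lam : 'I_D -> F).
Hypothesis monP : P \is monic.
Hypothesis szP : size P = D.+1.
Hypothesis hP : forall j : nat, (size (P`_j)%R <= kap0.+1)%N.
Hypothesis P0 : map_poly (ev1 idfun 0) P = \prod_(j < D) ('X - (eta0 j)%:P).
Hypothesis lam_inj : injective (thetav lam idfun eta0).

Let n := #|'S_D|.
(** [kap] bounds the degrees in [t] of the coefficients of the resolvent, hence of its factor [Q].
    In [g], the summand [n.+2 * kap0] plays the same role for [G] and [H], and [kap * n] pays for
    their powers of [Y]. *)
Let kap := (n.+1 * kap0)%N.
Let g := (n.+2 * kap0 + kap * n)%N.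
Let R := transfer P (resolvent lam).
Let H := transfer P (resolvent_deriv lam).
Let G sg := transfer P (resolvent_conj lam sg).
Let disc := symc P (resolvent_disc lam).

Definition split_points : {set F} :=
  [set t | [exists eta : {ffun 'I_D -> F}, injectiveb eta &&
     (map_poly (ev1 idfun t) P == \prod_j ('X - (eta j)%:P))]].

Lemma size_transfer (A : {poly {mpoly F[D]}}) e (i : nat) : sym_invariant A -> coef_msize e A ->
  (size ((transfer P A)`_i)%R <= (e.+1 * kap0).+1)%N.
Proof.
move=> sA hA; rewrite coef_transfer.
apply: (leq_trans (size_symc hP (sym_invariant_coef _ sA))).
by rewrite ltnS leq_mul2r hA orbT.
Qed.

Lemma wt2_transfer_lagrange c : sym_invariant (lagrange (theta lam) c) ->
  (forall s, msize (c s) <= 2)%N -> wt2 kap g (transfer P (lagrange (theta lam) c)).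
Proof.
move=> sc hc j i.
have [jn|jn] := ltnP j n; last first.
  rewrite coef_transfer; have /leq_sizeP/(_ j jn) -> := size_lagrange (theta lam) c.
  by rewrite symc0 coef0 eqxx.
have := size_transfer j sc (coef_msize_lagrange lam hc).
rewrite -/n => hs; have [hi _|hi] := ltnP i (n.+2 * kap0).+1.
  by rewrite /g leq_add // leq_mul2l (ltnW jn) orbT.
by move/leq_sizeP: hs => /(_ i hi) ->; rewrite eqxx.
Qed.

Lemma monic_resolvent : R \is monic /\ size R = n.+1.
Proof.
have sr : size (resolvent lam) = n.+1.
  by rewrite [LHS]size_prod_XsubC -sum1_size sum1_card.
have mr : (resolvent lam)`_n = 1.
  have mres : resolvent lam \is monic by apply: monic_prod_XsubC.
  by move/monicP: mres; rewrite /lead_coef sr.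
have Rn : R`_n = 1 by rewrite coef_transfer mr symc1.
have sR : size R = n.+1.
  apply/eqP; rewrite eqn_leq; apply/andP; split.
    apply/leq_sizeP => j jn; rewrite coef_transfer [X in symc _ X]nth_default ?symc0 // sr //.
  by rewrite ltnNge; apply/negP => /leq_sizeP/(_ n (leqnn n))/eqP; rewrite Rn oner_eq0.
by split=> //; rewrite monicE /lead_coef sR Rn.
Qed.

Section Fiber.
Variables (L : fieldType) (iota : {rmorphism F -> L}) (t : L) (eta : 'I_D -> L).
Hypothesis hroots : map_poly (ev1 iota t) P = \prod_(j < D) ('X - (eta j)%:P).

Lemma fiber_resolvent : map_poly (ev1 iota t) R = \prod_s ('X - (thetav lam iota eta s)%:P).
Proof. by rewrite /R (map_transfer hroots) ?map_resolvent //; apply: sym_invariant_resolvent. Qed.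

Lemma fiber_disc : (ev1 iota t disc != 0) = (mmap iota eta (resolvent_disc lam) != 0).
Proof. by rewrite /disc (ev1_symc hroots) // sym_disc. Qed.

Lemma fiber_deriv s : ev2 iota t (thetav lam iota eta s) H =
  \prod_(s' | s' != s) (thetav lam iota eta s - thetav lam iota eta s').
Proof. by rewrite ev2E (map_transfer hroots) ?map_deriv_eval //; apply: sym_invariant_deriv. Qed.

Lemma fiber_conj sg s : ev2 iota t (thetav lam iota eta s) (G sg) =
  ev2 iota t (thetav lam iota eta s) H * thetav lam iota eta (sg * s)%g.
Proof.
rewrite [LHS]ev2E (map_transfer hroots); last exact: sym_invariant_conj.
by rewrite map_conj_eval mulrC -(fiber_deriv s).
Qed.

Lemma fiber_deriv_neq0 s : injective (thetav lam iota eta) ->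
  ev2 iota t (thetav lam iota eta s) H != 0.
Proof.
move=> inj; rewrite fiber_deriv; apply/prodf_neq0 => s' ne.
by rewrite subr_eq0; apply: contraNneq ne => /inj ->.
Qed.

Lemma fiber_factor (Q k : {poly {poly F}}) : R = Q * k -> Q \is monic ->
  exists2 rs : seq 'S_D, uniq rs &
    map_poly (ev1 iota t) Q = \prod_(s <- rs) ('X - (thetav lam iota eta s)%:P).
Proof.
move=> hR mQ; apply: (@prod_XsubC_factor _ _ _ _ (map_poly (ev1 iota t) k)).
  exact: monic_map.
by rewrite -fiber_resolvent hR rmorphM.
Qed.
End Fiber.

Section Places.
Variables (K : closedFieldType) (iota : {rmorphism F -> K}).
Variables (m : nat) (Q k : {poly {poly F}}).
Hypothesis hR : R = Q * k.
Hypothesis monQ : Q \is monic.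
Hypothesis szQ : size Q = m.+2.
Hypothesis indQ : indecomposable Q.

Lemma wt2_factor : wt2 kap (kap * m.+1) Q.
Proof.
have hs : forall i : nat, (size (Q`_i)%R <= kap.+1)%N.
  apply: (@factor_size_coef _ _ _ k); rewrite -hR.
    by rewrite monic_neq0 // monic_resolvent.1.
  move=> i; apply: size_transfer; [exact: sym_invariant_resolvent|exact: coef_msize_resolvent].
move=> j i; have [jm|jm] := ltnP j m.+1.
  have [hi _|hi] := ltnP i kap.+1.
    apply: (@leq_trans (kap + kap * j)); first by rewrite leq_add2r -ltnS.
    by rewrite -mulnS leq_mul2l jm orbT.
  by have /leq_sizeP/(_ i hi) -> := hs j; rewrite eqxx.
move: jm; rewrite leq_eqVlt => /orP[/eqP <-|jm]; last first.
  have -> : Q`_j = 0 by rewrite nth_default // szQ.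
  by rewrite coef0 eqxx.
have -> : Q`_m.+1 = 1 by move/monicP: monQ; rewrite /lead_coef szQ.
by rewrite coef1; case: i => [|i]; rewrite ?eqxx.
Qed.

Definition good t := ~~ root disc t.
Definition rts t : seq K := sval (closed_field_poly_normal (map_poly (ev1 iota (iota t)) Q)).

Lemma rtsE t : map_poly (ev1 iota (iota t)) Q = \prod_(z <- rts t) ('X - z%:P).
Proof.
rewrite /rts; case: (closed_field_poly_normal _) => r /= {1}->.
by have /monicP -> := monic_map (ev1 iota (iota t)) monQ; rewrite scale1r.
Qed.

Lemma size_rts t : size (rts t) = m.+1.
Proof.
have := size_prod_XsubC (rts t) id; rewrite -rtsE size_map_poly_id0 ?szQ; first by case.
by rewrite (monicP monQ) rmorph1 oner_eq0.
Qed.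

Lemma exists_roots t : exists eta : 'I_D -> K,
  map_poly (ev1 iota t) P = \prod_(j < D) ('X - (eta j)%:P).
Proof.
have [r hr] := closed_field_poly_normal (map_poly (ev1 iota t) P).
have mP := monic_map (ev1 iota t) monP.
rewrite (monicP mP) scale1r in hr.
have sr : size r = D.
  have := size_prod_XsubC r id; rewrite -hr size_map_poly_id0 ?szP; first by case.
  by rewrite (monicP monP) rmorph1 oner_eq0.
exists (fun j => nth 0 r j); rewrite hr (big_nth 0) sr big_mkord //.
Qed.

Lemma ev1_iota t p : ev1 iota (iota t) p = iota p.[t].
Proof. by rewrite ev1E horner_map. Qed.

Lemma good_thetav t eta : good t ->
  map_poly (ev1 iota (iota t)) P = \prod_(j < D) ('X - (eta j)%:P) -> injective (thetav lam iota eta).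
Proof.
move=> gt h; apply: thetav_inj; rewrite -(fiber_disc h) ev1_iota fmorph_eq0; exact: gt.
Qed.

Lemma rts_thetav t eta : good t ->
  map_poly (ev1 iota (iota t)) P = \prod_(j < D) ('X - (eta j)%:P) ->
  uniq (rts t) /\ forall z, z \in rts t -> exists s, z = thetav lam iota eta s.
Proof.
move=> gt h; have inj := good_thetav gt h.
have [rs urs hrs] := fiber_factor h hR monQ.
have pe : perm_eq (rts t) [seq thetav lam iota eta s | s <- rs].
  by apply: prod_XsubC_eq; rewrite -rtsE hrs big_map.
split; first by rewrite (perm_uniq pe) map_inj_uniq.
by move=> z; rewrite (perm_mem pe) => /mapP[s _ ->]; exists s.
Qed.

Lemma rts_uniq t : good t -> uniq (rts t).
Proof. by move=> gt; have [eta h] := exists_roots (iota t); have [] := rts_thetav gt h. Qed.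

Lemma rts_root t z : good t -> z \in rts t -> ev2 iota (iota t) z Q = 0.
Proof. by move=> gt zr; apply/eqP; rewrite ev2E rtsE -/(root _ _) root_prod_XsubC. Qed.

Lemma rts_deriv t z : good t -> z \in rts t -> ev2 iota (iota t) z Q^`() != 0.
Proof. by move=> gt zr; rewrite ev2E -deriv_map rtsE; apply: simple_root_prod => //; apply: rts_uniq. Qed.

Lemma frobenius_perm t eta : good t ->
  map_poly (ev1 iota (iota t)) P = \prod_(j < D) ('X - (eta j)%:P) ->
  exists pi : 'S_D, forall j, eta j ^+ #|F| = eta (pi j).
Proof.
move=> gt h; have inj := eta_inj (good_thetav gt h).
have hroot z : (ev2 iota (iota t) z P == 0) = [exists j, z == eta j].
  rewrite ev2E h horner_prod; apply/idP/existsP => [/prodf_eq0[j _]|[j /eqP ->]].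
    by rewrite hornerXsubC subr_eq0 => e; exists j.
  by apply/prodf_eq0; exists j => //; rewrite hornerXsubC subrr.
have hj j : exists i, eta j ^+ #|F| == eta i.
  apply/existsP; rewrite -hroot -ev2_frob expf_eq0 hroot; apply/andP; split.
    exact: ltnW (finNzRing_gt1 F).
  by apply/existsP; exists j.
pose f j := xchoose (hj j).
have hf j : eta j ^+ #|F| = eta (f j) by apply/eqP; exact: (xchooseP (hj j)).
have finj : injective f.
  move=> i j /(congr1 eta); rewrite -!hf => e; apply: inj; apply/eqP; rewrite -subr_eq0.
  have : (eta i - eta j) ^+ #|F| == 0 by rewrite (frobD iota) (frobN iota) e subrr.
  by rewrite expf_eq0 => /andP[].
by exists (perm finj) => j; rewrite permE.
Qed.

Lemma thetav_frob eta (pi s : 'S_D) : (forall j, eta j ^+ #|F| = eta (pi j)) ->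
  thetav lam iota eta s ^+ #|F| = thetav lam iota eta (s * pi)%g.
Proof.
move=> hpi; rewrite (frob_sum iota); apply: eq_bigr => j _.
by rewrite exprMn (frob_iota iota) hpi permM.
Qed.

Definition place_count sg := (\sum_(t | good t) count (frob_cond iota (G sg) H t) (rts t))%N.

Lemma places_covered t : good t ->
  (m.+1 <= \sum_(sg : 'S_D) count (frob_cond iota (G sg) H t) (rts t))%N.
Proof.
move=> gt; have [eta h] := exists_roots (iota t).
have inj := good_thetav gt h; have [_ hz] := rts_thetav gt h.
have [pi hpi] := frobenius_perm gt h.
rewrite -{1}(size_rts t) -sum1_size.
have -> : (\sum_(sg : 'S_D) count (frob_cond iota (G sg) H t) (rts t) =
    \sum_(z <- rts t) \sum_(sg : 'S_D) if frob_cond iota (G sg) H t z then 1 else 0)%N.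
  by rewrite exchange_big; apply: eq_bigr => sg _; rewrite -sum1_count big_mkcond.
rewrite [X in (X <= _)%N]big_seq [X in (_ <= X)%N]big_seq.
apply: leq_sum => z /hz[s ->].
have [sg hc] : exists sg, frob_cond iota (G sg) H t (thetav lam iota eta s).
  (* The Frobenius sends [theta s] to [theta (s * pi)], and [s * pi = (s * pi * s^-1) * s]: the
     label of the point is the conjugate of [pi] by [s]. *)
  exists (s * pi * s^-1)%g; apply/andP; split; first exact: (fiber_deriv_neq0 h).
  by apply/eqP; rewrite [RHS](fiber_conj h) mulgKV (thetav_frob s hpi).
have h1 : (1 <= if frob_cond iota (G sg) H t (thetav lam iota eta s) then 1 else 0)%N by rewrite hc.
by apply: leq_trans h1 _; rewrite (bigD1 sg) //= leq_addr.
Qed.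

(** The identity label means [s * pi = s], so the Frobenius fixes every root of [P (t, _)], not only
    [z]; fixed elements come from [F]. *)
Lemma split_of_place t z : good t -> z \in rts t -> frob_cond iota (G 1%g) H t z -> t \in split_points.
Proof.
move=> gt zr; have [eta h] := exists_roots (iota t).
have inj := good_thetav gt h; have [_ /(_ z zr)[s ->]] := rts_thetav gt h.
have [pi hpi] := frobenius_perm gt h.
case/andP => H0 /eqP e; have {}e := etrans e (fiber_conj h 1%g s).
move: e; rewrite mul1g => /(mulfI H0).
rewrite (thetav_frob s hpi) => /inj/(canRL (mulKg s)); rewrite mulVg => pi1.
have ha j : exists a, eta j == iota a.
  have [|a ->] := @frob_fixed F K iota (eta j); last by exists a.
  by rewrite hpi pi1 perm1.
rewrite inE; apply/existsP; exists [ffun j => xchoose (ha j)].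
have he j : iota (xchoose (ha j)) = eta j by apply/esym/eqP/(xchooseP (ha j)).
apply/andP; split.
  by apply/injectiveP => i j; rewrite !ffunE => /(congr1 iota); rewrite !he => /(eta_inj inj).
apply/eqP; apply: (map_poly_inj iota); rewrite -map_poly_comp.
transitivity (map_poly (ev1 iota (iota t)) P).
  apply: eq_map_poly => p; rewrite ev1_iota; transitivity (iota (ev1 idfun t p)) => //.
  by rewrite ev1E map_poly_id.
rewrite h rmorph_prod; apply: eq_bigr => j _.
by rewrite [RHS]rmorphB [X in _ = X - _]map_polyX [X in _ = _ - X]map_polyC ffunE; congr (_ - _%:P); exact/esym/he.
Qed.

Lemma place_count_1 : (place_count 1%g <= m.+1 * #|split_points|)%N.
Proof.
rewrite /place_count mulnC -sum_nat_const big_mkcond [X in (_ <= X)%N]big_mkcond /=.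
apply: leq_sum => t _; case: ifP => // gt.
have [hc|hc] := posnP (count (frob_cond iota (G 1%g) H t) (rts t)); first by rewrite hc.
move: hc; rewrite -has_count => /hasP[z zr hz].
by rewrite (split_of_place gt zr hz) -(size_rts t) count_size.
Qed.

(** [disc] is a nonzero polynomial because its value at [t = 0] is, by the choice of [lam]; its
    degree then bounds the bad points. *)
Lemma card_bad : (#|[pred t | ~~ good t]| <= (n * n).+1 * kap0)%N.
Proof.
have d0 : disc != 0.
  have := disc_neq0 lam_inj; rewrite -(fiber_disc P0); apply: contraNneq => ->.
  by rewrite rmorph0.
have := max_poly_roots d0 (rs := enum [pred t | ~~ good t]).
rewrite enum_uniq -cardE => /(_ _ isT).
have -> : all (root disc) (enum [pred t | ~~ good t]).
  by apply/allP => t; rewrite mem_enum inE /good negbK.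
move=> /(_ isT) h; rewrite -ltnS; apply: leq_trans h _.
apply: leq_trans (size_symc hP (sym_disc lam)) _.
by rewrite ltnS leq_mul2r msize_disc orbT.
Qed.

Lemma exists_origin : exists rs : seq 'S_D, [/\ uniq rs, size rs = m.+1 &
   map_poly (ev1 idfun 0) Q = \prod_(s <- rs) ('X - (thetav lam idfun eta0 s)%:P)].
Proof.
have [rs urs hrs] := fiber_factor P0 hR monQ; exists rs; split=> //.
have := size_prod_XsubC rs (thetav lam idfun eta0); rewrite -hrs size_map_poly_id0 ?szQ; first by case.
by rewrite (monicP monQ) rmorph1 oner_eq0.
Qed.

Section Origin.
Variables (rs : seq 'S_D) (s1 : 'S_D).
Hypothesis urs : uniq rs.
Hypothesis srs : size rs = m.+1.
Hypothesis Q0 : map_poly (ev1 idfun 0) Q = \prod_(s <- rs) ('X - (thetav lam idfun eta0 s)%:P).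
Hypothesis s1rs : s1 \in rs.
Notation th0 := (thetav lam idfun eta0).
Let r0 := [seq th0 s | s <- rs].

Lemma origin_prod : map_poly (ev1 idfun 0) Q = \prod_(z <- r0) ('X - z%:P).
Proof. by rewrite Q0 big_map. Qed.

Lemma origin_uniq : uniq r0.
Proof. by rewrite map_inj_uniq. Qed.

Lemma origin_root s : (ev2 idfun 0 (th0 s) Q == 0) = (s \in rs).
Proof.
by rewrite ev2E origin_prod -/(root _ _) root_prod_XsubC mem_map.
Qed.

Lemma origin_deriv : ev2 idfun 0 (th0 s1) Q^`() != 0.
Proof.
rewrite ev2E -deriv_map origin_prod; apply: simple_root_prod; first exact: origin_uniq.
exact: map_f.
Qed.

Lemma place_count_leq sg s : (s * s <= #|F|)%N -> (#|F| < s.+1 * s.+1)%N ->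
  (place_count sg <= #|F| + stepanov_const m kap g * s)%N.
Proof.
move=> hs1 hs2.
have r0s : size r0 = m.+1 by rewrite size_map.
have thr : th0 s1 \in r0 by exact: map_f.
have e0 : ev2 idfun 0 (th0 s1) Q = 0 by apply/eqP; rewrite origin_root.
have wG : wt2 kap g (G sg).
  by apply: wt2_transfer_lagrange; [exact: sym_invariant_conj|move=> u; apply: msize_theta].
have wH : wt2 kap g H.
  by apply: wt2_transfer_lagrange; [exact: sym_invariant_deriv|move=> u; rewrite msize1].
exact: (@stepanov F K iota kap m g Q (G sg) H monQ szQ wt2_factor
  (fun u => @det_nmx_eq0 F K iota m.+1 Q u monQ szQ indQ) wG wH (th0 s1) r0
  origin_uniq r0s thr e0 origin_deriv good rts rts_uniq (fun t _ => size_rts t)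
  rts_root rts_deriv s hs1 hs2).
Qed.

Definition other_bound := (m.+1 * (kap + g * m.+1 + kap * m.+1))%N.

(* [Q (t, G sg / H)] does not vanish at the point [(0, th0 s1)] of [Q], hence vanishes at boundedly
   many points of [Q]; and the points counted are among its zeros, since [z ^ q] is a root of [Q]. *)
Lemma place_count_other sg : (sg * s1)%g \notin rs -> (place_count sg <= other_bound)%N.
Proof.
move=> hsg.
have wG : wt2 kap g (G sg).
  by apply: wt2_transfer_lagrange; [exact: sym_invariant_conj|move=> u; apply: msize_theta].
have wH : wt2 kap g H.
  by apply: wt2_transfer_lagrange; [exact: sym_invariant_deriv|move=> u; rewrite msize1].
pose E := homsubst (G sg) H m.+1 Q.
have sQ : (size Q <= m.+2)%N by rewrite szQ.
have wE : wt2 kap (kap + g * m.+1) E.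
  apply: wt2_homsubst => //.
  apply: (@factor_size_coef _ _ _ k); rewrite -hR.
    by rewrite monic_neq0 // monic_resolvent.1.
  move=> i; apply: size_transfer; [exact: sym_invariant_resolvent|exact: coef_msize_resolvent].
have E0 : ev2 idfun 0 (th0 s1) E != 0.
  have H0 := fiber_deriv_neq0 P0 s1 lam_inj.
  have := ev2_homsubst (n := m.+1) sQ (esym (fiber_conj P0 sg s1)).
  rewrite -/E => ->; rewrite mulf_neq0 ?expf_neq0 //.
  by rewrite origin_root.
have d0 : \det (nmx m.+1 Q E) != 0.
  apply: contraNneq E0 => /(det_nmx_eq0 iota monQ szQ indQ) r0'.
  rewrite (rdivp_eq monQ E) r0' addr0 rmorphM mulf_eq0; apply/orP; right.
  by rewrite origin_root.
have := size_det_nmx monQ szQ wt2_factor wE; rewrite -(size_map_poly iota).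
have id0 : map_poly iota (\det (nmx m.+1 Q E)) != 0 by rewrite map_poly_eq0.
move=> hsz; rewrite -ltnS; apply: leq_trans hsz.
rewrite /place_count -big_filter.
apply: (@size_prod_dvdp _ _ _ iota) => //; [exact: fmorph_inj|exact/filter_uniq/index_enum_uniq|].
move=> t; rewrite mem_filter => /andP[gt _].
(* Simple vanishing is enough here, so the constants [z] serve as branches with [M = 1]. *)
rewrite -[count _ _]mul1n.
apply: (@nmx_mult _ m.+1 Q monQ szQ _ _ _ _ _ _ (fun z => z%:P)); [exact: rts_uniq|exact: size_rts|].
move=> z zr /andP[_ /eqP HG]; rewrite expr1.
have hz u : ev2 iota (iota t) z u = 0 -> 'X - (iota t)%:P %| evJ iota z%:P u.
  by move=> hu; rewrite dvdp_XsubCl /root evJ_horner hornerC hu.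
split; [by rewrite hornerC|exact/hz/rts_root|].
apply: hz; rewrite (ev2_homsubst (n := m.+1) sQ HG) -ev2_frob rts_root //.
by rewrite expr0n; have := finNzRing_gt1 F; case: #|F| => // q _; rewrite mulr0.
Qed.

Lemma card_stabilizer : (#|[set sg : 'S_D | (sg * s1)%g \in rs]| <= m.+1)%N.
Proof.
rewrite -srs -(card_uniqP urs) -(card_imset _ (mulIg s1)).
apply: subset_leq_card; apply/subsetP => _ /imsetP[sg + ->]; by rewrite inE.
Qed.

Lemma split_points_bound s : (s * s <= #|F|)%N -> (#|F| < s.+1 * s.+1)%N ->
  (#|F| <= n * #|split_points| + n * (stepanov_const m kap g * s + other_bound + (n * n).+1 * kap0))%N.
Proof.
move=> hs1 hs2.
pose S := [set sg : 'S_D | (sg * s1)%g \in rs].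
have S1 : 1%g \in S by rewrite inE mul1g.
have cS : (#|S| <= m.+1)%N by exact: card_stabilizer.
have mn : (m.+1 <= n)%N by rewrite -srs -(card_uniqP urs) max_card.
have hcov : (m.+1 * #|[pred t | good t]| <= \sum_sg place_count sg)%N.
  rewrite /place_count exchange_big /= mulnC -sum_nat_const.
  by apply: leq_sum => t gt; apply: places_covered.
have hgood : (#|F| <= #|[pred t | good t]| + (n * n).+1 * kap0)%N.
  rewrite -(cardC [pred t | good t]) leq_add2l; apply: leq_trans card_bad.
  by apply/eq_leq/eq_card => t; rewrite !inE.
have h1 := place_count_1.
pose C := stepanov_const m kap g.
(* [S] has at most [m] elements besides the identity. Taking their [m * (q + C * s)] away from the
   total of about [m.+1 * q] leaves one [q] for the identity. *)
have hS : (\sum_(sg in S) place_count sg <= m.+1 * #|split_points| + m * (#|F| + C * s))%N.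
  rewrite (bigD1 1%g) //=; apply: leq_add => //.
  apply: (@leq_trans (\sum_(sg in S | sg != 1%g) (#|F| + C * s))%N).
    by apply: leq_sum => sg _; apply: place_count_leq.
  rewrite sum_nat_const leq_mul2r; apply/orP; right.
  move: cS; rewrite (cardsD1 1%g) S1 add1n ltnS; apply: leq_trans.
  by apply/subset_leq_card/subsetP => x; rewrite in_setD1 unfold_in => /andP[-> ->].
have hnS : (\sum_(sg | sg \notin S) place_count sg <= n * other_bound)%N.
  apply: (@leq_trans (\sum_(sg | sg \notin S) other_bound)%N).
    by apply: leq_sum => sg; rewrite inE; apply: place_count_other.
  by rewrite sum_nat_const leq_mul2r max_card orbT.
rewrite (bigID (mem S)) /= in hcov.
move: hcov hgood hS hnS; rewrite -/C.
set A := (\sum_(i in S) _)%N; set B := (\sum_(i | i \notin S) _)%N; move: A B => A B.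
move: mn; move: n (#|F|) (#|[pred t | good t]|) (#|split_points|) other_bound (C * s)%N => nn q gd T ob Cs mn hcov hgood hS hnS.
have e1 : (m.+1 * q <= m.+1 * gd + m.+1 * ((nn * nn).+1 * kap0))%N by rewrite -mulnDr leq_mul2l hgood orbT.
have e2 : (m.+1 * ((nn * nn).+1 * kap0) <= nn * ((nn * nn).+1 * kap0))%N by rewrite leq_mul2r mn orbT.
have e3 : (m.+1 * T <= nn * T)%N by rewrite leq_mul2r mn orbT.
have e4 : (m * Cs <= nn * Cs)%N by rewrite leq_mul2r (ltnW mn) orbT.
move: e2 e1; move: ((nn * nn).+1 * kap0)%N => X e2 e1; rewrite !mulnDr; rewrite mulnDr in hS; lia.
Qed.
End Origin.
End Places.
End SplittingCount.

(** * Separating linear forms, and a bound uniform in the field *)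

Lemma exists_nonroot (F : finFieldType) (p : {poly F}) :
  p != 0 -> (size p <= #|F|)%N -> exists x, ~~ root p x.
Proof.
move=> p0 sp; apply/existsP; rewrite -negb_forall; apply: contraL sp => /forallP h.
rewrite -ltnNge cardE; apply: max_poly_roots => //; last exact: enum_uniq.
by apply/allP => x _; apply: h.
Qed.

(** Each nonzero vector [v i] is read as a nonzero polynomial of degree below [D]; a non-root of
    their product gives a form nonzero on all of them. Applied to differences, it yields both the
    weights [lam] of the resolvent and the linear form [u] on the grid. *)
Lemma moment_curve_separates (F : finFieldType) (I : finType) D (v : I -> 'I_D -> F) (P : pred I) :
  (forall i, P i -> exists j, v i j != 0) -> (#|I| * D < #|F|)%N ->
  exists x : F, forall i, P i -> \sum_(j < D) x ^+ j * v i j != 0.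
Proof.
move=> hv hq; pose p i : {poly F} := \sum_(j < D) v i j *: 'X^j.
have cp i (j : 'I_D) : (p i)`_j = v i j.
  rewrite /p coef_sum (bigD1 j) //= coefZ coefXn eqxx mulr1 big1 ?addr0 // => k kj.
  by rewrite coefZ coefXn (negbTE (_ : (j : nat) != k)) ?mulr0 // eq_sym.
have sp i : (size (p i) <= D)%N.
  apply: (leq_trans (size_sum _ _ _)); apply/bigmax_leqP => j _.
  by rewrite (leq_trans (size_scale_leq _ _)) // size_polyXn.
have [||x hx] := @exists_nonroot F (\prod_(i | P i) p i).
- apply/prodf_neq0 => i /hv[j vj]; apply: contraNneq vj => h.
  by rewrite -cp h coef0.
- apply: (leq_trans (size_poly_prod_leq _ _)); rewrite leq_subLR.
  apply: (@leq_trans (#|F| + 0)); last by rewrite addn0 leq_addl.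
  rewrite addn0; apply: leq_ltn_trans hq; apply: (@leq_trans (\sum_(i | P i) D)).
    by apply: leq_sum => i _; apply: sp.
  by rewrite sum_nat_const leq_mul2r max_card orbT.
exists x => i Pi; apply: contraNneq hx => h.
rewrite /root horner_prod; apply/prodf_eq0; exists i => //; apply/eqP.
rewrite -[RHS]h horner_sum; apply: eq_bigr => j _.
by rewrite hornerZ hornerXn mulrC.
Qed.

Lemma splitting_lower_bound D kap0 : exists c : nat, forall (F : finFieldType) (P : {poly {poly F}})
    (eta0 : 'I_D -> F) s,
  P \is monic -> size P = D.+1 -> (forall j : nat, (size (P`_j)%R <= kap0.+1)%N) ->
  injective eta0 -> map_poly (ev1 idfun 0) P = \prod_(j < D) ('X - (eta0 j)%:P) ->
  (s * s <= #|F|)%N -> (#|F| < s.+1 * s.+1)%N ->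
  (#|F| <= D`! * #|split_points D P| + c * s)%N.
Proof.
pose n := #|'S_D|; pose kap := (n.+1 * kap0)%N; pose g := (n.+2 * kap0 + kap * n)%N.
(* The degree [m.+1] of the factor depends on the field and the constant must not: [stepanov_const]
   is summed over all possible [m], and [other_bound] is taken at its largest. The last summand
   settles [q <= n * n * D], where no separating [lam] is guaranteed. *)
exists (n * (\sum_(m < n) stepanov_const m kap g + n * (kap + g * n + kap * n) + (n * n).+1 * kap0) + n * n * D)%N.
move=> F P eta0 s monP szP hP einj P0 hs1 hs2.
have s1 : (0 < s)%N by case: s hs1 hs2 => // _; rewrite mul1n ltnNge (ltnW (finNzRing_gt1 F)).
have [hq|hq] := leqP #|F| (n * n * D).
  apply: (leq_trans hq); apply: leq_trans (leq_addl _ _).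
  by rewrite mulnDl; apply: leq_trans (leq_addl _ _); rewrite leq_pmulr.
pose v (i : 'S_D * 'S_D) (j : 'I_D) := eta0 (i.1 j) - eta0 (i.2 j).
have [||x hx] := @moment_curve_separates F ('S_D * 'S_D)%type D v (fun i => i.1 != i.2).
- move=> [a b] /= ab; apply/existsP; rewrite -negb_forall; apply: contra ab => /forallP h.
  by apply/eqP/permP => j; apply/einj/eqP; rewrite -subr_eq0; apply: h.
- by rewrite card_prod.
pose lam (j : 'I_D) := x ^+ j.
have lam_inj : injective (thetav lam idfun eta0).
  move=> a b e; apply/eqP; apply: contraT => ab.
  have := hx (a, b) ab; rewrite /v /=; under eq_bigr do rewrite mulrBr.
  by rewrite sumrB -/(thetav lam idfun eta0 a) -/(thetav lam idfun eta0 b) e subrr eqxx.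
have [K [iota _]] := countable_algebraic_closure F.
have [monR szR] := monic_resolvent P lam.
have sR : (1 < size (transfer P (resolvent lam)))%N.
  by rewrite szR ltnS; apply/card_gt0P; exists 1%g.
have [Q [k [hR monQ sQ indQ]]] := exists_indecomposable_factor monR sR.
have [m szQ] : exists m, size Q = m.+2 by case: (size Q) sQ => [|[|m]] // _; exists m.
have [rs [urs srs Q0]] := exists_origin P0 hR monQ szQ.
have [s1' s1rs] : exists s1, s1 \in rs by case: rs srs {urs Q0} => // a rs' _; exists a; rewrite mem_head.
have mn : (m < n)%N by rewrite -ltnS -srs -(card_uniqP urs) ltnS max_card.
have := @split_points_bound _ _ _ _ _ _ monP szP hP P0 lam_inj _ iota _ _ _ hR monQ szQ indQ rs s1' urs srs Q0 s1rs s hs1 hs2.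
rewrite -/n -/kap -/g => h.
have hC : (stepanov_const m kap g <= \sum_(m < n) stepanov_const m kap g)%N.
  by rewrite (bigD1 (Ordinal mn)) //= leq_addr.
have hO : (other_bound D kap0 m <= n * (kap + g * n + kap * n))%N.
  have aux a b K' G' : (a <= b -> a * (K' + G' * a + K' * a) <= b * (K' + G' * b + K' * b))%N.
    by move=> ab; apply: leq_mul => //; apply: leq_add; [apply: leq_add|]; rewrite // leq_mul2l ab orbT.
  exact: aux.
move: h hC hO; rewrite -card_Sn -/n.
move: (stepanov_const m kap g) (\sum_(m < n) _)%N (other_bound D kap0 m) (n * (kap + g * n + kap * n))%N => C C' O O'.
move: ((n * n).+1 * kap0)%N (#|split_points D P|) (n * n * D)%N => Y T Z h hC hO.
apply: (leq_trans h); rewrite leq_add2l mulnDl; apply: leq_trans (leq_addr _ _).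
rewrite -mulnA leq_mul2l; apply/orP; right.
rewrite !mulnDl; apply: leq_add; first apply: leq_add.
- by rewrite leq_mul2r hC orbT.
- by apply: (leq_trans hO); rewrite leq_pmulr.
- by rewrite leq_pmulr.
Qed.

(** * Elimination over the box monomials *)

Section FunMatrix.
Variables (R : comNzRingType) (I : finType).
Implicit Types B : I -> I -> R.

Definition fun_mx B : 'M[R]_#|I| := \matrix_(i, j) B (enum_val i) (enum_val j).
Definition fun_det B : R := \det (fun_mx B).
Definition fun_adj B (b c : I) : R := (\adj (fun_mx B)) (enum_rank b) (enum_rank c).

Lemma sum_enum_val (E : I -> R) : \sum_(i < #|I|) E (enum_val i) = \sum_b E b.
Proof. by rewrite [RHS](reindex (@enum_val I predT)) //; apply: onW_bij; apply: enum_val_bij. Qed.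

Lemma fun_adj_mul B b c : \sum_g fun_adj B b g * B g c = fun_det B * (b == c)%:R.
Proof.
have := congr1 (fun M : 'M_#|I| => M (enum_rank b) (enum_rank c)) (mul_adj_mx (fun_mx B)).
rewrite mxE [X in _ = X]mxE (inj_eq enum_rank_inj) mulr_natr => <-; rewrite -sum_enum_val.
by apply: eq_bigr => j _; rewrite /fun_adj [fun_mx B j _]mxE enum_valK enum_rankK.
Qed.

Lemma fun_mul_adj B b c : \sum_g B b g * fun_adj B g c = fun_det B * (b == c)%:R.
Proof.
have := congr1 (fun M : 'M_#|I| => M (enum_rank b) (enum_rank c)) (mul_mx_adj (fun_mx B)).
rewrite mxE [X in _ = X]mxE (inj_eq enum_rank_inj) mulr_natr => <-; rewrite -sum_enum_val.
by apply: eq_bigr => j _; rewrite /fun_adj [fun_mx B _ j]mxE enum_valK enum_rankK.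
Qed.
End FunMatrix.

Lemma fun_det_neq0 (R : idomainType) (I : finType) (B : I -> I -> R) :
  (forall u : I -> R, (forall c, \sum_b u b * B b c = 0) -> forall b, u b = 0) -> fun_det B != 0.
Proof.
move=> h; apply/det0P => -[w w0 hw]; case/eqP: w0; apply/rowP => i; rewrite mxE.
rewrite -[i]enum_valK; apply: (h (fun b => w 0 (enum_rank b))) => c.
rewrite -sum_enum_val.
have := congr1 (fun M : 'rV_#|I| => M 0 (enum_rank c)) hw.
rewrite mxE [X in _ = X]mxE => e; rewrite -[RHS]e.
by apply: eq_bigr => j _; rewrite [fun_mx B j _]mxE enum_valK enum_rankK.
Qed.

Lemma size_fun_det (R : comNzRingType) (I : finType) e (B : I -> I -> {poly R}) :
  (forall b c, size (B b c) <= e.+1)%N -> (size (fun_det B) <= (#|I| * e).+1)%N.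
Proof. by move=> h; apply: size_det_leq => i j; rewrite mxE. Qed.

Lemma size_fun_adj (R : comNzRingType) (I : finType) e (B : I -> I -> {poly R}) b c :
  (forall b c, size (B b c) <= e.+1)%N -> (size (fun_adj B b c) <= (#|I| * e).+1)%N.
Proof.
move=> h; rewrite /fun_adj mxE /cofactor.
have hd : (size (\det (row' (enum_rank c) (col' (enum_rank b) (fun_mx B)))) <= (#|I| * e).+1)%N.
  apply: (@leq_trans (#|I|.-1 * e).+1); last by rewrite ltnS leq_mul2r leq_pred orbT.
  by apply: size_det_leq => i j; rewrite !mxE.
by rewrite -signr_odd; case: (odd _); rewrite ?expr0 ?expr1 ?mul1r ?mulN1r ?size_polyN.
Qed.

Lemma fun_det_map (R R' : comNzRingType) (phi : {rmorphism R -> R'}) (I : finType) (B : I -> I -> R) :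
  phi (fun_det B) = fun_det (fun b c => phi (B b c)).
Proof. by rewrite /fun_det -det_map_mx; congr (\det _); apply/matrixP => i j; rewrite !mxE. Qed.

Lemma msize_mulX_leq (R : idomainType) n (m : 'X_{1..n}) (p : {mpoly R[n]}) :
  (msize ('X_[m] * p) <= mdeg m + msize p)%N.
Proof.
have [->|nz] := eqVneq p 0; first by rewrite mulr0 msize0.
have X0 : ('X_[m] : {mpoly R[n]}) != 0 by rewrite -msize_poly_eq0 [X in X == _]mmeasureX.
apply: eq_leq; apply: etrans (msizeM X0 nz) _.
exact: (congr1 (fun a => (a + msize p).-1) (mmeasureX _ _ _)).
Qed.

Section Elimination.
Variables (F : fieldType) (k N : nat) (d : 'I_k -> nat) (fs v : 'I_k -> {mpoly F[k]}).
Hypothesis fs_lead : forall i, (msize (fs i - 'X_[U_(i) *+ d i])%R <= d i)%N.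
Hypothesis v_size : forall i, (msize (v i) <= (d i).+1)%N.
Notation I := 'X_{1..k < N.+1}.

Definition over_box (b : I) : option 'I_k := [pick i | (d i <= b i)%N].
Definition box : {set I} := [set b | over_box b == None].
Definition row_base (b : I) : {mpoly F[k]} :=
  if over_box b is Some i then 'X_[b - U_(i) *+ d i] * fs i else 'X_[b].
Definition row_pert (b : I) : {mpoly F[k]} :=
  if over_box b is Some i then 'X_[b - U_(i) *+ d i] * v i else 0.
(* The row [b] of [elim] is a multiple of the [i]-th equation [fs i + t v i] with leading monomial
   [X ^ b] if [d i <= b i], and is [X ^ b] itself if [b] lies in the box. Inverting this matrix
   over [F[t]] expresses [h X ^ b] by box monomials modulo the equations. *)
Definition elim (b c : I) : {poly F} := ((row_base b)@_c)%:P + 'X * ((row_pert b)@_c)%:P.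
Notation h := (fun_det elim).
Notation adj := (fun_adj elim).

Lemma over_boxP b i : over_box b = Some i -> (U_(i) *+ d i <= b)%MM.
Proof.
rewrite /over_box; case: pickP => // j hj [<-]; apply/mnm_lepP => l.
by rewrite mulmnE mnm1E; case: eqP => [<-|_]; rewrite ?mul1n // mul0n.
Qed.

Lemma boxP b i : b \in box -> (b i < d i)%N.
Proof. by rewrite inE /over_box; case: pickP => // /(_ i) /negbT; rewrite -ltnNge. Qed.

Lemma row_base_lead b : (msize (row_base b - 'X_[b])%R <= mdeg b)%N.
Proof.
rewrite /row_base; case E: (over_box b) => [i|]; last by rewrite subrr msize0.
have le := over_boxP E.
rewrite -{2}(submK le) mpolyXD -mulrBr.
apply: leq_trans (msize_mulX_leq _ _) _.
have hb : mdeg b = (mdeg (b - U_(i) *+ d i)%MM + d i)%N.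
  by rewrite -{1}(submK le) mdegD mdegMn mdeg1 mul1n.
by rewrite hb leq_add2l.
Qed.

Lemma row_base_coef (b : I) (c : 'X_{1..k}) : (mdeg b <= mdeg c)%N -> (row_base b)@_c = (bmnm b == c)%:R.
Proof.
move=> hbc; have : (row_base b - 'X_[b])@_c = 0.
  by apply: memN_msupp_eq0; apply: msize_mdeg_ge; apply: leq_trans (row_base_lead b) hbc.
by rewrite mcoeffB mcoeffX => /eqP; rewrite subr_eq0 => /eqP.
Qed.

(** At [t = 0] the matrix is unitriangular for the degree: the only monomial of degree at least
    [mdeg b] in row [b] is [X ^ b]. Descending induction on the degree kills a left kernel
    vector. *)
Lemma elim_det0 : h.[0] != 0.
Proof.
rewrite -[h.[0]]/(horner_eval 0 h) fun_det_map; apply: fun_det_neq0 => u hu.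
have e0 b c : horner_eval 0 (elim b c) = (row_base b)@_c.
  by rewrite /horner_eval /elim hornerD hornerM hornerX mul0r addr0 hornerC.
suff hn n' : forall b : I, (N.+1 - n' <= mdeg b)%N -> u b = 0 by move=> b; apply: (hn N.+1); rewrite subnn.
elim: n' => [|n' IH] b hb; first by move: hb; rewrite subn0 leqNgt; case/negP; exact: (valP b).
apply/eqP; rewrite -[u b]mulr1; apply/eqP; rewrite -[RHS](hu b) (bigD1 b) //= e0.
rewrite row_base_coef // eqxx [X in _ + X]big1 ?addr0 // => b' b'b; rewrite e0.
have [hb'|hb'] := leqP (mdeg b') (mdeg b).
  by rewrite row_base_coef // (inj_eq val_inj) (negbTE b'b) mulr0.
by rewrite IH ?mul0r //; lia.
Qed.

Lemma size_elim b c : (size (elim b c) <= 2)%N.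
Proof.
rewrite /elim; apply: leq_trans (size_polyD _ _) _; rewrite geq_max.
rewrite (leq_trans (size_polyC_leq1 _)) //=.
have [->|nz] := eqVneq ((row_pert b)@_c) 0; first by rewrite mulr0 size_poly0.
by rewrite mulrC size_mulX ?polyC_eq0 // size_polyC nz.
Qed.

Lemma msize_row_base b : (msize (row_base b) <= N.+1)%N.
Proof.
rewrite -(subrK 'X_[b] (row_base b)); apply: leq_trans (mmeasureD_le _ _ _) _.
rewrite geq_max mmeasureX (valP b) andbT; apply: leq_trans (row_base_lead b) _.
exact: ltnW (valP b).
Qed.

Lemma msize_row_pert b : (msize (row_pert b) <= N.+1)%N.
Proof.
rewrite /row_pert; case E: (over_box b) => [i|]; last by rewrite msize0.
have le := over_boxP E.
apply: leq_trans (msize_mulX_leq _ _) _.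
have hb : mdeg b = (mdeg (b - U_(i) *+ d i)%MM + d i)%N.
  by rewrite -{1}(submK le) mdegD mdegMn mdeg1 mul1n.
by apply: leq_trans (valP b); rewrite hb -addnS leq_add2l.
Qed.

Section Eval.
Variables (W : comNzRingType) (phi : {rmorphism {poly F} -> W}) (x : 'I_k -> W).
Let psi : {rmorphism F -> W} := phi \o polyC.

Definition sys_eval i : W := mmap psi x (fs i) + phi 'X * mmap psi x (v i).

Lemma elim_eval (b : I) : \sum_c phi (elim b c) * mmap1 x c =
  if over_box b is Some i then mmap1 x (b - U_(i) *+ d i)%MM * sys_eval i else mmap1 x b.
Proof.
have -> : \sum_c phi (elim b c) * mmap1 x c = mmap psi x (row_base b) + phi 'X * mmap psi x (row_pert b).
  rewrite (mmapE N.+1) ?msize_row_base // [in RHS](mmapE N.+1) ?msize_row_pert //.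
  rewrite mulr_sumr -big_split; apply: eq_bigr => c _.
  by rewrite /elim rmorphD rmorphM mulrDl mulrA.
rewrite /row_base /row_pert; case: (over_box b) => [i|]; last by rewrite mmap0 mulr0 addr0 mmapX.
rewrite !rmorphM /= mmapX /sys_eval mulrDr; congr (_ + _); ring.
Qed.

(** Multiply [elim_eval] by the adjugate: rows in the box return box monomials, the others multiples
    of the equations. The target ring is arbitrary so that [x] may be a zero at a given [t] or a
    branch over [F[t]]. *)
Lemma elim_relation (b : I) : exists g : 'I_k -> W,
  phi h * mmap1 x b - \sum_(a in box) phi (adj b a) * mmap1 x a = \sum_i g i * sys_eval i.
Proof.
exists (fun i => \sum_(c | over_box c == Some i) phi (adj b c) * mmap1 x (c - U_(i) *+ d i)%MM).
have -> : phi h * mmap1 x b = \sum_c phi (adj b c) * \sum_e phi (elim c e) * mmap1 x e.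
  under [RHS]eq_bigr do rewrite mulr_sumr.
  rewrite exchange_big /= (bigD1 b) //= [X in _ = _ + X]big1; last first.
    move=> e eb; under eq_bigr do rewrite mulrA -rmorphM.
    by rewrite -mulr_suml -rmorph_sum fun_adj_mul eq_sym (negbTE eb) mulr0 rmorph0 mul0r.
  under [in RHS]eq_bigr do rewrite mulrA -rmorphM.
  by rewrite -mulr_suml -rmorph_sum fun_adj_mul eqxx mulr1 addr0.
rewrite (bigID (mem box)) /= addrC.
have -> : \sum_(a in box) phi (adj b a) * (\sum_e phi (elim a e) * mmap1 x e) =
    \sum_(a in box) phi (adj b a) * mmap1 x a.
  by apply: eq_bigr => a; rewrite inE elim_eval => /eqP ->.
rewrite addrK.
under [RHS]eq_bigr do rewrite mulr_suml.
rewrite (exchange_big_dep (fun c => c \notin box)) /=; last first.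
  by move=> i c _ /eqP e; rewrite inE e.
apply: eq_bigr => c; rewrite inE elim_eval; case E: (over_box c) => [i|] // _.
rewrite (big_pred1 i) ?mulrA // => j; rewrite -[RHS]/(j == i) eq_sym.
Qed.
End Eval.

(** A row of [elim] indexed by the box is a unit vector, so the product with the adjugate reads off
    the same row of [adj]. *)
Lemma adj_box (b c : I) : b \in box -> adj b c = h * (b == c)%:R.
Proof.
rewrite inE => /eqP bb; rewrite -fun_mul_adj (bigD1 b) //= big1.
  by rewrite addr0 /elim /row_base /row_pert bb mcoeffX eqxx mcoeff0 mulr0 addr0 mul1r.
move=> g gb; rewrite /elim /row_base /row_pert bb mcoeffX mcoeff0 mulr0 addr0.
by rewrite (inj_eq val_inj) eq_sym (negbTE gb) mul0r.
Qed.
End Elimination.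

(** * Deformation of a grid *)

Lemma det_eigenrows (F : fieldType) n (A R : 'M[F]_n) (lam : 'I_n -> F) :
  injective lam -> (forall j, row j R != 0) -> (forall j, row j R *m A = lam j *: row j R) ->
  \det R != 0.
Proof.
move=> li R0 hR; apply/det0P => -[s s0 hs]; case/eqP: s0; apply/rowP => j; rewrite mxE.
(* Each factor [mu] comes from multiplying the relation by [A - mu]; using all eigenvalues but the
   [j]-th isolates row [j]. *)
have key (l : seq F) : \sum_i (s 0 i * \prod_(mu <- l) (lam i - mu)) *: row i R = 0.
  elim: l => [|mu l IH].
    by rewrite -[RHS]hs mulmx_sum_row; apply: eq_bigr => i _; rewrite big_nil mulr1.
  have e : (\sum_i (s 0 i * \prod_(mu <- l) (lam i - mu)) *: row i R) *m (A - mu%:M) = 0.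
    by rewrite IH mul0mx.
  rewrite -[RHS]e mulmx_suml; apply: eq_bigr => i _; rewrite -scalemxAl mulmxBr hR mul_mx_scalar.
  by rewrite big_cons -scalerBl scalerA; congr (_ *: _); ring.
have := key [seq lam i | i <- enum 'I_n & i != j].
rewrite (bigD1 j) //= [X in _ + X]big1 ?addr0 => [|i ij]; last first.
  have hi : lam i \in [seq lam i | i <- enum 'I_n & i != j].
    by apply/mapP; exists i => //; rewrite mem_filter ij mem_enum.
  by rewrite (big_rem _ hi) /= subrr mul0r mulr0 scale0r.
move/eqP; rewrite scaler_eq0 (negbTE (R0 j)) orbF mulf_eq0 => /orP[/eqP //|].
rewrite prodf_seq_eq0 => /hasP[mu /mapP[i]]; rewrite mem_filter => /andP[ij _] -> /=.
by rewrite subr_eq0 (inj_eq li) eq_sym (negbTE ij).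
Qed.

Lemma mmap1_succ (R : comNzRingType) k (x : 'I_k -> R) (m : 'X_{1..k}) i :
  mmap1 x (m + U_(i))%MM = x i * mmap1 x m.
Proof.
rewrite /mmap1 [in RHS](bigD1 i) //= (bigD1 i) //= mnmDE mnm1E eqxx addn1 exprS mulrA.
congr (_ * _); apply: eq_bigr => j ji.
by rewrite mnmDE mnm1E eq_sym (negbTE ji) addn0.
Qed.

Lemma dvdp_mmap_sub (F : fieldType) (psi : {rmorphism F -> {poly F}}) k
    (x y : 'I_k -> {poly F}) p pi :
  (forall i, pi %| x i - y i) -> pi %| mmap psi x p - mmap psi y p.
Proof.
move=> h; rewrite /mmap -sumrB; apply: dvdp_sumr => m _; rewrite -mulrBr dvdp_mull //.
have hM a b a' b' : pi %| a - b -> pi %| a' - b' -> pi %| a * a' - b * b'.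
  move=> e e'; rewrite (_ : _ - _ = (a - b) * a' + b * (a' - b')); last by ring.
  by apply: dvdp_add; [exact: dvdp_mulr|exact: dvdp_mull].
rewrite /mmap1; elim/big_rec2: _ => [|i a b _ hab]; first by rewrite subrr dvdp0.
apply: (hM) => //; elim: (m i) => [|e IH]; first by rewrite !expr0 subrr dvdp0.
by rewrite !exprS; apply: hM.
Qed.

Lemma horner_taylor2 (R : comNzRingType) (p : {poly R}) x y :
  exists r, p.[x + y] = p.[x] + y * p^`().[x] + y ^+ 2 * r.
Proof.
elim/poly_ind: p => [|p c [r IH]]; first by exists 0; rewrite derivC !hornerC; ring.
exists (r * x + p^`().[x] + y * r).
rewrite derivD derivC addr0 derivM derivX mulr1 !hornerMXaddC hornerD hornerMX IH; ring.
Qed.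

Section Grid.
Variables (F : fieldType) (k : nat) (d : 'I_k -> nat) (a : 'I_k -> nat -> F).
Hypothesis a_inj : forall i c c', (c < d i)%N -> (c' < d i)%N -> a i c = a i c' -> c = c'.
Variable v : 'I_k -> {mpoly F[k]}.
Hypothesis v_size : forall i, (msize (v i) <= (d i).+1)%N.
(** Box monomials have degree at most [\sum_i d i]; the two extra degrees leave room for two
    multiplications by a variable, as needed to show that these multiplications commute. *)
Let N := (\sum_i d i).+2.
Notation I := 'X_{1..k < N.+1}.

Definition grid_poly i : {mpoly F[k]} := \prod_(c < d i) ('X_i - (a i c)%:MP).

Lemma grid_poly_lead i : (msize (grid_poly i - 'X_[U_(i) *+ d i])%R <= d i)%N.
Proof.
rewrite /grid_poly; elim: (d i) => [|n IH].
  by rewrite big_ord0 mulm0n mpolyX0 subrr msize0.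
rewrite big_ord_recr /=; set A := \prod_(_ < _) _ in IH *.
have -> : 'X_[U_(i) *+ n.+1] = 'X_i * 'X_[U_(i) *+ n] :> {mpoly F[k]} by rewrite mulmS mpolyXD.
rewrite (_ : _ - _ = 'X_i * (A - 'X_[U_(i) *+ n]) - a i n *: (A - 'X_[U_(i) *+ n] + 'X_[U_(i) *+ n])); last first.
  rewrite -mul_mpolyC; ring.
apply: leq_trans (mmeasureD_le _ _ _) _; rewrite geq_max mmeasureN; apply/andP; split.
  by apply: leq_trans (msize_mulX_leq _ _) _; rewrite mdeg1 add1n ltnS.
apply: leq_trans (msizeZ_le _ _) _; apply: leq_trans (mmeasureD_le _ _ _) _.
by rewrite geq_max (leq_trans IH) //= mmeasureX /= mdegMn mdeg1 mul1n.
Qed.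

Notation bx := (@box k N d).
Notation D := #|bx|.
Notation elimB := (@elim F k N d grid_poly v).
Notation h := (fun_det elimB).
Notation adj := (fun_adj elimB).
Notation sys := (sys_eval grid_poly v).

Lemma mmap_grid_poly (W : comNzRingType) (psi : {rmorphism F -> W}) x i :
  mmap psi x (grid_poly i) = \prod_(c < d i) (x i - psi (a i c)).
Proof.
rewrite rmorph_prod; apply: eq_bigr => c _ /=.
by rewrite mmapB mmapX mmap1U mmapC.
Qed.

(** Newton lifting, one coordinate at a time: [grid_poly i] involves only [x i], with a simple root
    at the grid point, and the perturbation [v] carries a factor [t], so correcting [x] at order
    [T.+1] changes it only at order [T.+2]. *)
Lemma grid_hensel (j : I) : j \in bx -> forall T, exists x : 'I_k -> {poly F},
  (forall i, (x i).[0] = a i (j i)) /\ forall i, 'X^T %| sys idfun x i.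
Proof.
move=> jb; have jd i := boxP i jb.
have p0 i : \prod_(c < d i) (a i (j i) - a i c) = 0.
  by rewrite (bigD1 (Ordinal (jd i))) //= subrr mul0r.
pose p i : {poly {poly F}} := \prod_(c < d i) ('X - (a i c)%:P%:P).
have pE x i : mmap (idfun \o polyC) x (grid_poly i) = (p i).[x i].
  rewrite (@mmap_grid_poly _ (idfun \o polyC)) horner_prod; apply: eq_bigr => c _.
  by rewrite hornerXsubC.
have dp i (y : {poly F}) : y.[0] = a i (j i) -> (p i)^`().[y].[0] != 0.
  move=> y0.
  have -> : (p i)^`().[y].[0] = (\prod_(c <- [seq a i (val c) | c : 'I_(d i)]) ('X - c%:P))^`().[a i (j i)].
    rewrite -y0 -[LHS]/(horner_eval 0 _) -horner_map -deriv_map; congr (_^`().[_]).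
    rewrite rmorph_prod big_image /=; apply: eq_bigr => c _.
    by rewrite rmorphB /= map_polyX map_polyC /= /horner_eval hornerC.
  apply: simple_root_prod; last by apply/imageP; exists (Ordinal (jd i)).
  by apply/injectiveP => c c' /(a_inj (ltn_ord c) (ltn_ord c'))/val_inj.
case=> [|T]; first by exists (fun i => (a i (j i))%:P); split=> i; rewrite ?hornerC // expr0 dvd1p.
elim: T => [|T [x [x0 hx]]].
  exists (fun i => (a i (j i))%:P); split=> i; first by rewrite hornerC.
  rewrite expr1 /sys_eval (@mmap_grid_poly _ (idfun \o polyC)) /=.
  rewrite (eq_bigr (fun c : 'I_(d i) => (a i (j i) - a i c)%:P)); last by move=> c _; rewrite polyCB.
  by rewrite -rmorph_prod /= p0 add0r dvdp_mulIl.
have /fin_all_exists[r hr] i : exists r, sys idfun x i = 'X^(T.+1) * r.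
  by have /dvdpP[r ->] := hx i; exists r; rewrite mulrC.
pose c i := - (r i).[0] / (p i)^`().[x i].[0].
pose y i := x i + 'X^(T.+1) * (c i)%:P.
exists y; split=> i; first by rewrite /y hornerD hornerM hornerXn expr0n /= mul0r addr0.
have [q hq] : exists q, mmap (idfun \o polyC) y (v i) = mmap (idfun \o polyC) x (v i) + 'X^(T.+1) * q.
  have /dvdpP[q hq] : 'X^(T.+1) %| mmap (idfun \o polyC) y (v i) - mmap (idfun \o polyC) x (v i).
    by apply: (@dvdp_mmap_sub F (idfun \o polyC)) => l; rewrite /y addrC addKr dvdp_mulIl.
  by exists q; rewrite mulrC -hq addrC subrK.
have [s hs] := horner_taylor2 (p i) (x i) ('X^(T.+1) * (c i)%:P).
have hr' : (p i).[x i] = 'X^(T.+1) * r i - 'X * mmap (idfun \o polyC) x (v i).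
  by rewrite -hr /sys_eval -pE addrK.
have hz : 'X %| r i + (c i)%:P * (p i)^`().[x i].
  rewrite -['X]subr0 dvdp_XsubCl /root hornerD hornerM hornerC /c mulfVK ?dp //.
  by rewrite subrr.
have /dvdpP[z ez] := hz.
rewrite /sys_eval pE hq hs hr' /=; apply/dvdpP; exists (z + 'X^T * (c i)%:P ^+ 2 * s + q).
have e1 : 'X^(T.+1) = 'X * 'X^T :> {poly F} by rewrite exprS.
have e2 : 'X^(T.+2) = 'X * ('X * 'X^T) :> {poly F} by rewrite !exprS.
transitivity ('X^(T.+1) * (r i + (c i)%:P * (p i)^`().[x i]) +
   ('X^(T.+1) * (c i)%:P) ^+ 2 * s + 'X * ('X^(T.+1) * q)).
  move: (mmap _ x (v i)) ('X^(T.+1) : {poly F}) ((p i)^`().[x i]) => m1 Y p1; ring.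
rewrite ez e2 e1; move: ('X^T : {poly F}) => Y; ring.
Qed.

(** The default [b] is returned only at the top degree [N], where [bsuccE] does not apply. *)
Definition bsucc (b : I) i : I := insubd b (b + U_(i))%MM.

Lemma bsuccE (b : I) i : (mdeg b < N)%N -> bmnm (bsucc b i) = (b + U_(i))%MM.
Proof. by move=> hb; rewrite /bsucc [LHS]insubdK // unfold_in mdegD mdeg1 addn1 ltnS. Qed.

Lemma mdeg_box (b : I) : b \in bx -> (mdeg b < N.-1)%N.
Proof.
move=> hb; rewrite /N /= ltnS mdegE; apply: leq_sum => i _.
exact: ltnW (boxP i hb).
Qed.

Lemma mdeg_box_ltn (b : I) : b \in bx -> (mdeg b < N)%N.
Proof. by move/mdeg_box => hb; apply: leq_trans hb (leq_pred _). Qed.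

Definition bj (j : 'I_D) : I := enum_val j.

Lemma bj_box j : bj j \in bx.
Proof. exact: enum_valP. Qed.

Lemma sum_box (W : nmodType) (E : I -> W) : \sum_(b in bx) E b = \sum_(j < D) E (bj j).
Proof. exact: big_enum_val. Qed.

(** Multiplication by [h * X_i] in the box monomials modulo the system; the factor [h] avoids
    denominators. Products are expanded in columns, so the box monomials at a zero form a left
    eigenvector. *)
Definition mul_mx i : 'M[{poly F}]_D := \matrix_(c, j) adj (bsucc (bj j) i) (bj c).
Definition form_mx (u : 'I_k -> F) : 'M[{poly F}]_D :=
  \matrix_(c, j) \sum_i u i *: adj (bsucc (bj j) i) (bj c).
Definition erow (W : comNzRingType) (x : 'I_k -> W) : 'rV[W]_D := \row_j mmap1 x (bj j).

Section ZeroAt.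
Variables (t : F) (x : 'I_k -> F).
Hypothesis hx : forall i, sys (horner_eval t) x i = 0.

Lemma zero_relation (b : I) :
  h.[t] * mmap1 x b = \sum_j (adj b (bj j)).[t] * mmap1 x (bj j).
Proof.
have [g hg] := elim_relation grid_poly_lead v_size (horner_eval t) x b.
apply/eqP; rewrite -subr_eq0 -(sum_box (fun a => (adj b a).[t] * mmap1 x a)).
apply/eqP; apply: etrans hg _; apply: big1 => i _; by rewrite hx mulr0.
Qed.

Lemma zero_mul i : erow x *m map_mx (horner_eval t) (mul_mx i) = (h.[t] * x i) *: erow x.
Proof.
apply/rowP => j; rewrite mxE [RHS]mxE [erow x 0 j]mxE -mulrA -mmap1_succ.
rewrite -bsuccE; last exact: mdeg_box_ltn (bj_box j).
rewrite zero_relation; apply: eq_bigr => c _.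
by rewrite !mxE mulrC.
Qed.

Lemma zero_form u : erow x *m map_mx (horner_eval t) (form_mx u) = (h.[t] * \sum_i u i * x i) *: erow x.
Proof.
have -> : map_mx (horner_eval t) (form_mx u) = \sum_i u i *: map_mx (horner_eval t) (mul_mx i).
  apply/matrixP => c j; rewrite !mxE summxE rmorph_sum; apply: eq_bigr => i _.
  by rewrite !mxE /= /horner_eval hornerZ.
rewrite mulmx_sumr mulr_sumr scaler_suml; apply: eq_bigr => i _.
by rewrite -scalemxAr zero_mul scalerA mulrCA.
Qed.
End ZeroAt.

Definition grid_pt (j : 'I_D) (i : 'I_k) : F := a i (bj j i).
Variable u : 'I_k -> F.
Hypothesis u_sep : injective (fun j => \sum_i u i * grid_pt j i).

Lemma grid_zero j i : sys (horner_eval 0) (grid_pt j) i = 0.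
Proof.
rewrite /sys_eval [X in _ + X](_ : _ = 0) ?addr0; last by rewrite /= /horner_eval hornerX mul0r.
rewrite (@mmap_grid_poly _ (horner_eval 0 \o polyC)).
rewrite (bigD1 (Ordinal (boxP i (bj_box j)))) //= /horner_eval hornerC /grid_pt subrr mul0r //.
Qed.

(** At [t = 0] the rows are eigenvectors of [form_mx u], with eigenvalues distinct by [u_sep]; they
    are nonzero because the monomial [1] lies in the box. *)
Lemma grid_det : \det (\matrix_j erow (grid_pt j)) != 0.
Proof.
have h0 := elim_det0 N v grid_poly_lead : h.[0] != 0.
apply: (@det_eigenrows _ _ (map_mx (horner_eval 0) (form_mx u)) _ (fun j => h.[0] * \sum_i u i * grid_pt j i)).
- by move=> j j' /(mulfI h0)/u_sep.
- move=> j; rewrite rowK; apply/eqP => /rowP hz.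
  have c0 : (0%MM : 'X_{1..k}) \in [pred m : 'X_{1..k} | (mdeg m < N.+1)%N] by rewrite inE mdeg0.
  have b0 : (Sub 0%MM c0 : I) \in bx.
    rewrite inE /over_box; case: pickP => // i; rewrite SubK mnm0E leqn0 => /eqP di.
    by have := boxP i (bj_box j); rewrite di.
  have := hz (enum_rank_in b0 (Sub 0%MM c0)).
  by rewrite !mxE /bj enum_rankK_in // SubK mmap11 => /eqP; rewrite oner_eq0.
- move=> j; rewrite rowK; exact: (zero_form (grid_zero j) u).
Qed.

(* The two sides agree modulo [t ^ T] for every [T], because they do so after multiplication by the
   matrix of the box monomials at the [D] Hensel lifts of the grid points. *)
Lemma adj_succ (b : I) i c : (mdeg b < N)%N ->
  h * adj (bsucc b i) (bj c) = \sum_j adj b (bj j) * mul_mx i c j.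
Proof.
move=> hb; pose r c := h * adj (bsucc b i) (bj c) - \sum_j adj b (bj j) * mul_mx i c j.
suff hr : forall T, 'X^T %| r c.
  apply/eqP; rewrite -subr_eq0 -/(r c); apply: contraT => nz.
  by have := dvdp_leq nz (hr (size (r c))); rewrite size_polyXn ltnn.
move=> T.
have /fin_all_exists[x hx] j := grid_hensel (bj_box j) T.
have rel j (b' : I) : 'X^T %| h * mmap1 (x j) b' - \sum_l adj b' (bj l) * mmap1 (x j) (bj l).
  have [g hg] := elim_relation grid_poly_lead v_size idfun (x j) b'.
  rewrite -(sum_box (fun a => adj b' a * mmap1 (x j) a)).
  have -> : h * mmap1 (x j) b' - \sum_(a in bx) adj b' a * mmap1 (x j) a = \sum_i g i * sys idfun (x j) i by exact: hg.
  by apply: dvdp_sumr => l _; rewrite dvdp_mull // (hx j).2.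
pose V : 'M[{poly F}]_D := \matrix_(j, l) mmap1 (x j) (bj l).
have hV j : 'X^T %| \sum_l V j l * r l.
  (* Three relations at the lifted zero are combined: those for [X_i X ^ b], for [X ^ b], and for
     [X_i] times each box monomial. Each is divisible by ['X^T]. *)
  have -> : \sum_l V j l * r l =
     - (h * (h * mmap1 (x j) (bsucc b i) - \sum_l adj (bsucc b i) (bj l) * mmap1 (x j) (bj l)))
     + x j i * h * (h * mmap1 (x j) b - \sum_l adj b (bj l) * mmap1 (x j) (bj l))
     + \sum_l adj b (bj l) * (h * mmap1 (x j) (bsucc (bj l) i) -
          \sum_e adj (bsucc (bj l) i) (bj e) * mmap1 (x j) (bj e)).
    have hb2 l : (mdeg (bj l) < N)%N by exact: mdeg_box_ltn (bj_box l).
    have -> : \sum_l adj b (bj l) * (h * mmap1 (x j) (bsucc (bj l) i) -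
          \sum_e adj (bsucc (bj l) i) (bj e) * mmap1 (x j) (bj e)) =
       x j i * h * (\sum_l adj b (bj l) * mmap1 (x j) (bj l)) -
       \sum_e mmap1 (x j) (bj e) * \sum_l adj b (bj l) * adj (bsucc (bj l) i) (bj e).
      rewrite mulr_sumr; under eq_bigr do rewrite mulrBr.
      rewrite sumrB; congr (_ - _).
        by apply: eq_bigr => l _; rewrite bsuccE // mmap1_succ; ring.
      under eq_bigr do rewrite mulr_sumr.
      rewrite exchange_big /=; apply: eq_bigr => e _; rewrite mulr_sumr.
      by apply: eq_bigr => l _; ring.
    have -> : \sum_l V j l * r l = h * (\sum_l adj (bsucc b i) (bj l) * mmap1 (x j) (bj l)) -
       \sum_e mmap1 (x j) (bj e) * \sum_l adj b (bj l) * adj (bsucc (bj l) i) (bj e).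
      rewrite mulr_sumr -sumrB; apply: eq_bigr => l _; rewrite mxE /r mulrBr; congr (_ - _).
        by ring.
      by congr (_ * _); apply: eq_bigr => e _; rewrite mxE.
    rewrite bsuccE // mmap1_succ; ring.
  apply: dvdp_add; last by apply: dvdp_sumr => l _; apply: dvdp_mull; apply: rel.
  by apply: dvdp_add; rewrite ?dvdpNr; apply: dvdp_mull; apply: rel.
(* Cramer's rule; [\det V] is prime to ['X], its value at [0] being the determinant of
   [grid_det]. *)
have detV : \det V * r c = \sum_j (\adj V) c j * \sum_l V j l * r l.
  have /matrixP/(_ c 0) := congr1 (mulmx^~ (\col_l r l)) (mul_adj_mx V).
  rewrite -mulmxA mxE mul_scalar_mx !mxE => <-; apply: eq_bigr => j _.
  by rewrite [(V *m _) _ _]mxE; congr (_ * _); apply: eq_bigr => l _; rewrite [(\col_l r l) _ _]mxE.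
have d0 : (\det V).[0] != 0.
  have := grid_det; rewrite -[(\det V).[0]]/(horner_eval 0 (\det V)) -det_map_mx.
  congr (\det _ != 0); apply/matrixP => j l; rewrite !mxE rmorph_prod.
  apply: eq_bigr => e _; rewrite rmorphXn; congr (_ ^+ _).
  by rewrite /= /horner_eval (hx j).1.
have cop : coprimep 'X^T (\det V).
  by apply: coprimep_expl; rewrite coprimep_sym -['X]subr0 coprimep_XsubC.
rewrite -(Gauss_dvdpr _ cop) detV; apply: dvdp_sumr => j _; exact: dvdp_mull.
Qed.

(** By [adj_succ], either order of multiplication is [h] times the reduction of the same monomial
    [X_i X_l X ^ b]. *)
Lemma mul_mxC i l : mul_mx l *m mul_mx i = mul_mx i *m mul_mx l.
Proof.
have hb c : (mdeg (bj c) < N)%N := mdeg_box_ltn (bj_box c).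
have hs c e : (mdeg (bsucc (bj c) e) < N)%N.
  rewrite bsuccE //; first by rewrite mdegD mdeg1 addn1; exact: (mdeg_box (bj_box c)).
have key e e' c c' : (mul_mx e *m mul_mx e') c c' = h * adj (bsucc (bsucc (bj c') e') e) (bj c).
  rewrite mxE adj_succ //; apply: eq_bigr => j _.
  by rewrite [mul_mx e' _ _]mxE mulrC.
apply/matrixP => c c'; rewrite !key; congr (_ * adj _ _); apply: val_inj => /=.
rewrite (bsuccE _ (hs _ _)) bsuccE // (bsuccE _ (hs _ _)) bsuccE //.
by rewrite -!addmA [(U_(i) + _)%MM]addmC.
Qed.

Section Specialization.
Variables (t : F) (eta : 'I_D -> F).
Hypothesis d_gt0 : forall i, (0 < d i)%N.
Hypothesis ht : h.[t] != 0.
Hypothesis eta_inj : injective eta.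
Let A := map_mx (horner_eval t) (form_mx u).
Let M i := map_mx (horner_eval t) (mul_mx i).
Hypothesis hA : char_poly A = \prod_j ('X - (eta j)%:P).

Lemma form_mxE : A = \sum_i u i *: M i.
Proof.
apply/matrixP => c j; rewrite !mxE summxE rmorph_sum; apply: eq_bigr => i _.
by rewrite !mxE /= /horner_eval hornerZ.
Qed.

Lemma eigen_eta lam (x : 'rV_D) : x != 0 -> x *m A = lam *: x -> exists j, lam = eta j.
Proof.
move=> x0 hx; have : eigenvalue A lam by apply/eigenvalueP; exists x.
rewrite eigenvalue_root_char hA /root horner_prod => /prodf_eq0[j _].
by rewrite hornerXsubC subr_eq0 => /eqP ->; exists j.
Qed.

Lemma eigenvector j : exists2 w : 'rV_D, w != 0 & w *m A = eta j *: w.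
Proof.
have /eigenvalueP[w hw w0] : eigenvalue A (eta j); last by exists w.
rewrite eigenvalue_root_char hA /root horner_prod; apply/prodf_eq0; exists j => //.
by rewrite hornerXsubC subrr.
Qed.

(** There are [D] distinct eigenvalues in dimension [D], so the eigenvectors form a basis and every
    eigenspace is a line. *)
Lemma eigen_line lam (x y : 'rV_D) : x != 0 -> x *m A = lam *: x -> y *m A = lam *: y ->
  exists c, y = c *: x.
Proof.
move=> x0 hx hy; have [j0 hj0] := eigen_eta x0 hx.
have /fin_all_exists[w hw] j : exists w : 'rV_D, w != 0 /\ w *m A = eta j *: w.
  by have [w] := eigenvector j; exists w.
have dR : \det (\matrix_j w j) != 0.
  apply: (@det_eigenrows _ _ A _ eta) => // j; rewrite rowK; first exact: (hw j).1.
  exact: (hw j).2.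
have uR : \matrix_j w j \in unitmx by rewrite unitmxE unitfE.
have key (z : 'rV_D) : z *m A = lam *: z -> exists s, z = s *: w j0.
  move=> hz; pose s := z *m invmx (\matrix_j w j).
  have zs : z = \sum_j s 0 j *: w j.
    rewrite -[LHS](mulmxKV uR) -/s mulmx_sum_row; apply: eq_bigr => j _; by rewrite rowK.
  have hs0 : (\row_j (s 0 j * (eta j - lam))) *m \matrix_j w j = 0.
    rewrite mulmx_sum_row -[RHS](subrr (z *m A)) {2}hz {1}zs mulmx_suml zs scaler_sumr -sumrB.
    apply: eq_bigr => j _; rewrite mxE rowK -scalemxAl (hw j).2 !scalerA -scalerBl.
    by congr (_ *: _); ring.
  have s0 : \row_j (s 0 j * (eta j - lam)) = 0 by rewrite -[LHS](mulmxK uR) hs0 mul0mx.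
  exists (s 0 j0); rewrite [LHS]zs (bigD1 j0) //= big1 ?addr0 // => j jj0.
  have /rowP/(_ j) := s0; rewrite !mxE => /eqP; rewrite mulf_eq0 subr_eq0 hj0.
  by rewrite (inj_eq eta_inj) (negbTE jj0) orbF => /eqP ->; rewrite scale0r.
have [r hr] := key x hx; have [s hs] := key y hy.
have r0 : r != 0 by apply: contraNneq x0 => e; rewrite hr e scale0r.
by exists (s / r); rewrite hs hr scalerA divfK.
Qed.

Lemma zero_in_I : exists b0 : I, bmnm b0 = 0%MM /\ b0 \in bx.
Proof.
have c0 : (0%MM : 'X_{1..k}) \in [pred m : 'X_{1..k} | (mdeg m < N.+1)%N] by rewrite inE mdeg0.
exists (Sub 0%MM c0); rewrite SubK; split=> //.
rewrite inE /over_box; case: pickP => // i; rewrite SubK mnm0E leqNgt d_gt0 //.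
Qed.

Lemma zero_index : exists l0, bmnm (bj l0) = 0%MM.
Proof.
have [b0 [e0 bb0]] := zero_in_I.
by exists (enum_rank_in bb0 b0); rewrite /bj enum_rankK_in.
Qed.

(* The multiplication matrices commute, hence preserve the simple eigenlines of the linear form;
   an eigenvector is then the vector of the box monomials at a common zero. *)
Lemma zero_of_eigen j : exists x : 'I_k -> F,
  (forall i, sys (horner_eval t) x i = 0) /\ h.[t] * (\sum_i u i * x i) = eta j.
Proof.
have [w w0 hw] := eigenvector j.
have comm i : M i *m A = A *m M i.
  rewrite form_mxE mulmx_sumr mulmx_suml; apply: eq_bigr => l _.
  by rewrite -scalemxAr -scalemxAl -!map_mxM mul_mxC.
have /fin_all_exists[mu hmu] i : exists c, w *m M i = c *: w.
  by apply: (eigen_line w0 hw); rewrite -mulmxA comm mulmxA hw scalemxAl.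
pose x i := mu i / h.[t].
have mux i : mu i = h.[t] * x i by rewrite /x mulrC divfK.
have [l0 hl0] := zero_index.
(* Induction on the degree: [adj_succ] moves one variable from the monomial to [M i], which acts on
   [w] as [mu i = h.[t] * x i]. *)
have key n : forall b : I, mdeg b = n ->
    \sum_l (adj b (bj l)).[t] * w 0 l = h.[t] * w 0 l0 * mmap1 x b.
  elim: n => [|n IH] b hb.
    have b0 : b = bj l0 by apply: val_inj; rewrite /= hl0; apply/eqP; rewrite -mdeg_eq0 hb.
    rewrite (bigD1 l0) //= big1 => [|l ll0]; rewrite b0 adj_box ?bj_box //.
      by rewrite eqxx mulr1 addr0 hl0 mmap11 mulr1.
    rewrite (inj_eq enum_val_inj) eq_sym (negbTE ll0) mulr0 horner0 mul0r //.
  have [i bi] : exists i, b i != 0%N.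
    apply/existsP; rewrite -negb_forall; apply/negP => /forallP hz.
    have : mdeg b = 0%N by rewrite mdegE big1 // => i _; exact/eqP.
    by rewrite hb.
  have le : (U_(i) <= b)%MM by rewrite lep1mP.
  have db : mdeg (b - U_(i))%MM = n.
    by apply: succn_inj; rewrite -hb -{2}(submK le) mdegD mdeg1 addn1.
  have bN : (mdeg b < N.+1)%N := valP b.
  have c0 : (b - U_(i))%MM \in [pred m : 'X_{1..k} | (mdeg m < N.+1)%N].
    by rewrite inE db; apply: ltn_trans bN; rewrite hb.
  pose b' : I := Sub (b - U_(i))%MM c0.
  have b'E : bmnm b' = (b - U_(i))%MM by [].
  have db' : (mdeg b' < N)%N by rewrite b'E db -ltnS -hb.
  have eb : b = bsucc b' i by apply: val_inj; rewrite /= bsuccE // b'E submK.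
  apply: (mulfI ht).
  transitivity (\sum_c (h * adj b (bj c)).[t] * w 0 c).
    by rewrite mulr_sumr; apply: eq_bigr => c _; rewrite hornerM mulrA.
  rewrite {1}eb.
  under eq_bigr do rewrite adj_succ // horner_sum mulr_suml.
  rewrite exchange_big /=.
  transitivity (\sum_l (adj b' (bj l)).[t] * (w *m M i) 0 l).
    apply: eq_bigr => l _; rewrite mxE mulr_sumr; apply: eq_bigr => c _.
    rewrite hornerM [M i c l]mxE -[horner_eval t _]/(_.[t]).
    by rewrite -mulrA [X in _ * X]mulrC.
  under eq_bigr do rewrite hmu mxE mulrCA.
  rewrite -mulr_sumr (IH b' (etrans (congr1 mdeg b'E) db)) eb bsuccE // mmap1_succ mux.
  ring.
have w00 : w 0 l0 != 0.
  apply: contraNneq w0 => z; apply/eqP/rowP => l; rewrite mxE; apply: (mulfI ht).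
  have := key _ (bj l) erefl; rewrite z !(mulr0, mul0r) (bigD1 l) //= big1 => [|l' ll'].
    by rewrite adj_box ?bj_box // eqxx mulr1 addr0.
  by rewrite adj_box ?bj_box // (inj_eq enum_val_inj) eq_sym (negbTE ll') mulr0 horner0 mul0r.
exists x; split; last first.
  have e : (h.[t] * \sum_i u i * x i) *: w = eta j *: w.
    rewrite -hw form_mxE mulmx_sumr mulr_sumr scaler_suml; apply: eq_bigr => i _.
    by rewrite -scalemxAr hmu scalerA mux mulrCA.
  have := congr1 (fun z : 'rV_D => z 0 l0) e; rewrite mxE [X in _ = X]mxE => e'.
  exact: (mulIf w00 e').
move=> i.
have dN : (d i <= \sum_l d l)%N by rewrite (bigD1 i) //= leq_addr.
have c0 : (U_(i) *+ d i)%MM \in [pred m : 'X_{1..k} | (mdeg m < N.+1)%N].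
  by rewrite inE mdegMn mdeg1 mul1n; apply: (leq_ltn_trans dN); rewrite ltnS ltnW // ltnW.
pose g : I := Sub (U_(i) *+ d i)%MM c0.
have gE : bmnm g = (U_(i) *+ d i)%MM by [].
(* The row of [X_i ^ d i] is the [i]-th equation itself, with cofactor [1]; positivity of [d]
   prevents the choice of another index. As [g] is outside the box, this row of [elim] times the box
   columns of [adj] is zero, which is the equation at [x]. *)
have og : over_box d g = Some i.
  rewrite /over_box; case: pickP => [l|/(_ i)]; rewrite gE mulmnE mnm1E.
    by case: eqP => [->|_] //; rewrite mul0n leqNgt d_gt0.
  by rewrite eqxx mul1n leqnn.
have gb l : (g == bj l) = false.
  by apply/eqP => e; have := bj_box l; rewrite -e inE og.
have e1 : \sum_e (elimB g e).[t] * (\sum_l (adj e (bj l)).[t] * w 0 l) = 0.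
  under eq_bigr do rewrite mulr_sumr.
  rewrite exchange_big big1 //= => l _.
  transitivity ((\sum_e elimB g e * adj e (bj l)).[t] * w 0 l).
    by rewrite horner_sum mulr_suml; apply: eq_bigr => e _; rewrite hornerM mulrA.
  by rewrite fun_mul_adj gb mulr0 horner0 mul0r.
have e2 : h.[t] * w 0 l0 * \sum_e (elimB g e).[t] * mmap1 x e = 0.
  rewrite -[RHS]e1 mulr_sumr; apply: eq_bigr => e _; rewrite (key _ e erefl); ring.
move/eqP: e2; rewrite mulf_eq0 mulf_eq0 (negbTE ht) (negbTE w00) /= => /eqP e2.
have := elim_eval grid_poly_lead v_size (horner_eval t) x g; rewrite og.
rewrite [X in X = _](e2 : _ = 0) gE => /esym.
have -> : (U_(i) *+ d i - U_(i) *+ d i)%MM = 0%MM by apply/mnmP => l; rewrite mnmBE subnn mnm0E.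
by rewrite mmap11 mul1r.
Qed.

(** Both rows of box monomials lie on one eigenline and have entry [1] at the monomial [1], so they
    agree. The coordinates are then compared as eigenvalues of [mul_mx i], since [X_i] itself is
    outside the box when [d i = 1]. *)
Lemma zeros_separated x y :
  (forall i, sys (horner_eval t) x i = 0) -> (forall i, sys (horner_eval t) y i = 0) ->
  \sum_i u i * x i = \sum_i u i * y i -> forall i, x i = y i.
Proof.
move=> hx hy e i; have [l0 hl0] := zero_index.
have e1 z : erow z 0 l0 = 1 by rewrite mxE hl0 mmap11.
have x0 : erow x != 0.
  by apply/eqP => /rowP/(_ l0); rewrite e1 mxE; apply/eqP; rewrite oner_neq0.
have [|c exy] := eigen_line x0 (zero_form hx u) (y := erow y).
  by rewrite [LHS](zero_form hy u) e.
have c1 : c = 1.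
  by have := congr1 (fun z : 'rV_D => z 0 l0) exy; rewrite e1 mxE e1 mulr1.
have := zero_mul hy i; rewrite exy c1 scale1r (zero_mul hx) => exy'.
have := congr1 (fun z : 'rV_D => z 0 l0) exy'.
by rewrite mxE [X in _ = X]mxE e1 !mulr1 => /(mulfI ht).
Qed.
End Specialization.

Definition grid_charpoly : {poly {poly F}} := char_poly (form_mx u).

Lemma size_grid_charpoly_coef (l : nat) : (size (grid_charpoly`_l)%R <= (D * #|{: I}|).+1)%N.
Proof.
have hA i j : (size (form_mx u i j) <= #|{: I}|.+1)%N.
  rewrite mxE; apply: leq_trans (size_sum _ _ _) _; apply/bigmax_leqP => e _.
  apply: leq_trans (size_scale_leq _ _) _.
  rewrite -[#|_|]muln1; apply: size_fun_adj => b c; exact: size_elim.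
(* With [kap = 0] the weight is the degree in [t] alone. *)
apply: (wt2_size (kap := 0)).
rewrite /grid_charpoly /char_poly /determinant; apply: wt2_sum => s _.
have hP : wt2 0 (D * #|{: I}|) (\prod_i char_poly_mx (form_mx u) i (s i)).
  rewrite -[X in (X * _)%N]card_ord -sum_nat_const.
  elim/big_rec2: _ => [|i p n _ IH]; first exact: wt2_1.
  apply: wt2M IH; rewrite /char_poly_mx 4!mxE.
  apply: wt2D; last by apply: wt2N; apply: wt2C.
  case: (i == s i); last exact: wt2_0.
  by rewrite mulr1n; apply: (wt2_le (n := 0)) => //; apply: wt2_Y.
by rewrite -signr_odd; case: (odd _); rewrite ?expr0 ?expr1 ?mul1r ?mulN1r //; apply: wt2N.
Qed.

Definition grid_eta (j : 'I_D) : F := h.[0] * \sum_i u i * grid_pt j i.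

Lemma grid_eta_inj : injective grid_eta.
Proof. by move=> j j' /(mulfI (elim_det0 N v grid_poly_lead))/u_sep. Qed.

Lemma map_grid_charpoly t :
  map_poly (ev1 idfun t) grid_charpoly = char_poly (map_mx (horner_eval t) (form_mx u)).
Proof.
rewrite -map_char_poly; apply: eq_map_poly => p.
by rewrite ev1E map_poly_id.
Qed.

Lemma grid_charpoly0 : map_poly (ev1 idfun 0) grid_charpoly = \prod_j ('X - (grid_eta j)%:P).
Proof.
rewrite map_grid_charpoly; set p := char_poly _.
have := @all_roots_prod_XsubC _ p [seq grid_eta j | j <- enum 'I_D].
rewrite size_map size_enum_ord size_char_poly (eqP (char_poly_monic _)) scale1r big_map big_enum /=.
apply=> //; last by rewrite uniq_rootsE map_inj_uniq ?enum_uniq //; exact: grid_eta_inj.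
apply/allP => _ /mapP[j _ ->]; rewrite -eigenvalue_root_char; apply/eigenvalueP.
exists (erow (grid_pt j)); first exact: (zero_form (grid_zero j) u).
have [l0 hl0] : exists l0, bmnm (bj l0) = 0%MM.
  apply: zero_index => i; exact: leq_ltn_trans (leq0n _) (boxP i (bj_box j)).
by apply/eqP => /rowP/(_ l0); rewrite !mxE hl0 mmap11; apply/eqP; rewrite oner_neq0.
Qed.
End Grid.

(** * Counting zeros on a line through the grid system *)

Section GridCount.
Variables (F : finFieldType) (k : nat) (d : 'I_k -> nat) (a : 'I_k -> nat -> F).
Hypothesis a_inj : forall i c c', (c < d i)%N -> (c' < d i)%N -> a i c = a i c' -> c = c'.
Hypothesis d_gt0 : forall i, (0 < d i)%N.
Variable v : 'I_k -> {mpoly F[k]}.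
Hypothesis v_size : forall i, (msize (v i) <= (d i).+1)%N.
Variable u : 'I_k -> F.
Hypothesis u_sep : injective (fun j => \sum_i u i * @grid_pt F k d a j i).
Let N := (\sum_i d i).+2.
Notation D := #|@box k N d|.
Notation elimB := (@elim F k N d (grid_poly d a) v).

(** [phi] sends a zero to its eigenvalue: [zeros_separated] makes it injective, [eigen_eta] and
    [zero_of_eigen] identify its image with the set of all [eta j]. *)
Lemma card_grid_zeros t : (fun_det elimB).[t] != 0 ->
  t \in split_points D (grid_charpoly d a v u) ->
  #|[set x : {ffun 'I_k -> F} | [forall i, sys_eval (grid_poly d a) v (horner_eval t) x i == 0]]| = D.
Proof.
move=> ht; rewrite inE => /existsP[eta /andP[/injectiveP eta_inj /eqP]].
rewrite map_grid_charpoly => hA.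
set Z := [set x | _].
have ZP (x : {ffun 'I_k -> F}) : x \in Z -> forall i, sys_eval (grid_poly d a) v (horner_eval t) x i = 0.
  by rewrite inE => /forallP h i; apply/eqP.
pose phi (x : {ffun 'I_k -> F}) := (fun_det elimB).[t] * \sum_i u i * x i.
have phi_inj : {in Z &, injective phi}.
  move=> x y /ZP hx /ZP hy /(mulfI ht) e; apply/ffunP.
  exact: (zeros_separated v_size d_gt0 ht eta_inj hA hx hy e).
rewrite -(card_in_imset phi_inj).
have -> : phi @: Z = eta @: [set: 'I_D].
  apply/setP => c; apply/imsetP/imsetP => [[x /ZP hx ->]|[j _ ->]].
    have [l0 hl0] := zero_index d_gt0.
    have [||j ej] := eigen_eta hA (x := @erow k d _ x) (lam := phi x).
    - by apply/eqP => /rowP/(_ l0); rewrite !mxE hl0 mmap11; apply/eqP; rewrite oner_neq0.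
    - exact: (zero_form v_size hx u).
    by exists j.
  have [x [hx ex]] := zero_of_eigen a_inj v_size u_sep d_gt0 ht eta_inj hA j.
  exists [ffun i => x i]; last by rewrite /phi -ex; congr (_ * _); apply: eq_bigr => i _; rewrite ffunE.
  rewrite inE; apply/forallP => i; apply/eqP; rewrite -[RHS](hx i).
  by rewrite /sys_eval; congr (_ + _ * _); apply: eq_bigr => m _; congr (_ * _); apply: mmap1_eq => l; rewrite ffunE.
by rewrite card_imset // cardsT card_ord.
Qed.
End GridCount.

Lemma mem_box k N d (b : 'X_{1..k < N.+1}) : (b \in box N d) = [forall i, b i < d i]%N.
Proof.
apply/idP/forallP => [bb i|h]; first exact: boxP.
rewrite inE /over_box; case: pickP => // i.
by rewrite leqNgt h.
Qed.

(** The cutoff [N] truncates nothing, so the box is a full product of intervals. *)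
Lemma card_box k N (d : 'I_k -> nat) : (\sum_i d i <= N)%N -> #|box N d| = (\prod_i d i)%N.
Proof.
move=> dN.
have dle i : (d i <= N)%N by apply: leq_trans dN; rewrite (bigD1 i) //= leq_addr.
pose f (b : 'X_{1..k < N.+1}) : {ffun 'I_k -> 'I_N.+1} := [ffun i => inord (b i)].
have f_inj : {in box N d &, injective f}.
  move=> b b'; rewrite !mem_box => /forallP hb /forallP hb' /ffunP e.
  apply: val_inj; apply/mnmP => i; have := e i; rewrite !ffunE => /(congr1 val).
  by rewrite /= !inordK // ltnW // ltnS; apply: leq_trans (dle i); [apply: hb'|apply: hb].
rewrite -(card_in_imset f_inj).
transitivity #|family (fun i => [pred c : 'I_N.+1 | c < d i]%N)|.
  apply: eq_card => g; apply/imsetP/familyP => [[b bb ->] i|hg].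
    rewrite mem_box in bb; rewrite ffunE inE inordK; first exact: (forallP bb).
    by rewrite ltnS ltnW // (leq_trans _ (dle i)) //; apply: (forallP bb).
  have hd : (mdeg [multinom (g i : nat) | i < k] < N.+1)%N.
    rewrite mdegE ltnS; apply: leq_trans dN; apply: leq_sum => i _.
    by rewrite mnmE ltnW //; exact: (hg i).
  have c0 : [multinom (g i : nat) | i < k] \in [pred m : 'X_{1..k} | (mdeg m < N.+1)%N] by [].
  exists (Sub [multinom (g i : nat) | i < k] c0).
    by rewrite mem_box; apply/forallP => i; rewrite /= mnmE; exact: (hg i).
  by apply/ffunP => i; rewrite ffunE /= mnmE inord_val.
rewrite card_family foldrE big_map big_enum /=; apply: eq_bigr => i _.
rewrite -sum1_card -(big_ord_widen _ (fun=> 1%N) (leqW (dle i))).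
by rewrite sum1_card card_ord.
Qed.

Lemma msize_grid_poly (F : fieldType) k d (a : 'I_k -> nat -> F) i : (msize (grid_poly d a i) <= (d i).+1)%N.
Proof.
rewrite -(subrK 'X_[U_(i) *+ d i] (grid_poly d a i)); apply: leq_trans (mmeasureD_le _ _ _) _.
by rewrite geq_max (leqW (grid_poly_lead _ _ _)) mmeasureX /= mdegMn mdeg1 mul1n.
Qed.

Lemma sys_evalE (F : fieldType) k (fs v : 'I_k -> {mpoly F[k]}) t x i :
  sys_eval fs v (horner_eval t) x i = (fs i + t *: v i).@[x].
Proof.
rewrite mevalD mevalZ /sys_eval /meval; congr (_ + _ * _).
- by apply: eq_bigr => m _; rewrite /= /horner_eval hornerC.
- by rewrite /= /horner_eval hornerX.
- by apply: eq_bigr => m _; rewrite /= /horner_eval hornerC.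
Qed.

Lemma card_roots_leq (F : finFieldType) (p : {poly F}) n : p != 0 -> (size p <= n.+1)%N ->
  (#|[set t | p.[t] == 0%R]| <= n)%N.
Proof.
move=> p0 sp; rewrite -ltnS; apply: leq_trans sp; rewrite cardE; apply: max_poly_roots => //.
  by apply/allP => t; rewrite mem_enum inE.
exact: enum_uniq.
Qed.

Lemma line_lower_bound k (d : 'I_k -> nat) (D := (\prod_i d i)%N) : (forall i, 0 < d i)%N ->
  exists c : nat, forall (F : finFieldType) s, (s * s <= #|F|)%N -> (#|F| < s.+1 * s.+1)%N ->
  exists fs : 'I_k -> {mpoly F[k]}, (forall i, msize (fs i) <= (d i).+1)%N /\
  forall v : 'I_k -> {mpoly F[k]}, (forall i, msize (v i) <= (d i).+1)%N ->
  (#|F| <= D`! * #|[set t : F | #|[set x : {ffun 'I_k -> F} | [forall i, (fs i + t *: v i)%R.@[x] == 0%R]]| == D]|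
     + c * s)%N.
Proof.
move=> d0; pose N := (\sum_i d i).+2; pose I := 'X_{1..k < N.+1}.
pose D' := #|box N d|.
have DE : D' = D by rewrite /D' card_box //; apply: leqW.
have [c hc] := splitting_lower_bound D' (D' * #|{: I}|).
(* Beyond [B] the field has enough elements for [d i] distinct nodes in each coordinate and for a
   form separating the grid points. Up to [B] the bound is trivial thanks to the last summand of the
   constant; the middle one pays for the roots of [h]. *)
pose B := (\sum_i d i + #|{: 'I_D' * 'I_D'}| * k)%N.
exists (c + D'`! * #|{: I}| + B)%N => F s hs1 hs2.
have s1 : (0 < s)%N by case: s hs1 hs2 => // _; rewrite mul1n ltnNge (ltnW (finNzRing_gt1 F)).
pose a (i : 'I_k) c : F := nth 0 (enum F) c.
exists (grid_poly d a); split=> [i|v v_size]; first exact: msize_grid_poly.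
have [hq|hq] := leqP #|F| B.
  apply: (leq_trans hq); rewrite mulnDl addnA; apply: leq_trans (leq_addl _ _).
  by rewrite leq_pmulr.
have a_inj i c1 c2 : (c1 < d i)%N -> (c2 < d i)%N -> a i c1 = a i c2 -> c1 = c2.
  have dq : (d i <= #|F|)%N.
    by apply: leq_trans (ltnW hq); rewrite /B (bigD1 i) //= -!addnA leq_addr.
  move=> h1 h2 /eqP; rewrite /a nth_uniq ?enum_uniq -?cardE; first by move/eqP.
  - exact: leq_trans dq.
  - exact: leq_trans dq.
  - by [].
pose w (p : 'I_D' * 'I_D') (i : 'I_k) := grid_pt a p.1 i - grid_pt a p.2 i.
have [||y hy] := @moment_curve_separates F ('I_D' * 'I_D')%type k w (fun p => p.1 != p.2).
- move=> [j j'] /= jj; apply/existsP; rewrite -negb_forall; apply: contra jj => /forallP h.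
  apply/eqP; apply: enum_val_inj; apply: val_inj; apply/mnmP => l.
  have := h l; rewrite /w /= subr_eq0 => /eqP; apply: a_inj; exact: boxP (enum_valP _).
- by apply: leq_ltn_trans hq; rewrite leq_addl.
pose u (i : 'I_k) := y ^+ i.
have u_sep : injective (fun j => \sum_i u i * @grid_pt F k d a j i).
  move=> j j' /= e; apply/eqP; apply: contraT => jj; have := hy (j, j') jj.
  rewrite (eq_bigr (fun i => u i * grid_pt a j i - u i * grid_pt a j' i)).
    by rewrite sumrB e subrr eqxx.
  by move=> i _; rewrite mulrBr.
have h0 := elim_det0 N v (grid_poly_lead d a).
have := hc F (grid_charpoly d a v u) _ s (char_poly_monic _) (size_char_poly _)
  (size_grid_charpoly_coef d a v u) (grid_eta_inj (v := v) u_sep) (grid_charpoly0 v_size u_sep) hs1 hs2.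
move/leq_trans; apply; rewrite -DE.
set S := split_points _ _; set G := [set t | _].
set h := fun_det _ in h0.
have hh : (#|[set t | h.[t] == 0%R]| <= #|{: I}|)%N.
  apply: card_roots_leq; first by apply: contraNneq h0 => ->; rewrite horner0.
  rewrite -[#|_|]muln1; apply: size_fun_det => b b'; exact: size_elim.
have SG : (#|S| <= #|G| + #|{: I}|)%N.
  apply: leq_trans (leq_add (leqnn _) hh); apply: leq_trans (leq_card_setU _ _).
  apply: subset_leq_card; apply/subsetP => t tS; rewrite !inE.
  have [|ht] := boolP (h.[t] == 0); first by rewrite orbT.
  rewrite orbF; apply/eqP; rewrite -[RHS](card_grid_zeros a_inj d0 v_size u_sep ht tS).
  apply: eq_card => x; rewrite !inE; apply: eq_forallb => i; by rewrite sys_evalE.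
apply: (@leq_trans (D'`! * (#|G| + #|{: I}|) + c * s)%N); first by rewrite leq_add2r leq_mul2l SG orbT.
rewrite mulnDr !mulnDl -addnA leq_add2l addnC -addnA leq_add2l.
by apply: leq_trans (leq_addr _ _); rewrite leq_pmulr.
Qed.

(** * Averaging over the lines through a split system *)

Lemma floor_sqrt_exists n : exists s, (s * s <= n)%N /\ (n < s.+1 * s.+1)%N.
Proof.
elim: n => [|n [s [h1 h2]]]; first by exists 0%N.
have [h|h] := leqP (s.+1 * s.+1) n.+1.
  by exists s.+1; split=> //; move: h2; rewrite !mulSn !mulnS; lia.
by exists s; split=> //; apply: leqW.
Qed.

Lemma msize_poly_of (F : finFieldType) k d (c : coeffs F k d) : (msize (poly_of F k d c) <= d.+1)%N.
Proof.
apply: leq_trans (mmeasure_sum _ _ _ _) _; apply/bigmax_leqP => m _.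
apply: leq_trans (msizeZ_le _ _) _.
by rewrite mmeasureX; exact: (valP m).
Qed.

Lemma poly_of_mcoeff (F : finFieldType) k d (p : {mpoly F[k]}) : (msize p <= d.+1)%N ->
  poly_of F k d [ffun m : 'X_{1..k < d.+1} => p@_m] = p.
Proof. by move=> h; rewrite [RHS](mpolywE h); apply: eq_bigr => m _; rewrite ffunE. Qed.

Section Lines.
Variables (F : finFieldType) (k : nat) (d : 'I_k -> nat).
Notation W := (sample F k d).

Definition on_line (w v : W) (t : F) : W :=
  [ffun i => [ffun m => w i m + t * v i m]].

Lemma poly_of_on_line w v t i :
  poly_of F k (d i) (on_line w v t i) = poly_of F k (d i) (w i) + t *: poly_of F k (d i) (v i).
Proof.
rewrite /poly_of scaler_sumr -big_split; apply: eq_bigr => m _ /=.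
by rewrite !ffunE scalerDl scalerA.
Qed.

Lemma on_line_inj w t : t != 0 -> injective (fun v => on_line w v t).
Proof.
move=> t0 v v' /ffunP e; apply/ffunP => i; apply/ffunP => m.
by have := e i; rewrite !ffunE => /ffunP/(_ m); rewrite !ffunE => /addrI/(mulfI t0).
Qed.

Lemma average_over_lines (w : W) (S : {set W}) E C :
  (forall v, (#|F| <= E * #|[set t | on_line w v t \in S]| + C)%N) ->
  (#|F| * #|{: W}| <= E * (#|{: W}| + #|F| * #|S|) + C * #|{: W}|)%N.
Proof.
move=> h.
have {h} : (\sum_(v : W) #|F| <= \sum_(v : W) (E * #|[set t | on_line w v t \in S]| + C))%N.
  by apply: leq_sum.
rewrite big_split /= -big_distrr /= !sum_nat_const mulnC => /leq_trans; apply.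
rewrite [X in (_ + X <= _)%N]mulnC leq_add2r leq_mul2l; apply/orP; right.
pose n (v : W) t : nat := on_line w v t \in S.
have -> : (\sum_v #|[set t | on_line w v t \in S]| = \sum_t \sum_v n v t)%N.
  rewrite exchange_big /=; apply: eq_bigr => v _.
  by rewrite -sum1dep_card big_mkcond; apply: eq_bigr => t _; rewrite /n; case: (_ \in S).
have nE t : (\sum_v n v t = #|[set v | on_line w v t \in S]|)%N.
  by rewrite -sum1dep_card [RHS]big_mkcond; apply: eq_bigr => v _; rewrite /n; case: (_ \in S).
(* At [t = 0] every line passes through [w], so no averaging takes place; this single parameter
   costs at most one full count of the sample space. *)
rewrite (bigD1 0) //=; apply: leq_add; first by rewrite nE; apply: max_card.
apply: (@leq_trans (\sum_(t | t != 0%R) #|S|)%N).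
  apply: leq_sum => t t0; rewrite nE -(card_imset _ (@on_line_inj w t t0)).
  by apply: subset_leq_card; apply/subsetP => _ /imsetP[v + ->]; rewrite inE.
by rewrite sum_nat_const leq_mul2r max_card orbT.
Qed.
End Lines.

(** * From counts to real probabilities *)

Lemma INR_leq m n : (m <= n)%N -> Rle (INR m) (INR n).
Proof. by move=> /leP; apply: le_INR. Qed.

Close Scope ring_scope.

(** Division by [E * q * W] leaves the error [(c * s + E) / q], which is at most [(c + E) / sqrt q]
    because [s <= sqrt q] and [1 <= sqrt q]. *)
Lemma ratio_lower_bound (q s E c W S : nat) : (0 < E)%N -> (0 < W)%N -> (0 < s)%N -> (s * s <= q)%N ->
  (q * W <= E * (W + q * S) + c * s * W)%N ->
  Rle (Rdiv (Rminus 1 (Rdiv (INR (c + E)) (sqrt (INR q)))) (INR E)) (Rdiv (INR S) (INR W)).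
Proof.
move=> /ltP/lt_INR E0 /ltP/lt_INR W0 /leP/le_INR s1 /INR_leq hs /INR_leq h.
move: hs h (pos_INR q) (pos_INR S) (pos_INR c).
rewrite plus_INR -!(multE, plusE) !(plus_INR, mult_INR).
move: (INR q) (INR s) (INR E) (INR c) (INR W) (INR S) E0 W0 s1 => {q s E c W S} q s E c W S.
move=> E0 W0 s1 hs h q0 S0 c0; simpl in E0, W0, s1.
have ex := sqrt_sqrt q q0; have x0 := sqrt_pos q.
move: (sqrt q) ex x0 => x ex x0; subst q.
have sx : Rle s x by Lra.nra.
have key : Rle (Rmult (Rminus x (Rplus c E)) W) (Rmult (Rmult E S) x).
  have : Rle (Rmult x (Rmult (Rminus x (Rplus c E)) W)) (Rmult x (Rmult (Rmult E S) x)).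
    have : Rle (Rmult (Rmult c s) W) (Rmult (Rmult c x) W) by apply: Rmult_le_compat_r; [Lra.lra|apply: Rmult_le_compat_l].
    have : Rle (Rmult E W) (Rmult (Rmult x E) W) by apply: Rmult_le_compat_r; Lra.nra.
    by Lra.lra.
  by apply: Rmult_le_reg_l; Lra.lra.
apply: (Rmult_le_reg_l (Rmult (Rmult x E) W)); first by do 2!(apply: Rmult_lt_0_compat; try Lra.lra).
have := Rinv_r x; have := Rinv_r E; have := Rinv_r W; rewrite /Rdiv.
move: (Rinv x) (Rinv E) (Rinv W) => ix iE iW hW hE hx.
have {}hW : Rmult W iW = R1 by apply: hW; Lra.lra.
have {}hE : Rmult E iE = R1 by apply: hE; Lra.lra.
have {}hx : Rmult x ix = R1 by apply: hx; Lra.lra.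
have -> : Rmult (Rmult (Rmult x E) W) (Rmult (Rminus 1 (Rmult (Rplus c E) ix)) iE) = Rmult (Rminus x (Rplus c E)) W.
  transitivity (Rmult (Rmult (Rmult E iE) W) (Rminus x (Rmult (Rplus c E) (Rmult x ix)))).
    by Lra.lra.
  by rewrite hE hx; Lra.lra.
have -> : Rmult (Rmult (Rmult x E) W) (Rmult S iW) = Rmult (Rmult (Rmult E S) x) (Rmult W iW) by Lra.lra.
by rewrite hW Rmult_1_r; exact: key.
Qed.

Theorem theorem4p4 (k : nat) (d : 'I_k -> nat) :
  (0 < k)%N -> (forall i, (0 < d i)%N) ->
  exists c : R, Rlt 0 c /\
    forall F : finFieldType,
      Rle (Rdiv (Rminus 1 (Rdiv c (sqrt (INR #|F|)))) (INR ((\prod_(i < k) d i)`!)))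
          (prob_exact F k d).
Proof.
move=> _ d0; have [c hc] := line_lower_bound d0.
set D := (\prod_i d i)%N in hc *.
(* [c] is the loss on each line and the factorial is the loss at [t = 0]; the latter also makes the
   sum positive. *)
exists (INR (c + D`!)); split; first by apply: (lt_INR 0); apply/ltP; rewrite addn_gt0 fact_gt0 orbT.
move=> F; have [s [hs1 hs2]] := floor_sqrt_exists #|F|.
have s1 : (0 < s)%N by case: s hs1 hs2 => // _; rewrite mul1n ltnNge (ltnW (finNzRing_gt1 F)).
have [fs [fs_size hfs]] := hc F s hs1 hs2.
pose w : sample F k d := [ffun i => [ffun m : 'X_{1..k < (d i).+1} => ((fs i)@_m)%R]].
pose S := [set w : sample F k d | #|Fzeros F k d w| == D].
rewrite /prob_exact -/D -/S cardsT.
apply: (@ratio_lower_bound _ s) => //; first exact: fact_gt0.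
  by apply/card_gt0P; exists w.
apply: (@average_over_lines F k d w) => v.
have := hfs (fun i => poly_of F k (d i) (v i)) (fun i => msize_poly_of _).
move/leq_trans; apply; rewrite leq_add2r leq_mul2l; apply/orP; right.
apply: eq_leq; apply: eq_card => t; rewrite !inE; congr (_ == D).
apply: eq_card => x; rewrite !inE; apply: eq_forallb => i.
by rewrite poly_of_on_line /w ffunE poly_of_mcoeff.
Qed.
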